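(* Let $m\ge1$. For $j=1,\dots,m$ let $1\le\theta_j\le+\infty$, $1\le\tau_j<+\infty$, $0<r_j<+\infty$, let $X(\varphi_j)$ be a symmetric space on $[0,1]$ with fundamental function $\varphi_j$, and let $\psi_j$ be a $\Phi$-function, such that $1<\alpha_{\psi_j}\le\beta_{\psi_j}<\alpha_{\varphi_j}\le\beta_{\varphi_j}<2$. Suppose that for $j=1,\dots,m$ $$\Bigl[\sum_{s_j=0}^{\infty}\Bigl(\frac{\psi_j(2^{-s_j})}{\varphi_j(2^{-s_j})}\,2^{-s_jr_j}\Bigr)^{\varepsilon_j}\Bigr]^{1/\varepsilon_j}<+\infty,$$ where, with $\beta_j=\theta_j/\tau_j$, one puts $\varepsilon_j=\tau_j\beta_j'$, $\beta_j'=\frac{\beta_j}{\beta_j-1}$ if $\beta_j>1$ (with $\beta_j'=1$ if $\beta_j=\infty$), and $\varepsilon_j=+\infty$ if $\theta_j\le\tau_j$ (for $\varepsilon_j=+\infty$ the expression above is read as the supremum over $s_j$). Then $S^{\bar r}_{X(\bar\varphi),\bar\theta}B\subset L^*_{\bar\psi,\bar\tau}(\mathbb{T}^m)$, and there is a constant $C>0$ independent of $f$ such that $$\|f\|^*_{\bar\psi,\bar\tau}\le C\,\|f\|_{S^{\bar r}_{X(\bar\varphi),\bar\theta}B}$$ for every $f\in S^{\bar r}_{X(\bar\varphi),\bar\theta}B$.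
   Context: $\mathbb{T}^m=[0,2\pi]^m$, $I^m=[0,1]^m$, $\mathbb{Z}_+=\{0,1,2,\dots\}$. Functions $f$ on $\mathbb{T}^m$ are measurable and $2\pi$-periodic in each variable. $\Phi$-function: a concave, non-decreasing, continuous function $\varphi$ on $[0,1]$ with $\varphi(0)=0$ (not identically zero). Put $\alpha_\varphi=\liminf_{t\to0}\varphi(2t)/\varphi(t)$ and $\beta_\varphi=\limsup_{t\to0}\varphi(2t)/\varphi(t)$. Rearrangement: for a nonnegative measurable $g$ on $[0,1]$, $g^*(t)=\inf\{\lambda>0:\mu\{x: g(x)>\lambda\}<t\}$, $\mu$ being Lebesgue measure. Symmetric space on $[0,1]$: a Banach space $X$ of Lebesgue measurable functions on $[0,1]$ such that (1) $|f|\le|g|$ a.e. and $g\in X$ imply $f\in X$ and $\|f\|_X\le\|g\|_X$; (2) if $g$ is measurable, $f\in X$ and $|f|,|g|$ are equimeasurable, then $g\in X$ and $\|g\|_X=\|f\|_X$. Its fundamental function is $\varphi(t)=\|\chi_{[0,t]}\|_X$, taken to be a $\Phi$-function; the space is then denoted $X(\varphi)$. Anisotropic symmetric space: for $\bar\varphi=(\varphi_1,\dots,\varphi_m)$, $X(\bar\varphi)$ is the space of functions $f$ on $\mathbb{T}^m$ with finite norm $\|f\|^*_{X(\bar\varphi)}=\|\cdots\|f^{*_1,\dots,*_m}\|_{X(\varphi_1)}\cdots\|_{X(\varphi_m)}$, where $f^{*_1,\dots,*_m}(t_1,\dots,t_m)$ is obtained from $|f(2\pi\bar x)|$, $\bar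 x\in I^m$, by taking the non-increasing rearrangement successively in $x_1$, then $x_2$, ..., then $x_m$, each time with the other variables fixed, and the norm of $X(\varphi_j)$ is applied in the variable $t_j$ (first $t_1$, ..., last $t_m$). $\overset{\circ}{X}(\bar\varphi)$ is the subset of $f\in X(\bar\varphi)$ with $\int_0^{2\pi}f(\bar x)\,dx_j=0$ for every $j$. Generalized anisotropic Lorentz space: $L^*_{\bar\psi,\bar\tau}(\mathbb{T}^m)$ is the set of $f$ with finite $$\|f\|^*_{\bar\psi,\bar\tau}=\Bigl[\int_0^1\psi_m^{\tau_m}(t_m)\Bigl[\cdots\Bigl[\int_0^1\psi_1^{\tau_1}(t_1)\bigl(f^{*_1,\dots,*_m}(t_1,\dots,t_m)\bigr)^{\tau_1}\frac{dt_1}{t_1}\Bigr]^{\tau_2/\tau_1}\cdots\Bigr]^{\tau_m/\tau_{m-1}}\frac{dt_m}{t_m}\Bigr]^{1/\tau_m}.$$ Dyadic blocks: $a_{\bar n}(f)$ are the Fourier coefficients of $f$ with respect to $\{e^{i\langle\bar n,\bar x\rangle}\}_{\bar n\in\mathbb{Z}^m}$; $\rho(\bar s)=\{\bar k\in\mathbb{Z}^m: 2^{s_j-1}\le|k_j|<2^{s_j},\ j=1,\dots,m\}$; $\delta_{\bar s}(f,\bar x)=\sum_{\bar n\in\rho(\bar s)}a_{\bar n}(f)e^{i\langle\bar n,\bar x\rangle}$ (an empty sum is $0$). Mixed sequence norm: $\|\{a_{\bar s}\}\|_{l_{\bar\theta}}=\bigl\{\sum_{s_m}\bigl[\cdots\bigl[\sum_{s_1}|a_{\bar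 s}|^{\theta_1}\bigr]^{\theta_2/\theta_1}\cdots\bigr]^{\theta_m/\theta_{m-1}}\bigr\}^{1/\theta_m}$, sums over $s_j\in\mathbb{Z}_+$, with the $j$-th $\ell_{\theta_j}$-norm replaced by a supremum if $\theta_j=\infty$. Nikol'skii--Besov class: for $f\in\overset{\circ}{X}(\bar\varphi)$ put $$\|f\|_{S^{\bar r}_{X(\bar\varphi),\bar\theta}B}=\|f\|^*_{X(\bar\varphi)}+\Bigl\|\Bigl\{\prod_{j=1}^m2^{s_jr_j}\|\delta_{\bar s}(f)\|^*_{X(\bar\varphi)}\Bigr\}_{\bar s\in\mathbb{Z}_+^m}\Bigr\|_{l_{\bar\theta}};$$ the class $S^{\bar r}_{X(\bar\varphi),\bar\theta}B$ is the set of $f\in\overset{\circ}{X}(\bar\varphi)$ with $\|f\|_{S^{\bar r}_{X(\bar\varphi),\bar\theta}B}\le1$. *)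

(* Defs.v *)
From HB Require Import structures.
From mathcomp Require Import all_boot all_order all_algebra.
From mathcomp Require Import complex.
From mathcomp Require Import all_classical all_reals all_analysis.
From mathcomp Require Import measurable_realfun.

Set Implicit Arguments.
Unset Strict Implicit.
Unset Printing Implicit Defensive.

Import Order.TTheory GRing.Theory Num.Theory.
Import numFieldNormedType.Exports.

Local Open Scope classical_set_scope.
Local Open Scope ring_scope.

(** * Lebesgue measure and Lebesgue measurability *)

(* Product of n copies of the Lebesgue measure, by integrating the measures of
   the sections; n = 0 is the unit mass on the one-point space. *)
Fixpoint lebesgue_tuple (R : realType) (n : nat) :
    set (n.-tuple R) -> \bar R :=
  match n with
  | 0 => fun A => \d_[tuple] A
  | n'.+1 => fun A => (\int[lebesgue_measure]_u
              lebesgue_tuple [set x : n'.-tuple R | A [tuple of u :: x]])%E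
  end.

(* [completed_algebra_gen mu] consists of the sets A `|` N with A measurable and
   N contained in a null set: for the Lebesgue measure on the Borel sets, these
   are the Lebesgue measurable sets. *)
Definition lebesgue_measurable_fun d (T : measurableType d) (R : realType)
    (mu : set T -> \bar R) (D : set T) (f : T -> R) : Prop :=
  forall B : set R, measurable B -> completed_algebra_gen mu (D `&` f @^-1` B).

(** * Phi-functions *)

Definition Phi_function (R : realType) (phi : R -> R) : Prop :=
  [/\ forall x y l : R, x \in `[0, 1] -> y \in `[0, 1] -> l \in `[0, 1] ->
        l * phi x + (1 - l) * phi y <= phi (l * x + (1 - l) * y),
      forall x y : R, x \in `[0, 1] -> y \in `[0, 1] -> x <= y -> phi x <= phi y,
      {within `[0, 1], continuous phi},
      phi 0 = 0 &
      exists2 t, t \in `[0, 1] & phi t != 0].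

Definition dil_lower (R : realType) (phi : R -> R) : \bar R :=
  limf_einf (fun t : R => (phi (2 * t) / phi t)%:E) 0^'+.

Definition dil_upper (R : realType) (phi : R -> R) : \bar R :=
  limf_esup (fun t : R => (phi (2 * t) / phi t)%:E) 0^'+.

(** * Symmetric spaces on [0, 1] *)

Definition ae_unit (R : realType) (P : R -> Prop) : Prop :=
  {ae @lebesgue_measure R, forall x, x \in `[0, 1] -> P x}.

Definition measurable_unit (R : realType) (f : R -> R) : Prop :=
  lebesgue_measurable_fun (@lebesgue_measure R) `[0, 1] f.

Definition equimeasurable (R : realType) (f g : R -> R) : Prop :=
  forall l : R, lebesgue_measure (`[0, 1]%classic `&` [set x | l < f x]) =
                lebesgue_measure (`[0, 1]%classic `&` [set x | l < g x]).

(* Elements are functions rather than classes modulo a.e. equality on [0, 1],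
   hence the a.e. equality in [ss_norm_eq0]; values outside [0, 1] are
   irrelevant by [ss_ideal].  [ss_norm] is meaningful on [ss_mem] only. *)
Record symmetric_space (R : realType) := SymmetricSpace {
  ss_mem : set (R -> R) ;
  ss_norm : (R -> R) -> R ;
  ss_measurable : forall f, ss_mem f -> measurable_unit f ;
  ss_mem0 : ss_mem (fun=> 0) ;
  ss_memD : forall f g, ss_mem f -> ss_mem g -> ss_mem (fun x => f x + g x) ;
  ss_memZ : forall (a : R) f, ss_mem f -> ss_mem (fun x => a * f x) ;
  ss_norm_ge0 : forall f, ss_mem f -> 0 <= ss_norm f ;
  ss_norm_eq0 : forall f, ss_mem f ->
    (ss_norm f = 0 <-> ae_unit (fun x => f x = 0)) ;
  ss_normD : forall f g, ss_mem f -> ss_mem g ->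
    ss_norm (fun x => f x + g x) <= ss_norm f + ss_norm g ;
  ss_normZ : forall (a : R) f, ss_mem f ->
    ss_norm (fun x => a * f x) = `|a| * ss_norm f ;
  ss_complete : forall u : nat -> R -> R, (forall n, ss_mem (u n)) ->
    (forall e : R, 0 < e -> exists N : nat, forall p q : nat,
      (N <= p)%N -> (N <= q)%N -> ss_norm (fun x => u p x - u q x) < e) ->
    exists2 f, ss_mem f &
      (fun n => ss_norm (fun x => u n x - f x)) @ \oo --> (0 : R) ;
  ss_ideal : forall f g, measurable_unit f -> ss_mem g ->
    ae_unit (fun x => `|f x| <= `|g x|) ->
    ss_mem f /\ ss_norm f <= ss_norm g ;
  ss_symmetric : forall f g, measurable_unit g -> ss_mem f ->
    equimeasurable (fun x => `|f x|) (fun x => `|g x|) ->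
    ss_mem g /\ ss_norm g = ss_norm f
}.

Definition fundamental_function (R : realType) (X : symmetric_space R)
    (phi : R -> R) : Prop :=
  forall t : R, t \in `[0, 1] ->
    let chi := \1_(`[0, t]%classic : set R) in
    ss_mem X chi /\ phi t = ss_norm X chi.

(* The norm with value +oo outside the space, for extended real functions. *)
Definition ss_enorm (R : realType) (X : symmetric_space R) (g : R -> \bar R) :
    \bar R :=
  if `[< ae_unit (fun x => g x \is a fin_num) /\ ss_mem X (fine \o g) >]
  then (ss_norm X (fine \o g))%:E else +oo%E.

(** * Operations applied in one variable after the other *)

Definition upd (T : Type) (m : nat) (x : m.-tuple T) (j : 'I_m) (u : T) :
    m.-tuple T :=
  [tuple if i == j then u else tnth x i | i < m].

(* For j = 0, ..., m - 1 in this order, replaces F, viewed as a function of its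
   j-th variable (the others being fixed), by its image under A j.  When A j
   takes values in constant functions (norms), the result is constant. *)
Definition successively (T V : Type) (m : nat)
    (A : 'I_m -> (T -> V) -> T -> V) (F : m.-tuple T -> V) : m.-tuple T -> V :=
  foldl (fun G j x => A j (fun u => G (upd x j u)) (tnth x j)) F (enum 'I_m).

Definition mixed_norm (T V : Type) (x0 : T) (m : nat)
    (N : 'I_m -> (T -> V) -> V) (F : m.-tuple T -> V) : V :=
  successively (fun j g => fun=> N j g) F [tuple x0 | i < m].

(** * Rearrangements *)

(* [lebesgue_measure] is total: it is the outer measure on arbitrary sets. *)
Definition rearrangement (R : realType) (g : R -> \bar R) (t : R) : \bar R :=
  ereal_inf [set l%:E | l in [set l : R | 0 < l /\
    (lebesgue_measure (`[0%R, 1%R]%classic `&` [set x | l%:E < g x]) < t%:E)%E]].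

Definition iterated_rearrangement (R : realType) (m : nat)
    (f : m.-tuple R -> R[i]) : m.-tuple R -> \bar R :=
  successively (fun=> @rearrangement R)
    (fun x => (Normc.normc (f [tuple 2 * pi * tnth x i | i < m]))%:E).

(** * Function spaces on the torus *)

Definition torus_function (R : realType) (m : nat) (f : m.-tuple R -> R[i]) :
    Prop :=
  [/\ lebesgue_measurable_fun (@lebesgue_tuple R m) setT
        (fun x => complex.Re (f x)),
      lebesgue_measurable_fun (@lebesgue_tuple R m) setT
        (fun x => complex.Im (f x)) &
      forall x j, f (upd x j (tnth x j + 2 * pi)) = f x].

Definition aniso_norm (R : realType) (m : nat) (X : 'I_m -> symmetric_space R)
    (f : m.-tuple R -> R[i]) : \bar R :=
  mixed_norm 0 (fun j => ss_enorm (X j)) (iterated_rearrangement f).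

Definition aniso_space (R : realType) (m : nat) (X : 'I_m -> symmetric_space R) :
    set (m.-tuple R -> R[i]) :=
  [set f | torus_function f /\ (aniso_norm X f < +oo)%E].

(* Intended for functions whose real and imaginary parts are integrable. *)
Definition cintegral d (T : measurableType d) (R : realType)
    (mu : set T -> \bar R) (D : set T) (f : T -> R[i]) : R[i] :=
  (fine (\int[mu]_(x in D) (complex.Re (f x))%:E)%E +i*
   fine (\int[mu]_(x in D) (complex.Im (f x))%:E)%E)%C.

Definition aniso_space0 (R : realType) (m : nat)
    (X : 'I_m -> symmetric_space R) : set (m.-tuple R -> R[i]) :=
  [set f | aniso_space X f /\ forall j,
    {ae @lebesgue_tuple R m, forall x,
      cintegral lebesgue_measure `[0, 2 * pi] (fun u => f (upd x j u)) = 0}].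

Definition lorentz_norm1 (R : realType) (psi : R -> R) (tau : R)
    (g : R -> \bar R) : \bar R :=
  ((\int[lebesgue_measure]_(t in `[0%R, 1%R])
     ((psi t `^ tau)%:E * g t `^ tau * (t^-1)%:E)) `^ tau^-1)%E.

Definition lorentz_norm (R : realType) (m : nat) (psi : 'I_m -> R -> R)
    (tau : 'I_m -> R) (f : m.-tuple R -> R[i]) : \bar R :=
  mixed_norm 0 (fun j => lorentz_norm1 (psi j) (tau j))
    (iterated_rearrangement f).

Definition lorentz_space (R : realType) (m : nat) (psi : 'I_m -> R -> R)
    (tau : 'I_m -> R) : set (m.-tuple R -> R[i]) :=
  [set f | torus_function f /\ (lorentz_norm psi tau f < +oo)%E].

(** * Dyadic blocks and Nikol'skii--Besov classes *)

Definition character (R : realType) (m : nat) (n : m.-tuple int)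
    (x : m.-tuple R) : R[i] :=
  let a := \sum_(j < m) (tnth n j)%:~R * tnth x j in (cos a +i* sin a)%C.

Definition torus (R : realType) (m : nat) : set (m.-tuple R) :=
  [set x | forall j, tnth x j \in `[0, 2 * pi]].

Definition fourier_coef (R : realType) (m : nat) (f : m.-tuple R -> R[i])
    (n : m.-tuple int) : R[i] :=
  (((2 * pi) ^- m)%:C)%C *
  cintegral (@lebesgue_tuple R m) (@torus R m)
    (fun x => f x * ((character n x)^*)%C).

Definition rho (R : realType) (m : nat) (s : m.-tuple nat) :
    set (m.-tuple int) :=
  [set k | forall j, (2 : R) ^ ((tnth s j)%:Z - 1) <= `|tnth k j|%:~R
                     < (2 : R) ^ (tnth s j)%:Z].

Definition dyadic_block (R : realType) (m : nat) (s : m.-tuple nat)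
    (f : m.-tuple R -> R[i]) (x : m.-tuple R) : R[i] :=
  \sum_(n \in rho R s) fourier_coef f n * character n x.

(* Only used for 0 < theta <= +oo. *)
Definition seq_norm (R : realType) (theta : \bar R) (a : nat -> \bar R) :
    \bar R :=
  match theta with
  | th%:E => ((\sum_(k <oo) `|a k| `^ th) `^ th^-1)%E
  | +oo%E => ereal_sup (range (fun k => `|a k|%E))
  | -oo%E => 0%E
  end.

Definition mixed_seq_norm (R : realType) (m : nat) (theta : 'I_m -> \bar R)
    (a : m.-tuple nat -> \bar R) : \bar R :=
  mixed_norm 0%N (fun j => seq_norm (theta j)) a.

Definition besov_norm (R : realType) (m : nat) (X : 'I_m -> symmetric_space R)
    (r : 'I_m -> R) (theta : 'I_m -> \bar R) (f : m.-tuple R -> R[i]) : \bar R :=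
  (aniso_norm X f +
   mixed_seq_norm theta (fun s =>
     (\prod_(j < m) 2 `^ ((tnth s j)%:R * r j))%:E *
     aniso_norm X (dyadic_block s f)))%E.

Definition besov_class (R : realType) (m : nat) (X : 'I_m -> symmetric_space R)
    (r : 'I_m -> R) (theta : 'I_m -> \bar R) : set (m.-tuple R -> R[i]) :=
  [set f | aniso_space0 X f /\ (besov_norm X r theta f <= 1)%E].

(* With b = theta / tau: epsilon = tau b' where b' = b / (b - 1) if b > 1
   (b' = 1 if b = +oo), and epsilon = +oo if b <= 1. *)
Definition epsilon (R : realType) (theta : \bar R) (tau : R) : \bar R :=
  match theta with
  | th%:E => let b := th / tau in
             if 1 < b then (tau * (b / (b - 1)))%:E else +oo%E
  | _ => tau%:E
  end.

(* Main.v *)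
Require Import Defs.
From HB Require Import structures.
From mathcomp Require Import all_boot all_order all_algebra.
From mathcomp Require Import complex.
From mathcomp Require Import all_classical all_reals all_analysis.
From mathcomp Require Import measurable_realfun.
From mathcomp Require Import ring lra zify.

(** Write [star F] for the iterated rearrangement of [F] and [A s] for the norm of
the dyadic block [delta_s f] in the anisotropic symmetric space.  The norms
are used through their fundamental functions only: a function at least [c] on
[0, t] has norm at least [c * phi t], so that, one variable after the other,
[star F t] is at most the norm of [F] divided by [\prod_j phi_j (t_j)]
([star_weak_type]).  The embedding comes from three facts.

- Representation.  As [beta_phi < 2], the sum of [2^-k / phi_j (2^-k)] is
  finite, and the weak-type bound controls the integral over the torus
  ([integral_torus_star]).  The [A s] decay geometrically because [r_j > 0];
  hence the series of the blocks converges absolutely almost everywhere and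
  has the Fourier coefficients of [f], those with a vanishing index being zero
  on both sides since [f] has mean zero in every variable.  By uniqueness of
  Fourier coefficients, |f| is at most the sum of the |delta_s f| outside a
  null set ([dyadic_representation]).

- Blocks are flat at scale [2^-s].  A block is a trigonometric polynomial of
  degree less than [2^(s_j)] in the variable [j].  A sampling formula with a
  rapidly decaying kernel bounds its supremum over a cell of side
  [2^-(s_j)], up to a constant, by a weighted sum of its translates; therefore
  a majorant of the block satisfies the weak-type bound with [t_j] replaced by
  [max (t_j, 2^-(s_j))] ([star_cell_sup]).

- Subadditivity with loss.  If the weights [v_s] add up to less than 1, the
  rearrangement at [t] of a sum is at most the sum of the rearrangements of
  its terms at [v_s t] ([star_esum]).  For [t] in the dyadic box [k], the
  weights are chosen as multiples of [rho ^ |k - s|].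

Altogether, on the box [k], [star f] is at most a constant times the sum over
[s] of
   [A s * rho ^ (- n |k - s|) / \prod_j phi_j (max (2^-k_j, 2^-s_j))]
([star_expansion]).  The dilation indices make
[psi_j (2^-k) / phi_j (max (2^-k, 2^-s))] smaller than its value at [k = s] by
a factor [q ^ |k - s|] with [q < 1], up to a constant: for [k > s] because
[alpha_psi > 1], for [k < s] because [beta_psi < alpha_phi]
([dilation_kernel]).  With
[rho ^ (2 n) >= q], half of this decay pays for the weights and the other half
leaves a geometric kernel, which is bounded on mixed sequence spaces
([geom_ker_bounded]).  The Lorentz norm is dominated by a mixed sequence norm
over the boxes ([lorentz_mixed_dyadic]), and Hoelder's inequality in each index
([mixed_seq_hoelder]), with the exponents [epsilon theta tau] of the summability
hypothesis, turns it into the Besov norm ([lorentz_besov]).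

Rearrangements are defined by an outer measure and are studied as such: the
majorants, which are suprema over cells, need not be measurable. *)

Set Implicit Arguments.
Unset Strict Implicit.
Unset Printing Implicit Defensive.

Import Order.TTheory GRing.Theory Num.Theory.
Import numFieldNormedType.Exports.

Local Open Scope classical_set_scope.
Local Open Scope ring_scope.

Local Notation "u ::: x" := [tuple of u :: x] (at level 60, right associativity).

(** * Iterated operations, one coordinate at a time *)

Lemma upd_cons0 (T : Type) n (t u : T) (x : n.-tuple T) :
  upd (t ::: x) ord0 u = u ::: x.
Proof.
apply: eq_from_tnth => i; rewrite tnth_mktuple.
by case: (unliftP ord0 i) => [j ->|->]; rewrite ?tnthS ?eqxx ?tnth0//.
Qed.

Lemma upd_consS (T : Type) n (t u : T) (x : n.-tuple T) (j : 'I_n) :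
  upd (t ::: x) (lift ord0 j) u = t ::: upd x j u.
Proof.
apply: eq_from_tnth => i; rewrite tnth_mktuple.
case: (unliftP ord0 i) => [k ->|->]; rewrite ?tnthS ?tnth0//.
by rewrite tnth_mktuple (inj_eq lift_inj).
Qed.

(** Every induction on the number of variables goes through this lemma and
    [mixed_norm_cons]: the operation in the first variable acts first, with the
    other variables as parameters. *)
Lemma successively_cons (T V : Type) n (A : 'I_n.+1 -> (T -> V) -> T -> V)
    (F : n.+1.-tuple T -> V) (t : T) (x : n.-tuple T) :
  successively A F (t ::: x) =
  successively (fun j => A (lift ord0 j))
    (fun y => A ord0 (fun u => F (u ::: y)) t) x.
Proof.
have fold (H : n.+1.-tuple T -> V) (H' : n.-tuple T -> V) s :
    (forall y : n.-tuple T, H (t ::: y) = H' y) ->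
    foldl (fun G j x => A j (fun u => G (upd x j u)) (tnth x j)) H
      (map (lift ord0) s) (t ::: x) =
    foldl (fun G j x => A (lift ord0 j) (fun u => G (upd x j u)) (tnth x j)) H'
      s x.
  elim: s H H' => [|j s IH] H H' HH' /=; first exact: HH'.
  apply: IH => y; rewrite tnthS; congr (A _ _ _).
  by apply/funext => u; rewrite upd_consS HH'.
rewrite /successively enum_ordSl /=; apply: fold => y.
rewrite tnth0; congr (A _ _ _).
by apply/funext => u; rewrite upd_cons0.
Qed.

Lemma successively0 (T V : Type) (A : 'I_0 -> (T -> V) -> T -> V)
    (F : 0.-tuple T -> V) x : successively A F x = F [tuple].
Proof. rewrite (tuple0 x) /successively. by rewrite (size0nil (size_enum_ord 0)). Qed.

Lemma mktuple_cst_cons (T : Type) n (a : T) :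
  [tuple a | i < n.+1] = a ::: [tuple a | i < n].
Proof.
apply: eq_from_tnth => i; rewrite tnth_mktuple.
by case: (unliftP ord0 i) => [k ->|->]; rewrite ?tnthS ?tnth0 ?tnth_mktuple.
Qed.

Lemma mixed_norm_cons (T V : Type) (x0 : T) n (N : 'I_n.+1 -> (T -> V) -> V)
    (F : n.+1.-tuple T -> V) :
  mixed_norm x0 N F =
  mixed_norm x0 (fun j => N (lift ord0 j)) (fun y => N ord0 (fun u => F (u ::: y))).
Proof. by rewrite /mixed_norm mktuple_cst_cons successively_cons. Qed.

Lemma mixed_norm0 (T V : Type) (x0 : T) (N : 'I_0 -> (T -> V) -> V)
    (F : 0.-tuple T -> V) : mixed_norm x0 N F = F [tuple].
Proof. exact: successively0. Qed.

Section star.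
Context {R : realType}.

(** The iterated rearrangement as a recursion on the number of variables.  The
    first variable carries the rescaling from [0, 1] to the torus and is
    rearranged first; what remains is a function of fewer variables. *)
Fixpoint star (n : nat) : (n.-tuple R -> \bar R) -> n.-tuple R -> \bar R :=
  match n with
  | 0 => fun F _ => F [tuple]
  | n'.+1 => fun F t =>
      star (fun x => rearrangement (fun u => F (2 * pi * u ::: x)) (thead t))
        [tuple of behead t]
  end.

Lemma star_cons n (F : n.+1.-tuple R -> \bar R) t0 (t : n.-tuple R) :
  star F (t0 ::: t) =
  star (fun x => rearrangement (fun u => F (2 * pi * u ::: x)) t0) t.
Proof.
by rewrite /= theadE; congr (star _ _); apply: val_inj.
Qed.

Lemma successively_rearrangement n (F : n.-tuple R -> \bar R) t :
  successively (fun=> @rearrangement R)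
    (fun x => F [tuple 2 * pi * tnth x i | i < n]) t = star F t.
Proof.
elim: n F t => [|n IH] F t.
  by rewrite successively0 /=; congr (F _); exact: tuple0.
rewrite (tuple_eta t) successively_cons star_cons -IH.
congr (successively _ _ _); apply/funext => y; congr (rearrangement _ _).
apply/funext => u; congr (F _).
apply: eq_from_tnth => i; rewrite tnth_mktuple.
by case: (unliftP ord0 i) => [k ->|->]; rewrite ?tnthS ?tnth0 ?tnth_mktuple.
Qed.

Lemma iterated_rearrangementE n (f : n.-tuple R -> R[i]) t :
  iterated_rearrangement f t = star (fun x => (Normc.normc (f x))%:E) t.
Proof. by rewrite -successively_rearrangement. Qed.

End star.

(** * Rearrangements without measurability *)

Section outer.
Context {R : realType}.
Local Notation mu := (@lebesgue_measure R).
Local Open Scope ereal_scope.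

(** An outer measure is needed because the sets to which it applies are
    superlevel sets of arbitrary functions.  The preimage of an optimal cover of
    [A] by half-open intervals is a cover of the preimage of [A]. *)
Lemma lebesgue_outer_affine (A : set R) (c d : R) : (0 < c)%R ->
  mu [set u | A (c * u + d)%R] <= (c^-1)%:E * mu A.
Proof.
move=> c0.
suff : c%:E * mu [set u | A (c * u + d)%R] <= mu A.
  move=> /(@lee_wpmul2l _ (c^-1)%:E); rewrite muleA -EFinM mulVf ?gt_eqF//.
  by rewrite mul1e; apply; rewrite lee_fin invr_ge0 ltW.
apply: le_ereal_inf_tmp => _ [F [mF AF] <-].
pose F' k := [set u | F k (c * u + d)%R].
have lenF' k : measurable (F' k : set (ocitv_type R)) /\
    c%:E * wlength idfun (F' k : set (ocitv_type R)) =
    wlength idfun (F k : set (ocitv_type R)).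
  have /ocitvP[F0|[[a b] /= ab Fab]] := mF k.
    have -> : F' k = set0 by rewrite /F' F0.
    by rewrite F0 wlength0 mule0.
  have -> : F' k = `](c^-1 * (a - d))%R, (c^-1 * (b - d))%R]%classic.
    rewrite /F' Fab; apply/seteqP; split => u /=; rewrite !in_itv/=.
      move=> /andP[h1 h2].
      by rewrite ltr_pdivrMl// ler_pdivlMl// ltrBlDr lerBrDr h1.
    by rewrite ltr_pdivrMl// ler_pdivlMl// ltrBlDr lerBrDr.
  split; first exact: is_ocitv.
  rewrite Fab !wlength_itv/= !lte_fin ab ltr_pM2l ?invr_gt0// ltrD2r ab.
  rewrite -!EFinB -EFinM; congr EFin.
  by rewrite -mulrBr mulrA mulfV ?gt_eqF// mul1r opprB addrA subrK.
have A'F' : measurable_cover ([set u | A (c * u + d)%R] : set (ocitv_type R)) F'.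
  split=> [k|u /= /AF[k _ Fk]]; first exact: (lenF' k).1.
  by exists k.
rewrite (eq_eseriesr (fun k _ => esym (lenF' k).2)) nneseriesZl//.
  apply: lee_wpmul2l; first by rewrite lee_fin ltW.
  by apply: ereal_inf_lbound; exists F'.
Qed.

Lemma esum_pickle (T : countType) (a : T -> \bar R) : (forall i, 0 <= a i) ->
  \esum_(i in [set: T]) a i = \sum_(n <oo) oapp a 0 (@pickle_inv T n).
Proof.
move=> a0.
have b0 n : 0 <= oapp a 0 (@pickle_inv T n) by case: pickle_inv => /=.
rewrite nneseries_esumT//.
transitivity (\esum_(n in pickle @` [set: T]) oapp a 0 (@pickle_inv T n)).
  rewrite esum_image; last by move=> i j _ _; exact: (pcan_inj pickleK).
  by apply: eq_esum => i _; rewrite pickleK_inv.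
rewrite esum_mkcond; apply: eq_esum => n _; case: ifPn => // nT.
case E : pickle_inv => [i|]//=; exfalso; move/negP: nT; apply.
by rewrite inE; exists i => //; have := @pickle_invK T n; rewrite /= E.
Qed.

Lemma lebesgue_outer_le_esum (T : countType) (A : T -> set R) :
  mu (\bigcup_i A i) <= \esum_(i in [set: T]) mu (A i).
Proof.
rewrite esum_pickle//.
pose B n := oapp A set0 (@pickle_inv T n).
have AB : \bigcup_i A i `<=` \bigcup_n B n.
  by move=> x [i _ Aix]; exists (pickle i) => //; rewrite /B pickleK_inv.
apply: le_trans (le_outer_measure mu _ _ AB) _.
apply: le_trans (outer_measure_sigma_subadditive mu B) _.
apply: lee_nneseries => // n _; rewrite /B.
case: (@pickle_inv T n) => [i|]; first exact: lexx.
by rewrite [leLHS](measure0 mu).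
Qed.

End outer.

Section rearrangement1.
Context {R : realType}.
Local Notation mu := (@lebesgue_measure R).
Local Open Scope ereal_scope.
Implicit Types (g h : R -> \bar R) (t : R).

Lemma rearrangement_ge0 g t : 0 <= rearrangement g t.
Proof. by apply: le_ereal_inf_tmp => _ [l [l0 _] <-]; rewrite lee_fin ltW. Qed.

Lemma rearrangement_le g t l : (0 < l)%R ->
  mu (`[0%R, 1%R]%classic `&` [set x | l%:E < g x]) < t%:E ->
  rearrangement g t <= l%:E.
Proof. by move=> l0 gl; apply: ereal_inf_lbound; exists l. Qed.

(** The converse of [rearrangement_le], up to a strict inequality; together
    they let the rearrangement be handled as a generalized inverse of the
    distribution function. *)
Lemma rearrangement_lt g t l : rearrangement g t < l%:E -> (0 < l)%R /\
  mu (`[0%R, 1%R]%classic `&` [set x | l%:E < g x]) < t%:E.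
Proof.
move=> /ereal_inf_lt[_ [k [k0 gk] <-]]; rewrite lte_fin => kl.
split; first exact: lt_trans kl.
apply: le_lt_trans gk; apply: le_outer_measure.
move=> x [x01 /= gx]; split => //=; apply: le_lt_trans gx.
by rewrite lee_fin ltW.
Qed.

Lemma le_rearrangement g h t :
  (forall u, u \in `[0%R, 1%R] -> g u <= h u) ->
  rearrangement g t <= rearrangement h t.
Proof.
move=> gh; apply: ereal_inf_le_tmp => _ [l [l0 hl] <-]; exists l => //.
split => //; apply: le_lt_trans hl; apply: le_outer_measure.
by move=> x [/= x01 gx]; split => //=; apply: lt_le_trans gx _; exact: gh.
Qed.

Lemma rearrangement_anti g s t : (s <= t)%R ->
  rearrangement g t <= rearrangement g s.
Proof.
move=> st; apply: ereal_inf_le_tmp => _ [l [l0 hl] <-]; exists l => //.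
by split => //; apply: lt_le_trans hl _; rewrite lee_fin.
Qed.

(** If [l_i] exceeds the rearrangement of [g_i] at [v_i t], then [g_i] exceeds
    [l_i] on a set of measure less than [v_i t]; outside the union of these sets,
    whose measure is less than [t], the sum is at most the sum of the [l_i].
    The [l_i] are within a summable error of the rearrangements. *)
Lemma rearrangement_esum (T : countType) g (gi : T -> R -> \bar R) (v : T -> R) t :
  (0 < t)%R -> (forall i, (0 < v i)%R) ->
  \esum_(i in [set: T]) (v i)%:E < 1 ->
  (forall i u, 0 <= gi i u) ->
  (forall u, u \in `[0%R, 1%R] -> g u <= \esum_(i in [set: T]) gi i u) ->
  rearrangement g t <= \esum_(i in [set: T]) rearrangement (gi i) (v i * t)%R.
Proof.
move=> t0 v0 v1 gi0 ggi.
set S := \esum_(i in _) _.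
have S0 : 0 <= S by apply: esum_ge0 => i _; exact: rearrangement_ge0.
have [->|Sfin] := eqVneq S +oo; first exact: leey.
have gifin i : rearrangement (gi i) (v i * t) \is a fin_num.
  rewrite ge0_fin_numE ?rearrangement_ge0//.
  apply: (@le_lt_trans _ _ S); last by rewrite ltey.
  rewrite -(@esum_set1 _ _ i (fun i => rearrangement (gi i) (v i * t)%R));
    last exact: rearrangement_ge0.
  apply: esum_ge; exists [set i]; first by split.
  by rewrite esum_set1 ?rearrangement_ge0// fsbig_set1.
apply/lee_addgt0Pr => e e0.
(* The weights of an arbitrary countable family, summing to at most e. *)
pose w (i : T) := (e / (2 ^ (pickle i).+1)%:R)%R.
have w0 i : (0 < w i)%R by rewrite divr_gt0// ltr0n expn_gt0.
pose l i := (fine (rearrangement (gi i) (v i * t)) + w i)%R.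
have lE i : (l i)%:E = rearrangement (gi i) (v i * t) + (w i)%:E.
  by rewrite EFinD fineK.
have wS : \esum_(i in [set: T]) (w i)%:E <= e%:E.
  rewrite esum_pickle; last by move=> i; rewrite lee_fin ltW.
  apply: le_trans (epsilon_trick0 predT (ltW e0)).
  apply: lee_nneseries => n _; first by case: pickle_inv => //= i; rewrite lee_fin ltW.
  have := @pickle_invK T n; case: pickle_inv => [i /= <-|_]//=.
  by rewrite lee_fin divr_ge0// ltW.
have lS : \esum_(i in [set: T]) (l i)%:E <= S + e%:E.
  rewrite (eq_esum (fun i _ => lE i)) esumD; last 2 first.
  - by move=> i _; exact: rearrangement_ge0.
  - by move=> i _; rewrite lee_fin ltW.
  by rewrite leeD2l.
have l0 i : (0 < l i)%R.
  by rewrite ltr_wpDl// fine_ge0// rearrangement_ge0.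
have Sefin : S + e%:E \is a fin_num by rewrite fin_numD// ge0_fin_numE// ltey Sfin.
have Se0 : (0 < fine (S + e%:E))%R.
  by rewrite fine_gt0// ltey_eq Sefin andbT (lt_le_trans _ (leeD2r _ S0))// add0e.
rewrite -[leRHS]fineK//; apply: rearrangement_le => //.
have cover : `[0%R, 1%R]%classic `&` [set x | (fine (S + e%:E))%:E < g x] `<=`
    \bigcup_i (`[0%R, 1%R]%classic `&` [set x | (l i)%:E < gi i x]).
  move=> x [/= x01]; rewrite fineK// => Sgx.
  apply: contrapT => nx; move: Sgx; apply/negP; rewrite -leNgt.
  apply: le_trans (ggi _ x01) _; apply: le_trans lS.
  apply: le_esum => i _; rewrite leNgt; apply/negP => lx.
  by apply: nx; exists i.
apply: le_lt_trans (le_outer_measure mu _ _ cover) _.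
apply: le_lt_trans (lebesgue_outer_le_esum _) _.
apply: (@le_lt_trans _ _ (\esum_(i in [set: T]) (v i * t)%:E)).
  apply: le_esum => i _; apply/ltW/(@rearrangement_lt _ _ (l i) _).2.
  by rewrite lE lteDl// lte_fin.
rewrite esum_pickle; last by move=> i; rewrite lee_fin ltW// mulr_gt0.
rewrite (eq_eseriesr (g := fun n => t%:E * oapp (fun i => (v i)%:E) 0 (@pickle_inv T n))).
  rewrite nneseriesZl//; last by move=> n _; case: pickle_inv => //= i; rewrite lee_fin ltW.
  rewrite -esum_pickle; last by move=> i; rewrite lee_fin ltW.
  by rewrite -[ltRHS]mule1 lte_pmul2l.
by move=> n _; case: pickle_inv => [i|] /=; rewrite ?mule0// muleC.
Qed.

End rearrangement1.

Section rearrangement2.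
Context {R : realType}.
Local Notation mu := (@lebesgue_measure R).
Local Open Scope ereal_scope.
Implicit Types (g h : R -> \bar R) (t : R).

Lemma lee_realP (x y : \bar R) : (forall l : R, x < l%:E -> y <= l%:E) -> y <= x.
Proof.
case: x => [x| |] h; first by apply/lee_addgt0Pr => e e0; apply: h; rewrite lte_fin ltrDl.
  exact: leey.
rewrite leeNy_eq; case: y h => [y| |] h //.
  by have := h (y - 1)%R (ltNyr _); rewrite lee_fin lerBrDr gerDl ler10.
by have := h 0%R (ltNyr _).
Qed.

Lemma rearrangement_scale g (c t : R) : (0 < c)%R ->
  rearrangement (fun u => c%:E * g u) t <= c%:E * rearrangement g t.
Proof.
move=> c0; apply: lee_realP => l.
rewrite -lte_pdivlMl// -EFinM => /rearrangement_lt[l0 gl].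
apply: rearrangement_le; first by move: l0; rewrite pmulr_rgt0// invr_gt0.
apply: le_lt_trans gl; apply: le_outer_measure => u [/= u01].
by rewrite EFinM lte_pdivrMl.
Qed.

(** The superlevel set of a translate splits into two pieces, before and after
    the period is exceeded; each is a translate of a part of the superlevel set
    of [g].  Halving [t] leaves room for both. *)
Lemma rearrangement_shift g (a t : R) : a \in `[0%R, 1%R] ->
  (forall u, g (u + 1)%R = g u) ->
  rearrangement (fun u => g (u + a)%R) t <= rearrangement g (t / 2).
Proof.
rewrite in_itv/= => /andP[a0 a1] per; apply: lee_realP => l /rearrangement_lt[l0 gl].
apply: rearrangement_le => //.
set A := _ `&` _ in gl.
have cover : `[0%R, 1%R]%classic `&` [set u | l%:E < g (u + a)%R] `<=`
    [set u | A (1 * u + a)%R] `|` [set u | A (1 * u + (a - 1))%R].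
  move=> u [/=]; rewrite in_itv/= => /andP[u0 u1] lu.
  have [ua1|ua1] := leP (u + a)%R 1%R; [left|right]; rewrite mul1r; split => //=.
  - by rewrite in_itv/= ua1 addr_ge0.
  - by rewrite in_itv/= addrA subr_ge0 (ltW ua1)/= lerBlDr lerD.
  - by rewrite addrA -per subrK.
apply: le_lt_trans (le_outer_measure mu _ _ cover) _.
apply: le_lt_trans (outer_measureU2 mu _ _) _.
apply: (@le_lt_trans _ _ (mu A + mu A)).
  apply: leeD; apply: le_trans (lebesgue_outer_affine _ _ _) _ => //.
    by rewrite invr1 mul1e.
  by rewrite invr1 mul1e.
rewrite (_ : t = t / 2 + t / 2)%R; last by rewrite -splitr.
by rewrite EFinD lteD.
Qed.

(** A function that is constant on intervals of length [L^-1] exceeds a level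
    either nowhere or on a set of measure at least [L^-1], up to the point 1,
    which is alone in its interval. *)
Lemma rearrangement_cell g (L : nat) t : (0 < L)%N -> (0 < t)%R ->
  (forall u v : R, Num.floor (L%:R * u) = Num.floor (L%:R * v) -> g u = g v) ->
  rearrangement g t <= rearrangement g (Num.max t L%:R^-1)%R.
Proof.
move=> L0 t0 gc; have [//|tL] := leP L%:R^-1%R t.
have LR : (0 < L%:R :> R)%R by rewrite ltr0n.
apply: lee_realP => l /rearrangement_lt[l0 gl].
apply: rearrangement_le => //.
(* All cells except the singleton of 1 have measure at least 1 / L. *)
apply: (@le_lt_trans _ _ (mu [set 1%R])); last first.
  by rewrite lebesgue_measure_set1 lte_fin.
apply: le_outer_measure => u [/=]; rewrite in_itv/= => /andP[u0 u1] lu.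
apply: contrapT => /eqP u1'; move: gl; apply/negP; rewrite -leNgt.
have ult : (u < 1)%R by rewrite lt_neqAle u1'.
pose k : R := (Num.floor (L%:R * u))%:~R.
have ku : (k <= L%:R * u)%R by exact: floor_le.
have k0 : (0 <= k)%R by rewrite ler0z floor_ge0 mulr_ge0.
have kL : (k + 1 <= L%:R)%R.
  rewrite /k -[L%:R]/((L%:Z)%:~R) -[X in (_ + X)%R]/(1%:~R) -intrD ler_int lezD1 floor_lt_int.
  by rewrite gtr_pMr.
apply: (@le_trans _ _ (mu `[(k / L%:R)%R, ((k + 1) / L%:R)%R[%classic)).
  rewrite lebesgue_measure_itv/= lte_fin ltr_pM2r ?invr_gt0// ltrDl ltr01.
  by rewrite -EFinB -mulrBl addrAC subrr add0r mul1r.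
apply: le_outer_measure => v /=; rewrite in_itv/= => /andP[kv vk]; split => /=.
  rewrite in_itv/=; apply/andP; split.
    by apply: le_trans kv; rewrite divr_ge0// ler0n.
  by apply/ltW/(lt_le_trans vk); rewrite ler_pdivrMr// mul1r.
rewrite (gc v u)//; apply/eqP; rewrite floor_eq intrD -/k mulrC.
by rewrite -ler_pdivrMr// kv /= -ltr_pdivlMr.
Qed.

End rearrangement2.

Section star_lemmas.
Context {R : realType}.
Local Open Scope ereal_scope.

Lemma torus_cons n (u : R) (x : n.-tuple R) : u \in `[0%R, 1%R] -> torus x ->
  torus ((2 * pi * u)%R ::: x).
Proof.
rewrite in_itv/= => /andP[u0 u1] xT j; case: (unliftP ord0 j) => [k ->|->].
  by rewrite tnthS.
have pi0 : (0 <= 2 * pi :> R)%R by rewrite mulr_ge0// pi_ge0.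
by rewrite tnth0 in_itv/= mulr_ge0//= ler_piMr.
Qed.

Lemma star_ge0 n (F : n.-tuple R -> \bar R) t : (forall x, torus x -> 0 <= F x) ->
  0 <= star F t.
Proof.
elim: n F t => [|n IH] F t F0; first by apply: F0 => -[].
by apply: IH => x _; exact: rearrangement_ge0.
Qed.

Lemma le_star n (F G : n.-tuple R -> \bar R) t :
  (forall x, torus x -> F x <= G x) -> star F t <= star G t.
Proof.
elim: n F G t => [|n IH] F G t FG; first by apply: FG => -[].
apply: IH => x xT; apply: le_rearrangement => u u01.
by apply: FG; exact: torus_cons.
Qed.

Lemma star_anti n (F : n.-tuple R -> \bar R) (s t : n.-tuple R) :
  (forall j, (tnth s j <= tnth t j)%R) -> star F t <= star F s.
Proof.
elim: n F s t => [|n IH] F s t st; first exact: lexx.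
rewrite (tuple_eta s) (tuple_eta t) !star_cons.
apply: (@le_trans _ _ (star (fun x => rearrangement
   (fun u => F ((2 * pi * u)%R ::: x)) (thead t)) [tuple of behead s])).
  by apply: IH => j; rewrite !tnth_behead; exact: st.
by apply: le_star => x _; apply: rearrangement_anti; exact: st.
Qed.

Definition tscale n (c : R) (t : n.-tuple R) : n.-tuple R :=
  [tuple of [seq (c * y)%R | y <- t]].

Lemma tscale_cons n c t0 (t : n.-tuple R) :
  tscale c (t0 ::: t) = (c * t0)%R ::: tscale c t.
Proof. exact: val_inj. Qed.

Lemma tnth_tscale n c (t : n.-tuple R) j : tnth (tscale c t) j = (c * tnth t j)%R.
Proof. exact: tnth_map. Qed.

(** Iterates [rearrangement_esum]: the sums over [i] are carried through the
    successive rearrangements, with the same weights in each variable. *)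
Lemma star_esum (T : countType) n (F : n.-tuple R -> \bar R)
    (Fi : T -> n.-tuple R -> \bar R) (v : T -> R) t :
  (forall j, (0 < tnth t j)%R) -> (forall i, (0 < v i)%R) ->
  \esum_(i in [set: T]) (v i)%:E < 1 ->
  (forall i x, 0 <= Fi i x) ->
  (forall x, torus x -> F x <= \esum_(i in [set: T]) Fi i x) ->
  star F t <= \esum_(i in [set: T]) star (Fi i) (tscale (v i) t).
Proof.
move=> + v0 v1; elim: n F Fi t => [|n IH] F Fi t t0 Fi0 FFi.
  by apply: FFi => -[].
rewrite (tuple_eta t) star_cons.
under eq_esum do rewrite tscale_cons star_cons.
apply: (IH _ (fun i x => rearrangement (fun u => Fi i ((2 * pi * u)%R ::: x))
   (v i * thead t)%R)).
- by move=> j; rewrite tnth_behead.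
- by move=> i x; exact: rearrangement_ge0.
- move=> x xT; apply: rearrangement_esum => //; first exact: t0.
  by move=> u u01; apply: FFi; exact: torus_cons.
Qed.

Lemma star_scale n (F : n.-tuple R -> \bar R) (c : R) t : (0 < c)%R ->
  star (fun x => c%:E * F x) t <= c%:E * star F t.
Proof.
move=> c0; elim: n F t => [|n IH] F t; first exact: lexx.
rewrite (tuple_eta t) !star_cons.
apply: le_trans (le_star _ _) (IH _ _) => x _.
exact: rearrangement_scale.
Qed.

Definition periodic n (F : n.-tuple R -> \bar R) :=
  forall x j, F (upd x j (tnth x j + 2 * pi)%R) = F x.

(** Translation by a vector measured in periods. *)
Definition tadd n (x a : n.-tuple R) : n.-tuple R :=
  [tuple (tnth x j + 2 * pi * tnth a j)%R | j < n].

Lemma tadd_cons n x0 a0 (x a : n.-tuple R) :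
  tadd (x0 ::: x) (a0 ::: a) = (x0 + 2 * pi * a0)%R ::: tadd x a.
Proof.
apply: eq_from_tnth => i; rewrite tnth_mktuple.
by case: (unliftP ord0 i) => [k ->|->]; rewrite ?tnthS ?tnth0 ?tnth_mktuple.
Qed.

Lemma star_shift n (F : n.-tuple R -> \bar R) (a t : n.-tuple R) :
  (forall j, tnth a j \in `[0%R, 1%R]) -> periodic F ->
  star (fun x => F (tadd x a)) t <= star F (tscale 2^-1 t).
Proof.
elim: n F a t => [|n IH] F a t a01 per.
  by rewrite /= (tuple0 (tadd _ _)) lexx.
case/tupleP: t => t0 t; case/tupleP: a a01 => a0 a a01.
rewrite tscale_cons !star_cons.
pose H (x : n.-tuple R) := rearrangement
  (fun u => F ((2 * pi * (u + a0))%R ::: x)) t0.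
apply: (@le_trans _ _ (star (fun x => H (tadd x a)) t)).
  apply: le_star => x _; apply: le_rearrangement => u _.
  by rewrite tadd_cons -mulrDr.
have perH : periodic H.
  move=> x j; rewrite /H; congr (rearrangement _ _); apply/funext => u.
  by rewrite -upd_consS -(tnthS (2 * pi * (u + a0))%R x j) per.
apply: (le_trans (IH _ _ _ _ perH)).
  by move=> j; have := a01 (lift ord0 j); rewrite tnthS.
apply: le_star => x _; rewrite [(_^-1 * t0)%R]mulrC.
apply: (rearrangement_shift (g := fun u => F ((2 * pi * u)%R ::: x))).
  by have := a01 ord0; rewrite tnth0.
move=> u; rewrite -[in RHS](per _ ord0) upd_cons0 tnth0; congr (F (_ ::: _)).
by rewrite mulrDr mulr1.
Qed.

(** The iterated form of [rearrangement_cell]: partial rearrangements of a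
    function constant on cells are again constant on the cells of the remaining
    variables. *)
Lemma star_cell n (F : n.-tuple R -> \bar R) (L : 'I_n -> nat) (t : n.-tuple R) :
  (forall j, (0 < L j)%N) -> (forall j, (0 < tnth t j)%R) ->
  (forall x y, (forall j, Num.floor ((L j)%:R * (tnth x j / (2 * pi)))%R =
     Num.floor ((L j)%:R * (tnth y j / (2 * pi)))%R) -> F x = F y) ->
  star F t <= star F [tuple Num.max (tnth t j) (L j)%:R^-1%R | j < n].
Proof.
elim: n F L t => [|n IH] F L t L0 tpos Fc; first exact: lexx.
case/tupleP: t tpos => t0 t tpos.
have -> : [tuple Num.max (tnth (t0 ::: t) j) (L j)%:R^-1%R | j < n.+1] =
  Num.max t0 (L ord0)%:R^-1%R ::: [tuple Num.max (tnth t j)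
   (L (lift ord0 j))%:R^-1%R | j < n].
  apply: eq_from_tnth => i; rewrite tnth_mktuple.
  by case: (unliftP ord0 i) => [k ->|->]; rewrite ?tnthS ?tnth0 ?tnth_mktuple.
rewrite !star_cons.
have pi0 : (2 * pi != 0 :> R)%R by rewrite mulf_neq0// gt_eqF// pi_gt0.
apply: (@le_trans _ _ (star (fun x => rearrangement (fun u => F ((2 * pi * u)%R ::: x))
   (Num.max t0 (L ord0)%:R^-1%R)) t)).
  apply: le_star => x _; apply: rearrangement_cell => //.
    by have := tpos ord0; rewrite tnth0.
  move=> u v uv; apply: Fc => j; case: (unliftP ord0 j) => [k ->|->].
    by rewrite !tnthS.
  by rewrite !tnth0 ![(2 * pi * _)%R]mulrC !mulfK.
apply: IH => //; first by move=> j; have := tpos (lift ord0 j); rewrite tnthS.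
move=> x y xy; congr (rearrangement _ _); apply/funext => u; apply: Fc => j.
by case: (unliftP ord0 j) => [k ->|->]; rewrite ?tnth0// !tnthS.
Qed.

End star_lemmas.

(** * The weak-type bound *)

Section weak_type.
Context {R : realType}.
Local Notation mu := (@lebesgue_measure R).

Lemma ae_neq (a : R) : {ae mu, forall x, x != a}.
Proof.
exists [set a]; split => //; first exact: lebesgue_measure_set1.
by move=> x /= /negP/negPn/eqP.
Qed.

Lemma measurable_unit_borel (f : R -> R) : measurable_fun setT f -> measurable_unit f.
Proof.
move=> mf B mB; exists (`[0, 1]%classic `&` f @^-1` B).
  apply: measurableI; first exact: measurable_itv.
  by rewrite -[X in measurable X]setTI; apply: mf.
exists set0; last by rewrite setU0.
by exists set0; split => //; exact: measure0.
Qed.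

(** The ideal property compares [g] with [c] times the indicator of [0, t]; the
    point 0, where nothing is assumed, is negligible. *)
Lemma ss_enorm_ge (X : symmetric_space R) (phi : R -> R) (g : R -> \bar R)
    (c t : R) :
  fundamental_function X phi -> 0 <= c -> 0 < t <= 1 ->
  (forall u, 0 < u <= t -> (c%:E <= g u)%E) ->
  ((c * phi t)%:E <= ss_enorm X g)%E.
Proof.
move=> Xphi c0 /andP[t0 t1] cg; rewrite /ss_enorm.
case: asboolP => [[gfin gX]|_]; last exact: leey.
have [chiX ->] : ss_mem X \1_(`[0, t]%classic) /\ phi t = ss_norm X \1_(`[0, t]%classic).
  by apply: Xphi; rewrite in_itv/= (ltW t0).
rewrite lee_fin -[c in leLHS]ger0_norm// -ss_normZ//.
have [] // := @ss_ideal _ X (fun x => c * \1_(`[0, t]%classic) x) (fine \o g).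
- apply: measurable_unit_borel; exact: measurable_funM.
- rewrite /ae_unit in gfin *; have FF : Filter (almost_everywhere mu) by apply: ae_filter_ringOfSetsType.
  apply: filterS2 (ae_neq 0) gfin => x x0 gx x01 /=.
  rewrite indicE; case: (boolP (x \in `[0, t]%classic)); last by rewrite mulr0 normr0.
  rewrite inE/= in_itv/= => /andP[x0' xt]; rewrite mulr1.
  have := cg x; rewrite lt_neqAle eq_sym x0 x0' xt => /(_ isT).
  have := gx x01; case: (g x) => //= r _; rewrite lee_fin ger0_norm// => cr.
  by rewrite (le_trans cr)// ler_norm.
Qed.

Lemma mixed_norm_ge n (X : 'I_n -> symmetric_space R) (phi : 'I_n -> R -> R)
    (G : n.-tuple R -> \bar R) (c : R) (t : n.-tuple R) :
  (forall j, fundamental_function (X j) (phi j)) -> 0 <= c ->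
  (forall j, 0 < tnth t j <= 1) ->
  (forall x, (forall j, 0 < tnth x j <= tnth t j) -> (c%:E <= G x)%E) ->
  ((c * \prod_j phi j (tnth t j))%:E <=
    mixed_norm (0%R : R) (fun j => ss_enorm (X j)) G)%E.
Proof.
elim: n X phi G c t => [|n IH] X phi G c t Xphi c0 t01 cG.
  by rewrite big_ord0 mulr1 mixed_norm0; apply: cG => -[].
case/tupleP: t t01 cG => t0 t t01 cG.
have phi0 : 0 <= phi ord0 t0.
  have [|? ->] := Xphi ord0 t0; last exact: ss_norm_ge0.
  by have /andP[h ?] := t01 ord0; rewrite tnth0 in h *; rewrite in_itv/= ltW.
rewrite big_ord_recl tnth0 mulrA mixed_norm_cons.
under eq_bigr do rewrite tnthS.
apply: (IH (fun j => X (lift ord0 j)) (fun j => phi (lift ord0 j))) => [j||j|x xt].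
- exact: Xphi.
- by rewrite mulr_ge0.
- by have := t01 (lift ord0 j); rewrite tnthS.
- apply: ss_enorm_ge => //; first by have := t01 ord0; rewrite tnth0.
  move=> u u0; apply: cG => j.
  by case: (unliftP ord0 j) => [k ->|->]; rewrite ?tnth0 ?tnthS.
Qed.

(** As [star F] is non-increasing in each variable, it is at least its value at
    [t] on the whole box below [t]; the mixed norm is then bounded from below
    by the fundamental functions. *)
Lemma star_weak_type n (X : 'I_n -> symmetric_space R) (phi : 'I_n -> R -> R)
    (F : n.-tuple R -> \bar R) (A : R) (t : n.-tuple R) :
  (forall j, fundamental_function (X j) (phi j)) ->
  (forall j, 0 < phi j (tnth t j)) -> (forall x, (0 <= F x)%E) ->
  (forall j, 0 < tnth t j <= 1) ->
  (mixed_norm (0%R : R) (fun j => ss_enorm (X j)) (star F) <= A%:E)%E ->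
  (star F t <= (A * \prod_j (phi j (tnth t j))^-1)%:E)%E.
Proof.
move=> Xphi phi0 F0 t01 FA; rewrite prodfV.
have P0 : 0 < \prod_j phi j (tnth t j) by exact: prodr_gt0.
have bound c : 0 <= c -> (c%:E <= star F t)%E -> c <= A / \prod_j phi j (tnth t j).
  move=> c0 cF; rewrite ler_pdivlMr// -lee_fin; apply: le_trans FA.
  apply: mixed_norm_ge => // x xt; apply: le_trans cF _.
  by apply: star_anti => j; have /andP[] := xt j.
have := star_ge0 t (fun x _ => F0 x); case: (star F t) bound => [r| |] bound //.
  by rewrite !lee_fin => r0; apply: bound.
move=> _.
have h0 : 0 <= A / \prod_j phi j (tnth t j) by apply: bound; rewrite ?leey.
have := bound (A / \prod_j phi j (tnth t j) + 1).
by rewrite leey gerDl ler10 => /(_ _ isT); rewrite addr_ge0// => /(_ isT).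
Qed.

End weak_type.

(** * Mixed sequence norms *)

Section seq_norms.
Context {R : realType}.
Local Open Scope ereal_scope.
Implicit Types (a b : nat -> \bar R) (th tau : R).

Lemma le_poweR (x y : \bar R) (r : R) : (0 <= r)%R -> 0 <= x -> x <= y ->
  x `^ r <= y `^ r.
Proof.
move=> r0 x0 xy; apply: gt0_ler_poweR => //; rewrite in_itv/= ?leey ?andbT//.
exact: le_trans xy.
Qed.

Lemma poweRVK (x : \bar R) (r : R) : (0 < r)%R -> 0 <= x -> (x `^ r) `^ r^-1 = x.
Proof. by move=> r0 x0; rewrite -poweRrM mulfV ?gt_eqF// poweRe1. Qed.

Lemma poweRKV (x : \bar R) (r : R) : (0 < r)%R -> 0 <= x -> (x `^ r^-1) `^ r = x.
Proof. by move=> r0 x0; rewrite -poweRrM mulVf ?gt_eqF// poweRe1. Qed.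

Lemma ge_nneseries_term (u : nat -> \bar R) k : (forall n, 0 <= u n) ->
  u k <= \sum_(n <oo) u n.
Proof.
move=> u0; rewrite (nneseriesD1 (n := k))//.
by rewrite leeDl// nneseries_ge0.
Qed.

Lemma seq_norm_ge0 (theta : \bar R) a : 0 <= seq_norm theta a.
Proof.
case: theta => [th| |]; rewrite ?poweR_ge0//=.
by apply: (@le_trans _ _ `|a 0%N|) => //; apply: ereal_sup_ubound; exists 0%N.
Qed.

Lemma seq_norm_term (theta : \bar R) a k : 1 <= theta -> 0 <= a k -> a k <= seq_norm theta a.
Proof.
case: theta => [th| |] //= th1 ak0; last first.
  by apply: ereal_sup_ubound; exists k => //; rewrite gee0_abs.
have th0 : (0 < th)%R by rewrite (lt_le_trans ltr01).
rewrite -{1}(poweRVK th0 ak0); apply: le_poweR; rewrite ?poweR_ge0// ?invr_ge0 ?(ltW th0)//.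
rewrite -{1}(gee0_abs ak0); apply: (ge_nneseries_term (u := fun k => `|a k| `^ th)).
by move=> n; exact: poweR_ge0.
Qed.

Lemma le_seq_norm (theta : \bar R) a b : 1 <= theta -> (forall k, 0 <= a k) ->
  (forall k, a k <= b k) -> seq_norm theta a <= seq_norm theta b.
Proof.
move=> + a0 ab; case: theta => [th| |] //= th1.
- have th0 : (0 <= th)%R by rewrite (le_trans ler01).
  apply: le_poweR; rewrite ?invr_ge0//.
    by apply: nneseries_ge0 => n _ _; exact: poweR_ge0.
  apply: lee_nneseries => [n _ _|n _]; first exact: poweR_ge0.
  by rewrite !gee0_abs//; [exact: le_poweR|exact: le_trans (ab n)].
- apply: ge_ereal_sup => _ [k _ <-]; apply: (@le_trans _ _ `|b k|).
    by rewrite !gee0_abs//; exact: le_trans (ab k).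
  by apply: ereal_sup_ubound; exists k.
Qed.

Lemma seq_norm_scale tau (c : R) a : (0 < tau)%R -> (0 <= c)%R ->
  (forall k, 0 <= a k) ->
  seq_norm tau%:E (fun k => c%:E * a k) = c%:E * seq_norm tau%:E a.
Proof.
move=> t0 c0 a0 /=.
have S0 : 0 <= \sum_(k <oo) `|a k| `^ tau.
  by apply: nneseries_ge0 => n _ _; exact: poweR_ge0.
rewrite (eq_eseriesr (g := fun k => c%:E `^ tau * `|a k| `^ tau)); last first.
  by move=> k _; rewrite gee0_abs ?mule_ge0// poweRM ?gee0_abs.
rewrite poweR_EFin nneseriesZl; last by move=> n _; exact: poweR_ge0.
rewrite -poweR_EFin poweRM ?poweR_ge0// poweRVK//.
Qed.

Lemma esumZl (I : countType) (c : R) (z : I -> \bar R) : (0 <= c)%R ->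
  (forall i, 0 <= z i) ->
  \esum_(i in [set: I]) (c%:E * z i) = c%:E * \esum_(i in [set: I]) z i.
Proof.
move=> c0 z0; rewrite !esum_pickle//; last by move=> i; rewrite mule_ge0.
rewrite -nneseriesZl//; last by move=> n _; case: (@pickle_inv I n).
by apply: eq_eseriesr => n _; case: (@pickle_inv I n) => [i|] //=; rewrite mule0.
Qed.

(** Each term is at most the sum [Z], so that [z_i ^ tau <= Z ^ (tau - 1) z_i]. *)
Lemma l1_sub_ltau tau (I : countType) (z : I -> \bar R) : (1 <= tau)%R ->
  (forall i, 0 <= z i) ->
  (\esum_(i in [set: I]) z i `^ tau) `^ tau^-1 <= \esum_(i in [set: I]) z i.
Proof.
move=> t1 z0; have t0 : (0 < tau)%R by rewrite (lt_le_trans ltr01).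
set Z := \esum_(i in _) z i.
have Z0 : 0 <= Z by apply: esum_ge0.
have [->|Zoo] := eqVneq Z +oo; first exact: leey.
have Zf : Z \is a fin_num by rewrite ge0_fin_numE// ltey.
have [Z00|Zn0] := eqVneq Z 0.
  rewrite esum1; first by rewrite poweR0r// invr_neq0// gt_eqF.
  move=> i _; suff -> : z i = 0 by rewrite poweR0r// gt_eqF.
  apply/eqP; rewrite eq_le z0 -Z00 andbT.
  by apply: esum_ge; exists [set i]; [split|rewrite fsbig_set1].
rewrite -[leRHS](poweRVK t0 Z0); apply: le_poweR; first by rewrite invr_ge0 ltW.
  by apply: esum_ge0 => i _; exact: poweR_ge0.
have zZ i : z i <= Z.
  by apply: esum_ge; exists [set i]; [split|rewrite fsbig_set1].
have Zpos : (0 < fine Z)%R by rewrite fine_gt0// lt0e Zn0 Z0 ltey.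
apply: (@le_trans _ _ (\esum_(i in [set: I]) (Z `^ (tau - 1) * z i))).
  apply: le_esum => i _.
  have [->|zi0] := eqVneq (z i) 0; first by rewrite poweR0r ?mule0// gt_eqF.
  have zf : z i \is a fin_num by rewrite ge0_fin_numE// (le_lt_trans (zZ i))// ltey.
  have t10 : (0 <= tau - 1)%R by rewrite subr_ge0.
  rewrite -[in leLHS](subrK 1%R tau) (poweRD (nneg_neq0_poweRD_def zi0 t10 ler01)).
  rewrite poweRe1//; apply: lee_wpmul2r => //; exact: le_poweR.
have -> : Z `^ (tau - 1) = ((fine Z) `^ (tau - 1))%:E by rewrite -poweR_EFin fineK.
rewrite esumZl ?powR_ge0// -/Z -[X in _ * X](fineK Zf) -EFinM -[in leRHS](fineK Zf).
by rewrite poweR_EFin lee_fin mulrC mulr_powRB1// ltW.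
Qed.

(** The inclusion of l_th in l_tau, obtained from the case th = 1 by taking
    powers. *)
Lemma seq_norm_embed th tau a : (1 <= th)%R -> (th <= tau)%R ->
  (forall k, 0 <= a k) -> seq_norm tau%:E a <= seq_norm th%:E a.
Proof.
move=> t1 tt a0 /=.
have t0 : (0 < th)%R by rewrite (lt_le_trans ltr01).
have tau0 : (0 < tau)%R by rewrite (lt_le_trans t0).
have := @l1_sub_ltau (tau / th) nat (fun k => `|a k| `^ th).
rewrite ler_pdivlMr// mul1r => /(_ tt (fun=> poweR_ge0 _ _)).
rewrite -!nneseries_esumT//; [|by move=> n; exact: poweR_ge0..].
move=> /(le_poweR _ (poweR_ge0 _ _)) => /(_ th^-1%R); rewrite invr_ge0 => /(_ (ltW t0)).
apply: le_trans.
have e : ((tau / th)^-1 * th^-1 = tau^-1)%R.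
  by rewrite invf_div mulrAC divff ?mul1r// gt_eqF.
rewrite -poweRrM e.
apply: le_poweR; rewrite ?invr_ge0 ?(ltW tau0)//.
  by apply: nneseries_ge0 => n _ _; exact: poweR_ge0.
apply: lee_nneseries => [n _ _|n _]; first exact: poweR_ge0.
by rewrite -poweRrM mulrC divfK// gt_eqF.
Qed.

End seq_norms.

Section sums.
Context {R : realType}.
Local Open Scope ereal_scope.

Lemma esum_pair (I J : choiceType) (a : I -> J -> \bar R) :
  (forall i j, 0 <= a i j) ->
  \esum_(i in [set: I]) \esum_(j in [set: J]) a i j =
  \esum_(p in [set: I * J]) a p.1 p.2.
Proof.
move=> a0; rewrite esum_esum//; congr esum.
by apply/seteqP; split => // -[i j].
Qed.

Lemma esum_exchange (I J : choiceType) (a : I -> J -> \bar R) :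
  (forall i j, 0 <= a i j) ->
  \esum_(i in [set: I]) \esum_(j in [set: J]) a i j =
  \esum_(j in [set: J]) \esum_(i in [set: I]) a i j.
Proof.
move=> a0; rewrite !esum_pair//.
rewrite (@reindex_esum _ _ _ [set: J * I] _ (fun p => (p.2, p.1)))//; split => //=.
by move=> [? ?] [? ?] _ _ /= [-> ->].
by move=> [i j] _; exists (j, i).
Qed.

Lemma esum_tuple_cons n (T : countType) (a : n.+1.-tuple T -> \bar R) :
  (forall s, 0 <= a s) ->
  \esum_(s in [set: n.+1.-tuple T]) a s =
  \esum_(s0 in [set: T]) \esum_(s in [set: n.-tuple T]) a (s0 ::: s).
Proof.
move=> a0; rewrite esum_pair//.
rewrite (@reindex_esum _ _ _ [set: T * n.-tuple T] _ (fun p => p.1 ::: p.2))//.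
split => //=.
- move=> [u s] [v t] _ _ /= /(congr1 val)/= [-> st]; congr (_, _).
  exact: val_inj.
- by move=> s _; case/tupleP: s => u s; exists (u, s).
Qed.

Lemma esum_tuple0 (T : countType) (a : 0.-tuple T -> \bar R) :
  (forall s, 0 <= a s) -> \esum_(s in [set: 0.-tuple T]) a s = a [tuple].
Proof.
move=> a0; rewrite (_ : [set: 0.-tuple T] = [set [tuple]]) ?esum_set1//.
by apply/seteqP; split => // s _; rewrite (tuple0 s).
Qed.

Lemma esum_term (I : countType) (a : I -> \bar R) i : (forall i, 0 <= a i) ->
  a i <= \esum_(i in [set: I]) a i.
Proof.
by move=> a0; apply: esum_ge; exists [set i]; [split|rewrite fsbig_set1].
Qed.

End sums.

Section mixed_seq.
Context {R : realType}.
Local Open Scope ereal_scope.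

Lemma mixed_seq_ge0 n (theta : 'I_n -> \bar R) (a : n.-tuple nat -> \bar R) :
  (forall s, 0 <= a s) -> 0 <= mixed_seq_norm theta a.
Proof.
rewrite /mixed_seq_norm; elim: n theta a => [|n IH] theta a a0.
  by rewrite mixed_norm0.
by rewrite mixed_norm_cons; apply: IH => s; exact: seq_norm_ge0.
Qed.

Lemma le_mixed_seq n (theta : 'I_n -> \bar R) (a b : n.-tuple nat -> \bar R) :
  (forall j, 1 <= theta j) -> (forall s, 0 <= a s) -> (forall s, a s <= b s) ->
  mixed_seq_norm theta a <= mixed_seq_norm theta b.
Proof.
rewrite /mixed_seq_norm; elim: n theta a b => [|n IH] theta a b t1 a0 ab.
  by rewrite !mixed_norm0.
rewrite !mixed_norm_cons; apply: IH => [//|s|s]; first exact: seq_norm_ge0.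
exact: le_seq_norm.
Qed.

Lemma mixed_seq_term n (theta : 'I_n -> \bar R) (a : n.-tuple nat -> \bar R) s :
  (forall j, 1 <= theta j) -> (forall s, 0 <= a s) ->
  a s <= mixed_seq_norm theta a.
Proof.
rewrite /mixed_seq_norm; elim: n theta a s => [|n IH] theta a s t1 a0.
  by rewrite mixed_norm0 (tuple0 s).
case/tupleP: s => s0 s; rewrite mixed_norm_cons.
apply: le_trans (IH _ _ s _ _) => //; last by move=> ?; exact: seq_norm_ge0.
exact: (seq_norm_term (a := fun u => a (u ::: s))).
Qed.

Lemma mixed_seq_scale n (tau : 'I_n -> R) (c : R) (a : n.-tuple nat -> \bar R) :
  (forall j, (0 < tau j)%R) -> (0 <= c)%R -> (forall s, 0 <= a s) ->
  mixed_seq_norm (fun j => (tau j)%:E) (fun s => c%:E * a s) =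
  c%:E * mixed_seq_norm (fun j => (tau j)%:E) a.
Proof.
move=> + c0; rewrite /mixed_seq_norm; elim: n tau a => [|n IH] tau a t0 a0.
  by rewrite !mixed_norm0.
rewrite !mixed_norm_cons -IH//; last by move=> s; exact: seq_norm_ge0.
by congr mixed_norm; apply/funext => s; rewrite seq_norm_scale.
Qed.

End mixed_seq.

(** * Geometric kernels *)

Section kernel.
Context {R : realType}.
Local Open Scope ereal_scope.

Definition nat_dist (k s : nat) : nat := (k - s + (s - k))%N.

Definition geom_ker n (r : R) (k s : n.-tuple nat) : R :=
  (\prod_(j < n) r ^+ nat_dist (tnth k j) (tnth s j))%R.

Lemma geom_ker_cons n (r : R) k0 s0 (k s : n.-tuple nat) :
  geom_ker r (k0 ::: k) (s0 ::: s) = (r ^+ nat_dist k0 s0 * geom_ker r k s)%R.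
Proof.
rewrite /geom_ker big_ord_recl !tnth0; congr (_ * _)%R.
by apply: eq_bigr => j _; rewrite !tnthS.
Qed.

Lemma geom_ker_gt0 n (r : R) (k s : n.-tuple nat) : (0 < r)%R -> (0 < geom_ker r k s)%R.
Proof. by move=> r0; apply: prodr_gt0 => j _; rewrite exprn_gt0. Qed.

Lemma geom_ker_exp n (r : R) (e : nat) (k s : n.-tuple nat) :
  geom_ker (r ^+ e) k s = (geom_ker r k s ^+ e)%R.
Proof. by rewrite /geom_ker -prodrXl; apply: eq_bigr => j _; rewrite exprAC. Qed.

Lemma geom_sum_le (r : R) k : (0 < r < 1)%R ->
  \sum_(s <oo) (r ^+ nat_dist k s)%:E <= ((2 - r ^+ k) / (1 - r))%:E.
Proof.
move=> /andP[r0 r1]; have r1' : (0 < 1 - r)%R by rewrite subr_gt0.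
have pos k' n : 0 <= (r ^+ nat_dist k' n)%:E by rewrite lee_fin exprn_ge0// ltW.
elim: k => [|k IH].
  apply: lime_le; first exact: is_cvg_nneseries.
  apply: nearW => n; rewrite sumEFin.
  rewrite lee_fin expr0 (_ : 2 - 1 = 1)%R; last by rewrite -addrA subrr addr0.
  have -> : (\sum_(0 <= i < n) r ^+ nat_dist 0 i = series (geometric 1 r) n)%R.
    by rewrite /series/=; apply: eq_bigr => i _; rewrite mul1r /nat_dist sub0n subn0.
  by apply: geometric_le_lim => //; rewrite ger0_norm// ltW.
rewrite nneseries_recl//.
rewrite -(nneseries_addn (f := fun s => (r ^+ nat_dist k.+1 s)%:E) 1)//.
have -> : \sum_(s <oo) (r ^+ nat_dist k.+1 (s + 1))%:E =
          \sum_(s <oo) (r ^+ nat_dist k s)%:E.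
  by apply: eq_eseriesr => s _; rewrite addn1 /nat_dist !subSS.
apply: le_trans (leeD2l _ IH) _; rewrite -EFinD lee_fin /nat_dist subn0 sub0n addn0.
rewrite -lerBrDr -mulrBl ler_pdivlMr// exprS.
have x0 : (0 <= r ^+ k)%R by rewrite exprn_ge0// ltW.
have : (0 <= r ^+ k * (1 - r) ^+ 2)%R by rewrite mulr_ge0// sqr_ge0.
by nra.
Qed.

Lemma geom_ker_sum n (r : R) (k : n.-tuple nat) : (0 < r < 1)%R ->
  \esum_(s in [set: n.-tuple nat]) (geom_ker r k s)%:E <= ((2 / (1 - r)) ^+ n)%:E.
Proof.
move=> /andP[r0 r1]; have r1' : (0 < 1 - r)%R by rewrite subr_gt0.
have pos m (k' s : m.-tuple nat) : 0 <= (geom_ker r k' s)%:E.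
  by rewrite lee_fin ltW// geom_ker_gt0.
elim: n k => [|n IH] k.
  by rewrite esum_tuple0// /geom_ker big_ord0 expr0.
case/tupleP: k => k0 k; rewrite esum_tuple_cons//.
under eq_esum => s0 _ do under eq_esum do rewrite geom_ker_cons EFinM.
under eq_esum => s0 _ do rewrite esumZl ?exprn_ge0 ?(ltW r0)//.
apply: (@le_trans _ _ (\esum_(s0 in [set: nat]) (((2 / (1 - r)) ^+ n)%:E * (r ^+ nat_dist k0 s0)%:E))).
  apply: le_esum => s0 _; rewrite muleC; apply: lee_wpmul2r; last exact: IH.
  by rewrite lee_fin exprn_ge0// ltW.
have c0 : (0 <= 2 / (1 - r))%R by rewrite divr_ge0// ltW.
rewrite esumZl ?exprn_ge0//; last by move=> i; rewrite lee_fin exprn_ge0// ltW.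
rewrite exprSr EFinM; apply: lee_wpmul2l; first by rewrite lee_fin exprn_ge0.
rewrite -nneseries_esumT; last by move=> i; rewrite lee_fin exprn_ge0// ltW.
apply: le_trans (geom_sum_le _ _) _; first by rewrite r0.
by rewrite lee_fin ler_pM2r ?invr_gt0// gerBl exprn_ge0// ltW.
Qed.

End kernel.

Section kernel_bound.
Context {R : realType}.
Local Open Scope ereal_scope.

Lemma esum_mul_le (I : countType) (w : I -> R) (W : R) (Z : \bar R) :
  (forall i, (0 <= w i)%R) -> \esum_(i in [set: I]) (w i)%:E <= W%:E -> 0 <= Z ->
  \esum_(i in [set: I]) ((w i)%:E * Z) <= W%:E * Z.
Proof.
move=> w0 wW Z0.
have W0 : (0 <= W)%R.
  by rewrite -lee_fin (le_trans _ wW)// esum_ge0// => i _; rewrite lee_fin.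
case: Z Z0 => [s| |] // Z0.
  rewrite (@eq_esum _ _ _ _ (fun i => s%:E * (w i)%:E)); last first.
    by move=> i _; exact: muleC.
  rewrite esumZl; [|by []|by move=> i; rewrite lee_fin].
  by rewrite [leRHS]muleC; exact: lee_wpmul2l.
have [W00|Wn0] := eqVneq W 0%R; last by rewrite gt0_muley ?leey// lte_fin lt0r Wn0.
rewrite esum1 ?W00 ?mul0e// => i _; suff -> : w i = 0%R by rewrite mul0e.
apply/eqP; rewrite eq_le w0 andbT -lee_fin -W00; apply: le_trans wW.
by apply: (esum_term (a := fun i => (w i)%:E)) => j; rewrite lee_fin.
Qed.

(** A substitute for Jensen's inequality: each [w i * y i] is bounded by the
    l_tau norm of the family, and the second factor [w i] is summed.  It costs
    a square of the weight, which is harmless for geometric kernels. *)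
Lemma weighted_jensen (I : countType) (w : I -> R) (y : I -> \bar R) (W tau : R) :
  (1 <= tau)%R -> (forall i, (0 <= w i)%R) -> (forall i, 0 <= y i) ->
  \esum_(i in [set: I]) (w i)%:E <= W%:E ->
  \esum_(i in [set: I]) ((w i ^+ 2)%:E * y i) <=
  W%:E * (\esum_(i in [set: I]) ((w i)%:E * y i) `^ tau) `^ tau^-1.
Proof.
move=> t1 w0 y0 wW; have t0 : (0 < tau)%R by rewrite (lt_le_trans ltr01).
set S := (X in _ * X).
have wy0 i : 0 <= (w i)%:E * y i by rewrite mule_ge0// lee_fin.
have wS i : (w i)%:E * y i <= S.
  rewrite -{1}(poweRVK t0 (wy0 i)); apply: le_poweR; rewrite ?poweR_ge0//.
    by rewrite invr_ge0 ltW.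
  apply: (esum_term (a := fun i => ((w i)%:E * y i) `^ tau)) => j.
  exact: poweR_ge0.
apply: le_trans (esum_mul_le w0 wW (poweR_ge0 _ _)).
apply: le_esum => i _; rewrite expr2 EFinM -muleA.
by apply: lee_wpmul2l; rewrite ?lee_fin.
Qed.

(** One step of the induction behind [geom_ker_bounded].  The kernel of ratio
    [r ^ 2] is a square: one factor is spent to move the l_tau norm in the first
    index inside the sum, the other one is kept for the remaining indices. *)
Lemma geom_ker_step n (r tau : R) (B : n.+1.-tuple nat -> \bar R) (k : n.-tuple nat) (c : R) :
  c = (2 / (1 - r))%R -> (0 < r < 1)%R -> (1 <= tau)%R -> (forall s, 0 <= B s) ->
  seq_norm tau%:E (fun k0 => \esum_(s in [set: n.+1.-tuple nat])
     ((geom_ker (r ^+ 2) (k0 ::: k) s)%:E * B s)) <=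
  (c ^+ n.+2)%:E * \esum_(s in [set: n.-tuple nat])
     ((geom_ker r k s)%:E * seq_norm tau%:E (fun s0 => B (s0 ::: s))).
Proof.
move=> cE r01 t1 B0; have /andP[r0 r1] := r01.
have t0 : (0 < tau)%R by rewrite (lt_le_trans ltr01).
have c1 : (1 <= c)%R.
  by rewrite cE ler_pdivlMr ?subr_gt0//; nra.
have c0 : (0 <= c)%R by rewrite (le_trans ler01).
have p0 : forall x : \bar R, 0 <= x `^ tau by move=> x; exact: poweR_ge0.
pose Q (k0 : nat) := \esum_(s in [set: n.+1.-tuple nat])
   (((geom_ker r (k0 ::: k) s)%:E * B s) `^ tau).
have Q0 k0 : 0 <= Q k0 by apply: esum_ge0 => s _; exact: poweR_ge0.
have ker0 m (k' s : m.-tuple nat) : (0 <= geom_ker r k' s)%R by rewrite ltW// geom_ker_gt0.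
apply: (@le_trans _ _ (seq_norm tau%:E (fun k0 => (c ^+ n.+1)%:E * Q k0 `^ tau^-1))).
  apply: le_seq_norm => // k0.
    apply: esum_ge0 => s _; rewrite mule_ge0// lee_fin geom_ker_exp exprn_ge0//.
  under eq_esum do rewrite geom_ker_exp.
  by apply: weighted_jensen => //; rewrite cE; exact: geom_ker_sum.
rewrite seq_norm_scale ?exprn_ge0//; last by move=> k0; exact: poweR_ge0.
rewrite (exprSr c n.+1) (EFinM (c ^+ n.+1) c) -muleA; apply: lee_wpmul2l; first by rewrite lee_fin exprn_ge0.
rewrite /=.
have -> : \sum_(k0 <oo) `|Q k0 `^ tau^-1| `^ tau = \sum_(k0 <oo) Q k0.
  by apply: eq_eseriesr => k0 _; rewrite gee0_abs ?poweR_ge0// poweRKV.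
pose Y s := (geom_ker r k s)%:E * seq_norm tau%:E (fun s0 => B (s0 ::: s)).
have Y0 s : 0 <= Y s by rewrite mule_ge0 ?lee_fin// seq_norm_ge0.
have QY : \sum_(k0 <oo) Q k0 <= c%:E * \esum_(s in [set: n.-tuple nat]) (Y s `^ tau).
  rewrite nneseries_esumT//.
  under eq_esum => k0 _ do rewrite /Q esum_tuple_cons//.
  rewrite -esumZl//.
  under eq_esum => k0 _ do rewrite esum_exchange//.
  rewrite esum_exchange; last by move=> k0 s; apply: esum_ge0.
  apply: le_esum => s _; rewrite esum_exchange//.
  rewrite /Y poweRM ?lee_fin ?seq_norm_ge0// /= poweRKV//; last first.
    by apply: nneseries_ge0 => s0 _ _.
  rewrite nneseries_esumT// -esumZl ?powR_ge0// -esumZl//; last first.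
    by move=> s0; rewrite mule_ge0// lee_fin powR_ge0.
  apply: le_esum => s0 _; set Z := (X in _ * X).
  have Z0 : 0 <= Z by rewrite mule_ge0// lee_fin powR_ge0.
  apply: le_trans (@esum_mul_le nat (fun k0 => r ^+ nat_dist k0 s0)%R c Z _ _ Z0).
  - apply: le_esum => k0 _; rewrite geom_ker_cons EFinM -muleA.
    rewrite poweRM ?mule_ge0 ?lee_fin ?exprn_ge0// ?(ltW r0)//.
    rewrite poweRM ?lee_fin//; rewrite /Z (gee0_abs (B0 _)).
    apply: lee_wpmul2r; first by rewrite mule_ge0// lee_fin powR_ge0.
    rewrite poweR_EFin lee_fin ge1r_powR// exprn_gt0// exprn_ile1// ltW//.
  - by move=> k0; rewrite exprn_ge0// ltW.
  - have -> : \esum_(k0 in [set: nat]) (r ^+ nat_dist k0 s0)%:E =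
      \sum_(k0 <oo) (r ^+ nat_dist s0 k0)%:E.
      rewrite nneseries_esumT; last by move=> i; rewrite lee_fin exprn_ge0// ltW.
      by apply: eq_esum => k0 _; rewrite /nat_dist addnC.
    apply: le_trans (geom_sum_le _ _) _; first by [].
    rewrite cE lee_fin ler_pM2r ?invr_gt0 ?subr_gt0//.
    by rewrite gerBl exprn_ge0// ltW.
apply: (@le_trans _ _ ((c%:E * \esum_(s in [set: n.-tuple nat]) (Y s `^ tau)) `^ tau^-1)).
  apply: le_poweR => //; first by rewrite invr_ge0 ltW.
  by apply: nneseries_ge0.
rewrite poweRM ?lee_fin//; last by apply: esum_ge0.
apply: lee_pmul; rewrite ?poweR_ge0//.
  by rewrite poweR_EFin lee_fin ler1_powR// invf_le1.
exact: l1_sub_ltau.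
Qed.

(** Each coordinate replaces the ratio by its square root, so that the number
    of coordinates decreases while the ratio stays below 1. *)
Lemma geom_ker_bounded n (r : R) (tau : 'I_n -> R) :
  (0 < r < 1)%R -> (forall j, (1 <= tau j)%R) ->
  exists2 C : R, (0 <= C)%R & forall B : n.-tuple nat -> \bar R,
    (forall s, 0 <= B s) ->
    mixed_seq_norm (fun j => (tau j)%:E) (fun k =>
      \esum_(s in [set: n.-tuple nat]) ((geom_ker r k s)%:E * B s)) <=
    C%:E * mixed_seq_norm (fun j => (tau j)%:E) B.
Proof.
elim: n r tau => [|n IH] r tau r01 t1.
  exists 1%R => // B B0; rewrite mul1e /mixed_seq_norm !mixed_norm0 esum_tuple0.
    by rewrite /geom_ker big_ord0 mul1e.
  by move=> s; rewrite mule_ge0// /geom_ker big_ord0 lee_fin.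
have /andP[r0 r1] := r01.
pose q := Num.sqrt r; have qq : (q ^+ 2 = r)%R by rewrite sqr_sqrtr// ltW.
have q01 : (0 < q < 1)%R.
  by rewrite sqrtr_gt0 r0/= -sqrtr1 ltr_sqrt.
have [C C0 HC] := IH q (fun j => tau (lift ord0 j)) q01 (fun j => t1 _).
pose c : R := (2 / (1 - q))%R.
have c0 : (0 <= c)%R by case/andP: q01 => ? ?; rewrite divr_ge0// subr_ge0 ltW.
have tp j : (0 < tau j)%R by rewrite (lt_le_trans ltr01).
have kq0 m (k' s : m.-tuple nat) : 0 <= (geom_ker q k' s)%:E.
  by rewrite lee_fin ltW// geom_ker_gt0//; case/andP: q01.
exists (c ^+ n.+2 * C)%R => [|B B0]; first by rewrite mulr_ge0// exprn_ge0.
rewrite /mixed_seq_norm !mixed_norm_cons -!/(mixed_seq_norm _ _).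
pose B' (s : n.-tuple nat) := seq_norm (tau ord0)%:E (fun s0 => B (s0 ::: s)).
have B'0 s : 0 <= B' s by exact: seq_norm_ge0.
apply: (@le_trans _ _ (mixed_seq_norm (fun j => (tau (lift ord0 j))%:E)
   (fun k => (c ^+ n.+2)%:E * \esum_(s in [set: n.-tuple nat]) ((geom_ker q k s)%:E * B' s)))).
  apply: le_mixed_seq => [j|k|k]; first by rewrite lee_fin.
    exact: seq_norm_ge0.
  by rewrite -qq; apply: geom_ker_step.
rewrite mixed_seq_scale ?exprn_ge0//; last first.
  by move=> k; apply: esum_ge0 => s _; rewrite mule_ge0.
rewrite (EFinM (c ^+ n.+2) C) -muleA; apply: lee_wpmul2l; first by rewrite lee_fin exprn_ge0.
exact: HC.
Qed.

End kernel_bound.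
(** * Hoelder's inequality for mixed sequence norms *)

Section hoelder_mixed.
Context {R : realType}.
Local Open Scope ereal_scope.

Lemma seq_norm_cst0 (tau : R) (a : nat -> \bar R) : (0 < tau)%R ->
  (forall k, a k = 0) -> seq_norm tau%:E a = 0.
Proof.
move=> t0 a0 /=; rewrite eseries0 ?poweR0r ?invr_neq0 ?gt_eqF// => k _ _.
by rewrite a0 abse0 poweR0r// gt_eqF.
Qed.

(** Hoelder's inequality for the powers [tau] of the sequences, with exponents
    [theta / tau] and its conjugate.  When [theta <= tau] the sequence [b] is
    only bounded, and l_theta embeds in l_tau. *)
Lemma seq_norm_hoelder (theta : \bar R) (tau : R) (b : nat -> R) (a : nat -> \bar R) :
  1 <= theta -> (1 <= tau)%R -> (forall k, (0 < b k)%R) -> (forall k, 0 <= a k) ->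
  seq_norm tau%:E (fun k => (b k)%:E * a k) <=
  seq_norm (epsilon theta tau) (fun k => (b k)%:E) * seq_norm theta a.
Proof.
move=> th1 t1 b0 a0; have t0 : (0 < tau)%R by rewrite (lt_le_trans ltr01).
have ba0 k : 0 <= (b k)%:E * a k by rewrite mule_ge0// lee_fin ltW.
have sup_case (e th : \bar R) : 1 <= e -> seq_norm tau%:E a <= seq_norm th a ->
    e = +oo ->
    seq_norm tau%:E (fun k => (b k)%:E * a k) <=
    seq_norm e (fun k => (b k)%:E) * seq_norm th a.
  move=> e1 aath eoo.
  set s := seq_norm e _.
  have bs k : (b k)%:E <= s by apply: seq_norm_term => //; rewrite lee_fin ltW.
  have s0 : 0 < s by apply: lt_le_trans (bs 0%N); rewrite lte_fin.
  case: s s0 bs => [s| |] // s0 bs.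
    apply: (@le_trans _ _ (s%:E * seq_norm tau%:E a)); last first.
      by apply: lee_wpmul2l => //; exact: ltW.
    rewrite -seq_norm_scale ?(ltW s0)//; last by rewrite -lee_fin ltW.
    apply: le_seq_norm => // k; apply: lee_wpmul2r => //; exact: bs.
  have [a00|an0] := eqVneq (seq_norm th a) 0; last first.
    by rewrite gt0_mulye ?leey// lt0e an0 seq_norm_ge0.
  rewrite a00 mule0; have ak k : a k = 0.
    apply/eqP; rewrite eq_le a0 andbT.
    apply: le_trans (seq_norm_term (theta := tau%:E) _ (a0 k)) _ => //.
    by rewrite -a00.
  by rewrite seq_norm_cst0// => k; rewrite ak mule0.
case: theta th1 => [th| |] // th1; last first.
  (* Here epsilon = tau, and the values of a are bounded by their supremum. *)
  rewrite [epsilon _ _]/=; set s := seq_norm +oo a.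
  have as_ k : a k <= s.
    by apply: ereal_sup_ubound; exists k => //; rewrite gee0_abs.
  have s0 : 0 <= s by exact: le_trans (as_ 0%N).
  have [S0|S0] := eqVneq s 0.
    rewrite S0 mule0.
    rewrite seq_norm_cst0// => k.
    have -> : a k = 0 by apply/eqP; rewrite eq_le a0 andbT -S0.
    by rewrite mule0.
  have [soo|sfin] := eqVneq s +oo.
    rewrite soo gt0_muley ?leey//; apply: poweR_gt0.
    apply: lt_le_trans (ge_nneseries_term (u := fun k => `|(b k)%:E| `^ tau) 0%N _).
      by rewrite poweR_gt0//= lte_fin normr_gt0 gt_eqF.
    by move=> n; exact: poweR_ge0.
  have sf : s \is a fin_num by rewrite ge0_fin_numE// ltey.
  rewrite -[s in leRHS]fineK// muleC.
  rewrite -seq_norm_scale ?fine_ge0//; last first.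
    by move=> k; rewrite lee_fin ltW.
  apply: (@le_seq_norm _ tau%:E) => // k.
  rewrite fineK// muleC; apply: lee_wpmul2r; rewrite ?lee_fin ?(ltW (b0 k))//.
have th0 : (0 < th)%R by rewrite (lt_le_trans ltr01).
rewrite [epsilon _ _]/=; case: ifPn => [bet|]; last first.
  rewrite -leNgt ler_pdivrMr// mul1r => tht.
  by apply: (sup_case +oo th%:E); [exact: leey|exact: seq_norm_embed|].
pose B := (th / tau)%R; have B0 : (0 < B)%R by rewrite divr_gt0.
rewrite -/B /= in bet *; pose q := (B / (B - 1))%R.
have B1 : (0 < B - 1)%R by rewrite subr_gt0.
have q0 : (0 < q)%R by rewrite divr_gt0.
set SA := \sum_(k <oo) `|a k| `^ th.
set SB := (X in X `^ _ * _).
have SB0 : 0 < SB.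
  apply: lt_le_trans (ge_nneseries_term (u := fun k => `|(b k)%:E| `^ (tau * q)) 0%N _).
    by rewrite poweR_gt0//= lte_fin normr_gt0 gt_eqF.
  by move=> n; exact: poweR_ge0.
have SA0 : 0 <= SA by apply: nneseries_ge0 => n _ _; exact: poweR_ge0.
have [[k ak]|afin] := pselect (exists k, a k = +oo).
  suff -> : SA = +oo.
    by rewrite poweRyr ?invr_neq0 ?gt_eqF// gt0_muley ?leey// poweR_gt0.
  apply/eqP; rewrite -leye_eq.
  apply: le_trans (ge_nneseries_term (u := fun k => `|a k| `^ th) k _).
    by rewrite ak poweRyr// gt_eqF.
  by move=> n; exact: poweR_ge0.
have af k : a k \is a fin_num.
  by rewrite ge0_fin_numE// ltey; apply/eqP => ak; apply: afin; exists k.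
have pq : (q^-1 + B^-1 = 1)%R.
  by rewrite /q invf_div -[X in (_ + X)%R]div1r -mulrDl subrK mulfV// gt_eqF.
pose f k := (b k `^ tau)%R; pose g k := (fine (a k) `^ tau)%R.
have mf (h : nat -> R) : measurable_fun setT h by [].
have HFG : Lnorm counting 1 (EFin \o (f \* g)%R) = \sum_(k <oo) `|(b k)%:E * a k| `^ tau.
  rewrite Lnorm_counting// invr1 poweRe1; last first.
    by apply: nneseries_ge0 => n _ _; exact: poweR_ge0.
  apply: eq_eseriesr => k _; rewrite poweRe1// /f /g /=.
  rewrite -powRM ?fine_ge0 ?(ltW (b0 k))// gee0_abs//.
  rewrite -[X in _ = (_ * X) `^ _]fineK// -EFinM poweR_EFin.
  by rewrite ger0_norm// powR_ge0.
have HF : Lnorm counting q%:E (EFin \o f) = SB `^ q^-1.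
  rewrite Lnorm_counting//; congr (_ `^ _).
  apply: eq_eseriesr => k _; rewrite /f /= ger0_norm ?powR_ge0//.
  by rewrite -powRrM gtr0_norm.
have HG : Lnorm counting B%:E (EFin \o g) = SA `^ B^-1.
  rewrite Lnorm_counting//; congr (_ `^ _).
  apply: eq_eseriesr => k _; rewrite /g /= ger0_norm ?powR_ge0//.
  rewrite -powRrM /B mulrC divfK ?gt_eqF// gee0_abs// -[in RHS](fineK (af k)).
  by rewrite poweR_EFin.
have := hoelder counting (mf f) (mf g) q0 B0 pq.
rewrite HFG HF HG.
move=> H; apply: (@le_trans _ _ ((SB `^ q^-1 * SA `^ B^-1) `^ tau^-1)).
  apply: le_poweR => //; first by rewrite invr_ge0 ltW.
  by apply: nneseries_ge0 => n _ _; exact: poweR_ge0.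
have e1 : (q^-1 * tau^-1 = (tau * q)^-1)%R by rewrite -invfM mulrC.
have e2 : (B^-1 * tau^-1 = th^-1)%R by rewrite -invfM /B divfK// gt_eqF.
by rewrite poweRM ?poweR_ge0// -!poweRrM e1 e2.
Qed.

(** The weights have the form of a product, so that Hoelder's inequality applies
    in one index at a time, the weights of the other indices being constants. *)
Lemma mixed_seq_hoelder n (theta : 'I_n -> \bar R) (tau : 'I_n -> R)
    (b : 'I_n -> nat -> R) :
  (forall j, 1 <= theta j) -> (forall j, (1 <= tau j)%R) ->
  (forall j k, (0 < b j k)%R) ->
  (forall j, seq_norm (epsilon (theta j) (tau j)) (fun k => (b j k)%:E) < +oo) ->
  exists2 C : R, (0 <= C)%R & forall a : n.-tuple nat -> \bar R, (forall s, 0 <= a s) ->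
  mixed_seq_norm (fun j => (tau j)%:E)
    (fun s => (\prod_(j < n) b j (tnth s j))%:E * a s) <=
  C%:E * mixed_seq_norm theta a.
Proof.
elim: n theta tau b => [|n IH] theta tau b th1 t1 b0 bfin.
  exists 1%R => // a a0; rewrite /mixed_seq_norm !mixed_norm0 big_ord0 !mul1e.
  exact: lexx.
have [C C0 HC] := IH (fun j => theta (lift ord0 j)) (fun j => tau (lift ord0 j))
  (fun j => b (lift ord0 j)) (fun j => th1 _) (fun j => t1 _) (fun j => b0 _) (fun j => bfin _).
have tp j : (0 < tau j)%R by rewrite (lt_le_trans ltr01).
pose c := fine (seq_norm (epsilon (theta ord0) (tau ord0)) (fun k => (b ord0 k)%:E)).
have c0 : (0 <= c)%R by rewrite fine_ge0// seq_norm_ge0.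
have cE : seq_norm (epsilon (theta ord0) (tau ord0)) (fun k => (b ord0 k)%:E) = c%:E.
  by rewrite fineK// ge0_fin_numE// seq_norm_ge0.
have P0 (s : n.-tuple nat) : (0 <= \prod_(j < n) b (lift ord0 j) (tnth s j))%R.
  by apply: prodr_ge0 => j _; exact: ltW.
exists (c * C)%R => [|a a0]; first by rewrite mulr_ge0.
rewrite /mixed_seq_norm !mixed_norm_cons -!/(mixed_seq_norm _ _).
pose a' (s : n.-tuple nat) := seq_norm (theta ord0) (fun s0 => a (s0 ::: s)).
have a'0 s : 0 <= a' s by exact: seq_norm_ge0.
apply: (@le_trans _ _ (mixed_seq_norm (fun j => (tau (lift ord0 j))%:E)
  (fun s => c%:E * ((\prod_(j < n) b (lift ord0 j) (tnth s j))%:E * a' s)))).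
  apply: le_mixed_seq => [j|s|s]; rewrite ?lee_fin//; first exact: seq_norm_ge0.
  rewrite muleCA.
  rewrite (_ : (fun u => _) = fun u => (\prod_(j < n) b (lift ord0 j) (tnth s j))%:E *
     ((b ord0 u)%:E * a (u ::: s))); last first.
    apply/funext => u; rewrite big_ord_recl tnth0 muleA -EFinM mulrC.
    by congr ((_ * _)%:E * _); apply: eq_bigr => j _; rewrite tnthS.
  rewrite seq_norm_scale//; last first.
    by move=> k; rewrite mule_ge0// lee_fin ltW.
  apply: lee_wpmul2l; first by rewrite lee_fin.
  by rewrite -cE; exact: seq_norm_hoelder.
rewrite mixed_seq_scale//; last by move=> s; rewrite mule_ge0// lee_fin.
by rewrite (EFinM c C) -muleA; apply: lee_wpmul2l => //; exact: HC.
Qed.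

End hoelder_mixed.
(** * Discretization of the Lorentz norm *)

Section lorentz_dyadic.
Context {R : realType}.
Local Notation mu := (@lebesgue_measure R).
Local Open Scope ereal_scope.

(** Monotonicity of the integral, also for functions that are not measurable:
    the integral of a nonnegative function is a supremum over the simple
    functions below it. *)
Lemma ge0_le_integral_any d (T : measurableType d) (nu : {measure set T -> \bar R})
    (D : set T) (f g : T -> \bar R) :
  (forall x, D x -> 0 <= f x) -> (forall x, D x -> f x <= g x) ->
  \int[nu]_(x in D) f x <= \int[nu]_(x in D) g x.
Proof.
move=> f0 fg; have g0 x : D x -> 0 <= g x by move=> Dx; apply: le_trans (f0 x Dx) (fg x Dx).
rewrite !ge0_integralE//; apply: ereal_sup_le => _ [h hf <-]; exists h => //=.
move=> x; apply: le_trans (hf x) _; rewrite !patchE; case: ifPn => // /[!inE].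
exact: fg.
Qed.

Lemma dyadic_index (t : R) : (0 < t <= 1)%R ->
  exists k : nat, (2 ^- k.+1 < t <= 2 ^- k)%R.
Proof.
move=> /andP[t0 t1].
have ex : exists k : nat, (2 ^- k.+1 < t)%R.
  have := @cvg_geometric R 1 (2^-1)%R; rewrite ger0_norm ?invr_ge0// invf_lt1//.
  rewrite ltr1n => /(_ isT) /cvgrPdist_lt /(_ t t0)[N _ H].
  exists N; have := H N.+1 (leqnSn _); rewrite sub0r normrN /= mul1r exprVn.
  by rewrite ger0_norm// invr_ge0 exprn_ge0.
pose k := ex_minn ex; exists k; rewrite /k; case: ex_minnP => -[|j] /= H min; rewrite H/=.
  by rewrite expr0 invr1.
by rewrite leNgt; apply/negP => /min; rewrite ltnn.
Qed.

(** On the dyadic interval ]2^-(k+1), 2^-k], of measure [2^-(k+1)], the factor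
    [t^-1] is at most [2^(k+1)]: the interval contributes at most the value of
    [psi] at its right end times the bound of [g]. *)
Lemma lorentz_norm1_dyadic (psi : R -> R) (tau : R) (g : R -> \bar R) (a : nat -> \bar R) :
  (forall x y, x \in `[0%R, 1%R] -> y \in `[0%R, 1%R] -> (x <= y)%R -> (psi x <= psi y)%R) ->
  psi 0%R = 0%R -> (1 <= tau)%R ->
  (forall u, 0 <= g u) -> (forall k, 0 <= a k) ->
  (forall k u, (2 ^- k.+1 < u <= 2 ^- k)%R -> g u <= a k) ->
  lorentz_norm1 psi tau g <= seq_norm tau%:E (fun k => (psi (2 ^- k))%:E * a k).
Proof.
move=> psimon psi0 t1 g0 a0 ga; have t0 : (0 < tau)%R by rewrite (lt_le_trans ltr01).
have h01 (k : nat) : (2 ^- k : R) \in `[0%R, 1%R].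
  by rewrite in_itv/= invr_ge0 exprn_ge0//= invf_le1 ?exprn_gt0// exprn_ege1// ler1n.
have psige0 x : x \in `[0%R, 1%R] -> (0 <= psi x)%R.
  move=> x01; rewrite -psi0; apply: psimon => //; first by rewrite in_itv/= lexx/=.
  by move: x01; rewrite in_itv/= => /andP[].
have i0 t : t \in `[0%R, 1%R] -> 0 <= (psi t `^ tau)%:E * g t `^ tau * (t^-1)%:E.
  rewrite in_itv/= => /andP[t0' _].
  by rewrite mule_ge0// ?lee_fin ?invr_ge0// mule_ge0// ?poweR_ge0// lee_fin powR_ge0.
rewrite /lorentz_norm1 /=; apply: le_poweR; first by rewrite invr_ge0 ltW.
  by apply: integral_ge0 => t; exact: i0.
pose b k := `|(psi (2 ^- k))%:E * a k| `^ tau.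
have b0 k : 0 <= b k by exact: poweR_ge0.
pose I k := [set u : R | (2 ^- k.+1 < u <= 2 ^- k)%R].
pose S k (t : R) := (b k * ((2 ^+ k.+1)%R)%:E) * (\1_(I k) t)%:E.
have S0 k t : 0 <= S k t by rewrite mule_ge0// ?mule_ge0// lee_fin.
have mI k : measurable (I k).
  rewrite (_ : I k = `]2 ^- k.+1, 2 ^- k]%classic)%R; first exact: measurable_itv.
  by apply/seteqP; split => u; rewrite /I /= in_itv.
have mI1 k : measurable_fun (`[0%R, 1%R]%classic : set (measurableTypeR R)) (fun t : R => (\1_(I k) t : R)%:E).
  by apply/measurable_EFinP; apply: measurable_indic; exact: mI.
apply: (@le_trans _ _ (\int[mu]_(t in `[0%R, 1%R]) \sum_(k <oo) S k t)).
  apply: ge0_le_integral_any => [t|t t01]; first exact: i0.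
  have [->|tn0] := eqVneq t 0%R.
    by rewrite invr0 mule0; apply: nneseries_ge0.
  have := t01; rewrite /= in_itv/= => /andP[tge0 tle1].
  have tpos : (0 < t)%R by rewrite lt_neqAle eq_sym tn0.
  have [|k kt] := @dyadic_index t; first by rewrite tpos.
  apply: le_trans (ge_nneseries_term (u := fun k => S k t) k _) => //.
  rewrite /S indicE mem_set// mule1; have /andP[k1 k2] := kt.
  apply: lee_pmul; rewrite ?lee_fin ?invr_ge0//; last first.
    rewrite -[leRHS]invrK lef_pV2 ?posrE ?invr_gt0 ?exprn_gt0//; exact: ltW.
  - rewrite /b gee0_abs ?mule_ge0 ?lee_fin ?psige0//.
    rewrite poweRM ?lee_fin ?psige0//; apply: lee_pmul; rewrite ?poweR_ge0 ?lee_fin ?powR_ge0//.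
      apply: ge0_ler_powR; rewrite ?nnegrE ?psige0// ?(ltW t0)//.
      exact: psimon.
    by apply: le_poweR; rewrite ?(ltW t0)//; exact: ga.
  - by rewrite mule_ge0// ?poweR_ge0// lee_fin powR_ge0.
rewrite integral_nneseries//; last first.
  by move=> k; apply: emeasurable_funM => //; exact: mI1.
apply: lee_nneseries => [k _ _|k _]; first by apply: integral_ge0.
rewrite ge0_integralZl//; last by rewrite mule_ge0// lee_fin exprn_ge0.
have -> : \int[mu]_(x in `[0%R, 1%R]) (\1_(I k) x)%:E = mu (I k `&` `[0%R, 1%R]%classic).
  by apply: integral_indic => //; exact: mI.
rewrite -/(b k) -[b k in X in _ <= X]mule1.
rewrite -muleA; apply: lee_wpmul2l => //.
apply: (@le_trans _ _ ((2 ^+ k.+1)%:E * mu (I k))).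
  apply: lee_wpmul2l; first by rewrite lee_fin exprn_ge0.
  by apply: le_outer_measure; exact: subIsetl.
rewrite (_ : I k = `]2 ^- k.+1, 2 ^- k]%classic)%R; last first.
  by apply/seteqP; split => u; rewrite /I /= in_itv.
rewrite lebesgue_measure_itv/= lte_fin ltf_pV2 ?posrE ?exprn_gt0//.
rewrite ltr_eXn2l ?ltr1n// ltnS leqnn -EFinB -EFinM lee_fin.
by rewrite mulrBr mulfV ?expf_neq0// exprS mulfK ?expf_neq0// -addrA subrr addr0.
Qed.

Lemma lorentz_mixed_dyadic n (psi : 'I_n -> R -> R) (tau : 'I_n -> R)
    (F : n.-tuple R -> \bar R) (a : n.-tuple nat -> \bar R) :
  (forall j, Phi_function (psi j)) -> (forall j, (1 <= tau j)%R) ->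
  (forall x, 0 <= F x) -> (forall k, 0 <= a k) ->
  (forall k x, (forall j, 2 ^- (tnth k j).+1 < tnth x j <= 2 ^- (tnth k j))%R ->
     F x <= a k) ->
  mixed_norm (0%R : R) (fun j => lorentz_norm1 (psi j) (tau j)) F <=
  mixed_seq_norm (fun j => (tau j)%:E)
    (fun k => (\prod_(j < n) psi j (2 ^- tnth k j))%:E * a k).
Proof.
elim: n psi tau F a => [|n IH] psi tau F a psiP t1 F0 a0 Fa.
  by rewrite /mixed_seq_norm !mixed_norm0 big_ord0 mul1e; apply: Fa => -[].
rewrite /mixed_seq_norm !mixed_norm_cons.
pose a' (k : n.-tuple nat) := seq_norm (tau ord0)%:E
   (fun k0 => (psi ord0 (2 ^- k0))%:E * a (k0 ::: k)).
have psi0 j (k : nat) : (0 <= psi j (2 ^- k))%R.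
  have [_ mon _ p0 _] := psiP j; rewrite -p0.
  have k1 : (2 ^- k <= 1 :> R)%R by rewrite invf_le1 ?exprn_gt0// exprn_ege1// ler1n.
  have k0 : (0 <= 2 ^- k :> R)%R by rewrite invr_ge0 exprn_ge0.
  by apply: mon; rewrite ?in_itv/= ?lexx ?ler01 ?k0.
have -> : (fun y : n.-tuple nat => seq_norm (tau ord0)%:E
     (fun u => (\prod_(j < n.+1) psi j (2 ^- tnth (u ::: y) j))%:E * a (u ::: y))) =
   fun k => (\prod_(j < n) psi (lift ord0 j) (2 ^- tnth k j))%:E * a' k.
  apply/funext => k; rewrite /a' -seq_norm_scale//.
  - congr seq_norm; apply/funext => u; rewrite big_ord_recl tnth0 muleA -EFinM mulrC.
    by congr ((_ * _)%:E * _); apply: eq_bigr => j _; rewrite tnthS.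
  - by rewrite (lt_le_trans ltr01).
  - by apply: prodr_ge0.
  - by move=> u; rewrite mule_ge0// lee_fin.
apply: (IH (fun j => psi (lift ord0 j)) (fun j => tau (lift ord0 j))) => //.
- by move=> x; exact: poweR_ge0.
- by move=> k; exact: seq_norm_ge0.
move=> k x kx; have [_ mon _ p0 _] := psiP ord0.
apply: lorentz_norm1_dyadic => // k0 u ku; apply: Fa => j.
by case: (unliftP ord0 j) => [i ->|->]; rewrite ?tnth0// !tnthS.
Qed.

End lorentz_dyadic.

(** * Phi-functions and their dilation indices *)

Section phi_functions.
Context {R : realType}.
Variable phi : R -> R.
Hypothesis phiP : Phi_function phi.

Lemma Phi_mono x y : 0 <= x -> x <= y -> y <= 1 -> phi x <= phi y.
Proof.
move=> x0 xy y1; have [_ mon _ _ _] := phiP.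
by apply: mon => //; rewrite in_itv/= ?x0 ?y1 ?(le_trans x0 xy) ?(le_trans xy y1).
Qed.

(** Concavity between 0 and [t], together with [phi 0 = 0]. *)
Lemma Phi_scale c t : 0 <= c <= 1 -> 0 <= t <= 1 -> c * phi t <= phi (c * t).
Proof.
move=> /andP[c0 c1] /andP[t0 t1]; have [conc _ _ p0 _] := phiP.
have := conc t 0 c; rewrite !in_itv/= lexx ler01 t0 t1 c0 c1 => /(_ isT isT isT).
by rewrite p0 !mulr0 !addr0.
Qed.

(** [phi] is positive at some point, and concave: it is positive on the left of
    that point by [Phi_scale], and on the right by monotonicity. *)
Lemma Phi_gt0 t : 0 < t <= 1 -> 0 < phi t.
Proof.
move=> /andP[t0 t1]; have [_ _ _ p0 [s]] := phiP.
rewrite in_itv/= => /andP[s0 s1] ps.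
have ps0 : 0 < phi s by rewrite lt_neqAle eq_sym ps -p0 Phi_mono.
have sp : 0 < s.
  by rewrite lt_neqAle s0 andbT; apply: contra_neq ps => <-.
have [st|ts] := leP s t; first by apply: lt_le_trans ps0 _; exact: Phi_mono.
have ts1 : 0 <= t / s <= 1.
  by rewrite divr_ge0 ?(ltW t0)//= ler_pdivrMr// mul1r ltW.
have sn0 : s != 0 by rewrite gt_eqF.
rewrite -[t](divfK sn0).
apply: lt_le_trans (Phi_scale ts1 _); last by rewrite s0.
by rewrite mulr_gt0// divr_gt0.
Qed.

Lemma Phi_dbl t : 0 <= t -> 2 * t <= 1 -> phi (2 * t) <= 2 * phi t.
Proof.
move=> t0 t1; have h : 0 <= (2^-1 : R) <= 1 by rewrite invr_ge0 ler0n invf_le1// ler1n.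
have := @Phi_scale _ (2 * t) h; rewrite mulr_ge0//= t1 => /(_ isT).
by rewrite mulKf// ler_pdivrMl.
Qed.

End phi_functions.

Section dilation_indices.
Context {R : realType}.
Implicit Types (phi psi : R -> R).

Lemma dil_lower_gt phi (a : R) : (a%:E < dil_lower phi)%E ->
  exists2 d : R, 0 < d & forall t, 0 < t < d -> a < phi (2 * t) / phi t.
Proof.
rewrite /dil_lower /limf_einf /= lteNr -EFinN => /ereal_inf_lt[_ [A A0 <-]] aA.
have [d d0 dA] : exists2 d : R, 0 < d & forall t, 0 < t < d -> A t.
  move: A0 => /nbhs_ballP[d /= d0 dA]; exists d => // t /andP[t0 td].
  by apply: dA => //=; rewrite /ball/= sub0r normrN gtr0_norm.
exists d => // t /dA At; rewrite -ltrN2 -lte_fin; apply: le_lt_trans aA.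
by apply: ereal_sup_ubound; exists t.
Qed.

Lemma dil_upper_lt phi (a : R) : (dil_upper phi < a%:E)%E ->
  exists2 d : R, 0 < d & forall t, 0 < t < d -> phi (2 * t) / phi t < a.
Proof.
move=> /ereal_inf_lt[_ [A A0 <-]] aA.
have [d d0 dA] : exists2 d : R, 0 < d & forall t, 0 < t < d -> A t.
  move: A0 => /nbhs_ballP[d /= d0 dA]; exists d => // t /andP[t0 td].
  by apply: dA => //=; rewrite /ball/= sub0r normrN gtr0_norm.
exists d => // t /dA At; rewrite -lte_fin; apply: le_lt_trans aA.
by apply: ereal_sup_ubound; exists t.
Qed.

Lemma half_pow_lt (d : R) : 0 < d -> exists K : nat, forall k, (K <= k)%N -> 2 ^- k < d.
Proof.
move=> d0; have := @cvg_geometric R 1 2^-1.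
rewrite ger0_norm ?invr_ge0// invf_lt1// ltr1n.
move=> /(_ isT) /cvgrPdist_lt /(_ d d0)[N _ H]; exists N => k /H.
rewrite sub0r normrN /= mul1r exprVn.
by rewrite ger0_norm// invr_ge0 exprn_ge0.
Qed.

Lemma half_pow_range (k : nat) : 0 < (2 ^- k : R) <= 1.
Proof.
by rewrite invr_gt0 exprn_gt0//= invf_le1 ?exprn_gt0// exprn_ege1// ler1n.
Qed.

Lemma half_powS (k : nat) : 2 * 2 ^- k.+1 = 2 ^- k :> R.
Proof. by rewrite exprS invfM mulrA divff// mul1r. Qed.

(** Finitely many steps are not contracting; they are absorbed in the
    constant. *)
Lemma geometric_decay (x : nat -> R) (M q : R) (K : nat) :
  0 < q -> (forall k, 0 < x k) -> (forall k, x k.+1 <= M * x k) ->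
  (forall k, (K <= k)%N -> x k.+1 <= q * x k) ->
  exists2 C : R, 0 < C & forall s d, x (s + d)%N <= C * q ^+ d * x s.
Proof.
move=> q0 x0 xM xq; pose D := Num.max 1 (M / q).
have D1 : 1 <= D by rewrite le_max lexx.
have D0 : 0 < D by rewrite (lt_le_trans ltr01).
have DM : M <= D * q by rewrite -ler_pdivrMr// le_max lexx orbT.
exists (D ^+ K) => [|s d]; first by rewrite exprn_gt0.
apply: (@le_trans _ _ (D ^+ minn K (s + d) * q ^+ d * x s)); last first.
  by rewrite ler_pM2r// ler_pM2r ?exprn_gt0// ler_weXn2l// geq_minl.
elim: d => [|d IH].
  by rewrite addn0 expr0 mulr1 -[leLHS]mul1r ler_pM2r// exprn_ege1.
rewrite addnS; have [Ks|sK] := leqP K (s + d)%N.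
  apply: le_trans (xq _ Ks) _; apply: le_trans (ler_wpM2l (ltW q0) IH) _.
  have -> : minn K (s + d) = K by apply/minn_idPl.
  have -> : minn K (s + d).+1 = K by apply/minn_idPl; exact: leqW.
  by rewrite le_eqVlt; apply/orP; left; apply/eqP; rewrite exprS; ring.
apply: le_trans (xM _) _.
apply: le_trans (ler_wpM2r (ltW (x0 _)) DM) _.
have Dq : 0 <= D * q by rewrite mulr_ge0// ltW.
apply: le_trans (ler_wpM2l Dq IH) _.
have -> : minn K (s + d) = (s + d)%N by apply/minn_idPr; exact: ltnW.
have -> : minn K (s + d).+1 = (s + d).+1 by apply/minn_idPr.
rewrite !exprS le_eqVlt; apply/orP; left; apply/eqP; ring.
Qed.

Lemma lte_real_between (x y : \bar R) : (x < y)%E ->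
  exists a : R, (x < a%:E)%E /\ (a%:E < y)%E.
Proof.
case: x => [x| |]; case: y => [y| |] //.
- rewrite lte_fin => xy; exists ((x + y) / 2); rewrite !lte_fin.
  by rewrite midf_lt// midf_lt.
- by move=> _; exists (x + 1); rewrite lte_fin ltrDl ltr01 ltry.
- by move=> _; exists (y - 1); rewrite lte_fin gtrDl ltrN10 ltNyr.
- by move=> _; exists 0; rewrite ltNyr ltry.
Qed.

Lemma nat_dist_ge k s : (s <= k)%N -> nat_dist k s = (k - s)%N.
Proof. by rewrite /nat_dist -subn_eq0 => /eqP ->; rewrite addn0. Qed.

Lemma nat_dist_le k s : (k <= s)%N -> nat_dist k s = (s - k)%N.
Proof. by rewrite /nat_dist -subn_eq0 => /eqP ->. Qed.

Lemma ratio_step (x1 y1 x y c d : R) : 0 < y1 -> 0 < y -> 0 <= c -> 0 <= x1 ->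
  x1 <= c * x -> y <= d * y1 -> x1 / y1 <= c * d * (x / y).
Proof.
move=> y10 y0 c0 x10 xc yd; rewrite ler_pdivrMr// mulrA mulrAC ler_pdivlMr//.
have -> : c * d * x * y1 = (c * x) * (d * y1) by ring.
by apply: ler_pM => //; exact: ltW.
Qed.

Lemma ratio_swap (a b c d m : R) : 0 < a -> 0 < b -> 0 < c -> 0 < d ->
  a / b <= m * (c / d) -> d / c <= m * (b / a).
Proof.
move=> a0 b0 c0 d0; rewrite ler_pdivrMr// mulrA mulrAC ler_pdivlMr// => H.
rewrite ler_pdivrMr// mulrA mulrAC ler_pdivlMr// mulrC.
by rewrite -(mulrA m b c) (mulrC b c) mulrA.
Qed.

(** For [s <= k] the denominator does not depend on [k], and [psi (2^-k)]
    decreases geometrically as [alpha_psi > 1].  For [k < s] the quotient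
    [psi / phi] is considered at [2^-k] itself, and it increases geometrically
    with the index as [beta_psi < alpha_phi]. *)
Lemma dilation_kernel phi psi : Phi_function phi -> Phi_function psi ->
  (1 < dil_lower psi)%E -> (dil_upper psi < dil_lower phi)%E ->
  exists2 q : R, 0 < q < 1 & exists2 C : R, 0 < C & forall k s : nat,
    psi (2 ^- k) / phi (Num.max (2 ^- k) (2 ^- s)) <=
    C * q ^+ nat_dist k s * (psi (2 ^- s) / phi (2 ^- s)).
Proof.
move=> phiP psiP /lte_real_between[a [a1 /dil_lower_gt[d1 d10 H1]]].
move=> /lte_real_between[c0 [/dil_upper_lt[d2 d20 H2] /lte_real_between[b [c0b]]]].
move=> /dil_lower_gt[d3 d30 H3]; rewrite lte_fin in a1; rewrite lte_fin in c0b.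
have psi0 k : 0 < psi (2 ^- k) by apply: Phi_gt0 => //; exact: half_pow_range.
have phi0 k : 0 < phi (2 ^- k) by apply: Phi_gt0 => //; exact: half_pow_range.
have [K1 HK1] := half_pow_lt d10; have [K2 HK2] := half_pow_lt d20.
have [K3 HK3] := half_pow_lt d30.
have pos k : 0 < (2 ^- k : R) by have /andP[] := half_pow_range k.
have c00 : 0 < c0.
  apply: lt_trans (H2 (2 ^- K2.+1) _); last by rewrite pos HK2.
  by rewrite half_powS divr_gt0.
have b0 : 0 < b by exact: lt_trans c0b.
have a0 : 0 < a by rewrite (lt_trans ltr01).
have mono (f : R -> R) k : Phi_function f -> f (2 ^- k.+1) <= f (2 ^- k).
  move=> fP; apply: (Phi_mono fP); first exact: ltW.
    by rewrite lef_pV2 ?posrE ?exprn_gt0// ler_weXn2l// ler1n.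
  by have /andP[] := half_pow_range k.
have dbl (f : R -> R) k : Phi_function f -> f (2 ^- k) <= 2 * f (2 ^- k.+1).
  move=> fP; rewrite -half_powS; apply: (Phi_dbl fP); first exact: ltW.
  by rewrite half_powS; have /andP[] := half_pow_range k.
have [||||C1 C10 HC1] := @geometric_decay (fun k => psi (2 ^- k)) 1 a^-1 K1.
- by rewrite invr_gt0.
- by [].
- by move=> k; rewrite mul1r mono.
- move=> k K1k; rewrite ler_pdivlMl//; have := H1 (2 ^- k.+1).
  rewrite pos HK1 ?leqW// half_powS => /(_ isT).
  by rewrite ltr_pdivlMr// => /ltW.
have [||||C2 C20 HC2] := @geometric_decay
    (fun k => phi (2 ^- k) / psi (2 ^- k)) 2 (c0 / b) (maxn K2 K3).
- by rewrite divr_gt0.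
- by move=> k; rewrite divr_gt0.
- move=> k; rewrite -[X in _ <= X * _]mul1r; apply: ratio_step; rewrite ?(ltW (phi0 _))//.
    by rewrite mul1r mono.
  exact: dbl.
- move=> k; rewrite geq_max => /andP[K2k K3k].
  have h2 : psi (2 ^- k) <= c0 * psi (2 ^- k.+1).
    have := H2 (2 ^- k.+1); rewrite pos HK2 ?leqW// half_powS => /(_ isT).
    by rewrite ltr_pdivrMr// => /ltW.
  have h3 : phi (2 ^- k.+1) <= b^-1 * phi (2 ^- k).
    have := H3 (2 ^- k.+1); rewrite pos HK3 ?leqW// half_powS => /(_ isT).
    by rewrite ltr_pdivlMr// ler_pdivlMl// => /ltW.
  rewrite [c0 / b]mulrC; apply: ratio_step; rewrite ?(ltW (phi0 _))//.
  by rewrite invr_ge0 ltW.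
exists (Num.max a^-1 (c0 / b)).
  by rewrite lt_max invr_gt0 a0/= gt_max invf_lt1// a1/= ltr_pdivrMr// mul1r.
set q := Num.max _ _; have q0 : 0 < q by rewrite lt_max invr_gt0 a0.
exists (Num.max C1 C2) => [|k s]; first by rewrite lt_max C10.
have [sk|ks] := leqP s k.
  rewrite max_r; last by rewrite lef_pV2 ?posrE ?exprn_gt0// ler_weXn2l// ler1n.
  rewrite mulrA ler_pM2r ?invr_gt0// (nat_dist_ge sk) -{1}(subnKC sk).
  apply: le_trans (HC1 _ _) _; rewrite ler_pM2r//.
  apply: ler_pM; rewrite ?exprn_ge0 ?invr_ge0 ?(ltW C10) ?(ltW a0)//.
    by rewrite le_max lexx.
  by rewrite lerXn2r ?nnegrE ?invr_ge0 ?(ltW a0) ?(ltW q0)// le_max lexx.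
rewrite max_l; last by rewrite lef_pV2 ?posrE ?exprn_gt0// ler_weXn2l// ?ler1n// ltnW.
have := HC2 k (s - k)%N; rewrite subnKC ?(ltnW ks)// => H.
rewrite (nat_dist_le (ltnW ks)).
apply: ratio_swap => //.
apply: le_trans H _; rewrite ler_pM2r ?divr_gt0//.
apply: ler_pM; rewrite ?exprn_ge0 ?divr_ge0 ?(ltW C20) ?(ltW c00) ?(ltW b0)//.
  by rewrite le_max lexx orbT.
by rewrite lerXn2r ?nnegrE ?divr_ge0 ?(ltW c00) ?(ltW b0) ?(ltW q0)// le_max lexx orbT.
Qed.

(** [phi (2^-k)] decreases at most like [a^-k] with [a < 2], more slowly than
    [2^-k]. *)
Lemma dilation_summable phi : Phi_function phi -> (dil_upper phi < 2%:E)%E ->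
  (\sum_(k <oo) (2 ^- k / phi (2 ^- k))%:E < +oo)%E.
Proof.
move=> phiP /lte_real_between[a [/dil_upper_lt[d d0 Hd]]]; rewrite lte_fin => a2.
have phi0 k : 0 < phi (2 ^- k) by apply: Phi_gt0 => //; exact: half_pow_range.
have pos k : 0 < (2 ^- k : R) by have /andP[] := half_pow_range k.
have [K HK] := half_pow_lt d0.
have a0 : 0 < a.
  apply: lt_trans (Hd (2 ^- K.+1) _); last by rewrite pos HK.
  by rewrite half_powS divr_gt0.
pose z (k : nat) : R := 2 ^- k / phi (2 ^- k).
have z0 k : 0 < z k by rewrite divr_gt0.
have zS k (c : R) : 0 < c -> phi (2 ^- k) <= c * phi (2 ^- k.+1) -> z k.+1 <= c / 2 * z k.
  move=> c0; rewrite /z; move: (phi0 k) (phi0 k.+1).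
  move: (phi (2 ^- k)) (phi (2 ^- k.+1)) => p0 p1 p00 p10 h.
  have -> : c / 2 * (2 ^- k / p0) = c * 2 ^- k.+1 / p0.
    by rewrite -(half_powS k); move: (2 ^- k.+1) => A; field; rewrite gt_eqF.
  by rewrite ler_pdivrMr// mulrAC ler_pdivlMr// mulrAC [c * _ * _]mulrC ler_pM2l.
have [||||C C0 HC] := @geometric_decay z 1 (a / 2) K.
- by rewrite divr_gt0.
- by [].
- move=> k; rewrite -[1](divff (_ : 2 != 0 :> R))//; apply: zS => //.
  rewrite -half_powS; apply: (Phi_dbl phiP); first exact: ltW.
  by rewrite half_powS; have /andP[] := half_pow_range k.
- move=> k Kk; apply: zS => //; have := Hd (2 ^- k.+1).
  rewrite pos HK ?leqW// half_powS => /(_ isT).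
  by rewrite ltr_pdivrMr// => /ltW.
have q1 : a / 2 < 1 by rewrite ltr_pdivrMr// mul1r.
apply: (@le_lt_trans _ _ ((C * z 0%N) / (1 - a / 2))%:E); last by rewrite ltry.
apply: lime_le; first by apply: is_cvg_nneseries => n _ _; rewrite lee_fin; exact: ltW (z0 n).
apply: nearW => n; rewrite sumEFin lee_fin.
apply: (@le_trans _ _ (series (geometric (C * z 0%N) (a / 2)) n)).
  rewrite /series/=; apply: ler_sum => i _.
  by have := HC 0%N i; rewrite add0n mulrAC.
have aq : 0 < a / 2 by rewrite divr_gt0.
apply: geometric_le_lim => //; last by rewrite gtr0_norm.
by rewrite mulr_ge0// ltW.
Qed.

End dilation_indices.

(** * Lebesgue measure on tuples *)

Lemma behead_tcons (T : Type) n (u : T) (x : n.-tuple T) :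
  [tuple of behead (u ::: x)] = x.
Proof. exact: val_inj. Qed.

Section lebesgue_tuple_measure.
Context {R : realType}.
Local Open Scope ereal_scope.
Local Notation leb := (@lebesgue_measure R).

Definition tcons n (p : measurableTypeR R * n.-tuple R) : n.+1.-tuple R := p.1 ::: p.2.

Lemma measurable_tcons n : measurable_fun setT (@tcons n).
Proof. exact: (measurable_cons measurable_fst measurable_snd). Qed.

(** Measure and sigma-finiteness are established together by induction: the
    recursion integrates the measures of sections, and identifying this with a
    product measure needs the previous measure to be sigma-finite. *)
Definition is_sfmeasure n (mu : set (n.-tuple R) -> \bar R) :=
  [/\ mu set0 = 0, (forall A, 0 <= mu A), semi_sigma_additive mu &
      sigma_finite setT mu].

Section pack.
Variables (n : nat) (mu : set (n.-tuple R) -> \bar R) (H : is_sfmeasure mu).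
(** A measure in the sense of the hierarchy, available inside the induction only
    under the induction hypothesis, which it carries as an argument. *)
Definition pack_mu of is_sfmeasure mu := mu.
HB.instance Definition _ := isMeasure.Build _ _ _ (pack_mu H)
  (let: And4 a _ _ _ := H in a) (let: And4 _ a _ _ := H in a)
  (let: And4 _ _ a _ := H in a).
HB.instance Definition _ := Measure_isSigmaFinite.Build _ _ _ (pack_mu H)
  (let: And4 _ _ _ a := H in a).
End pack.

Lemma lebesgue_tupleS_prod n (H : is_sfmeasure (@lebesgue_tuple R n)) (A : set (n.+1.-tuple R)) :
  lebesgue_tuple A = (leb \x pack_mu H) (@tcons n @^-1` A).
Proof.
rewrite /= /product_measure1; apply: eq_integral => u _ /=.
congr (lebesgue_tuple _); apply/seteqP; split => x /=; rewrite /xsection/= inE//.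
Qed.

Lemma lebesgue_tuple_sfmeasure n : is_sfmeasure (@lebesgue_tuple R n).
Proof.
elim: n => [|n IH].
  split; [exact: (@measure0 _ _ _ (dirac [tuple]))|move=> A; exact: (measure_ge0 (dirac [tuple]))|exact: (@measure_semi_sigma_additive _ _ _ (dirac [tuple]))|].
  exists (fun=> setT); first by rewrite bigcup_const.
  by move=> _; split => //; rewrite /= diracT ltry.
pose P := (leb \x pack_mu IH).
split.
- by rewrite lebesgue_tupleS_prod preimage_set0 measure0.
- by move=> A; rewrite lebesgue_tupleS_prod measure_ge0.
- move=> F mF tF mUF; rewrite lebesgue_tupleS_prod.
  rewrite (_ : (fun n0 => _) = (fun k => \sum_(0 <= i < k) P (@tcons n @^-1` F i))); last first.
    by apply/funext => k; apply: eq_bigr => i _; rewrite lebesgue_tupleS_prod.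
  rewrite preimage_bigcup; apply: measure_semi_sigma_additive.
  + by move=> i; rewrite -[X in measurable X]setTI; exact: measurable_tcons.
  + move/trivIsetP : tF => tF; apply/trivIsetP => i j _ _ ij.
    by rewrite -preimage_setI tF// preimage_set0.
  + by rewrite -preimage_bigcup -[X in measurable X]setTI; exact: measurable_tcons.
- have /sigma_finiteP[F [TF ndF Foo]] := sigma_finiteT leb.
  have /sigma_finiteP[G [TG ndG Goo]] := sigma_finiteT (pack_mu IH).
  exists (fun k => (fun x : n.+1.-tuple R => (thead x, [tuple of behead x])) @^-1` (F k `*` G k)).
    apply/esym/seteqP; split => // x _.
    have [i _ Fi] : (\bigcup_i F i) (thead x) by rewrite -TF.
    have [j _ Gj] : (\bigcup_i G i) [tuple of behead x] by rewrite -TG.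
    exists (maxn i j) => //; split.
      by move: Fi; exact/subsetPset/ndF/leq_maxl.
    by move: Gj; exact/subsetPset/ndG/leq_maxr.
  move=> k; have [mF Fk] := Foo k; have [mG Gk] := Goo k; split.
    have mh : measurable_fun setT (fun x : n.+1.-tuple R => thead x).
      exact: (@measurable_tnth _ _ n.+1 ord0).
    have mt := @measurable_behead _ R n.
    rewrite (_ : _ @^-1` _ = (fun x : n.+1.-tuple R => thead x) @^-1` F k `&`
       (fun x : n.+1.-tuple R => [tuple of behead x]) @^-1` G k); last first.
      by apply/seteqP; split => x.
    apply: measurableI; rewrite -[X in measurable X]setTI.
      exact: mh.
    exact: mt.
  rewrite lebesgue_tupleS_prod (_ : _ @^-1` _ = F k `*` G k).
    by rewrite product_measure1E// lte_mul_pinfty// ge0_fin_numE.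
  by apply/seteqP; split=> -[u x]; rewrite /tcons /= theadE behead_tcons.
Qed.

HB.instance Definition _ n := isMeasure.Build _ _ _ (@lebesgue_tuple R n)
  (let: And4 a _ _ _ := lebesgue_tuple_sfmeasure n in a)
  (let: And4 _ a _ _ := lebesgue_tuple_sfmeasure n in a)
  (let: And4 _ _ a _ := lebesgue_tuple_sfmeasure n in a).
HB.instance Definition _ n := Measure_isSigmaFinite.Build _ _ _ (@lebesgue_tuple R n)
  (let: And4 _ _ _ a := lebesgue_tuple_sfmeasure n in a).

Lemma lebesgue_tupleS n (A : set (n.+1.-tuple R)) :
  lebesgue_tuple A = (leb \x @lebesgue_tuple R n) (@tcons n @^-1` A).
Proof.
rewrite /= /product_measure1; apply: eq_integral => u _ /=.
congr (lebesgue_tuple _); apply/seteqP; split => x /=; rewrite /xsection/= inE//.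
Qed.

End lebesgue_tuple_measure.

(** * Tonelli theorems on the torus *)

Section tonelli_tuple.
Context {R : realType}.
Local Open Scope ereal_scope.
Local Notation leb := (@lebesgue_measure R).
Local Notation lebT n := (@lebesgue_tuple R n).
Local Notation I2pi := (`[0%R, (2 * pi)%R]%classic : set (measurableTypeR R)).

Lemma measurable_cons_comp n (F : n.+1.-tuple R -> \bar R) : measurable_fun setT F ->
  measurable_fun setT (F \o @tcons R n).
Proof. by move=> mF; apply: measurableT_comp mF (@measurable_tcons R n). Qed.

Lemma measurable_cons_l n (F : n.+1.-tuple R -> \bar R) (x : n.-tuple R) :
  measurable_fun setT F ->
  measurable_fun setT (fun u : measurableTypeR R => F (u ::: x)).
Proof.
by move=> mF; exact: (measurableT_comp (measurable_cons_comp mF) (pair2_measurable x)).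
Qed.

Lemma measurable_cons_r n (F : n.+1.-tuple R -> \bar R) (u : R) :
  measurable_fun setT F -> measurable_fun setT (fun x : n.-tuple R => F (u ::: x)).
Proof.
by move=> mF; exact: (measurableT_comp (measurable_cons_comp mF)
  (pair1_measurable (u : measurableTypeR R))).
Qed.

Lemma integral_tuple_cons n (F : n.+1.-tuple R -> \bar R) :
  measurable_fun setT F -> (forall x, 0 <= F x) ->
  \int[lebT (n.+1)%N]_x F x = \int[leb]_u \int[lebT n]_x F (u ::: x).
Proof.
move=> mF F0.
transitivity (\int[pushforward (leb \x lebT n) (@tcons R n)]_x F x).
  apply: (congr1 (fun mu : set (n.+1.-tuple R) -> \bar R => \int[mu]_x F x)).
  by apply/funext => A; exact: lebesgue_tupleS.
rewrite (ge0_integral_pushforward (@measurable_tcons R n))//.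
exact: (fubini_tonelli1 (m1 := leb) (m2 := lebT n) (F \o @tcons R n)
  (measurable_cons_comp mF) (fun x => F0 _)).
Qed.

Lemma integral_tuple_consC n (F : n.+1.-tuple R -> \bar R) :
  measurable_fun setT F -> (forall x, 0 <= F x) ->
  \int[lebT (n.+1)%N]_x F x = \int[lebT n]_x \int[leb]_u F (u ::: x).
Proof.
move=> mF F0; rewrite integral_tuple_cons//.
exact: (fubini_tonelli (m1 := leb) (m2 := lebT n) (F \o @tcons R n)
  (measurable_cons_comp mF) (fun x => F0 _)).
Qed.

Lemma measurable_integral_l n (F : n.+1.-tuple R -> \bar R) :
  measurable_fun setT F -> (forall x, 0 <= F x) ->
  measurable_fun setT (fun x : n.-tuple R => \int[leb]_u F (u ::: x)).
Proof.
move=> mF F0; exact: (measurable_fun_fubini_tonelli_G (m1 := leb)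
  (F \o @tcons R n) (measurable_cons_comp mF) (fun x => F0 _)).
Qed.

Lemma measurable_torus n : measurable (@torus R n).
Proof.
rewrite (_ : @torus R n = \bigcap_(j in [set: 'I_n]) ((fun x : n.-tuple R => tnth x j) @^-1` `[0%R, (2 * pi)%R]%classic)).
  apply: fin_bigcap_measurable; first exact: finite_finset.
  by move=> j _; rewrite -[X in measurable X]setTI; apply: measurable_tnth.
by apply/seteqP; split => [x xT j _ /=|x xT j]; [exact: xT|exact: (xT j)].
Qed.

Lemma torus_consE n (u : R) (x : n.-tuple R) :
  torus (u ::: x) <-> (u \in `[0%R, (2 * pi)%R]) /\ torus x.
Proof.
split => [H|[u0 xT] j]; last first.
  by case: (unliftP ord0 j) => [k ->|->]; rewrite ?tnth0// tnthS.
split; first by have := H ord0; rewrite tnth0.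
by move=> j; have := H (lift ord0 j); rewrite tnthS.
Qed.

Lemma torus_patch_cons n (F : n.+1.-tuple R -> \bar R) u (x : n.-tuple R) :
  (F \_ (@torus R n.+1)) (u ::: x) =
  ((fun u => ((fun x => F (u ::: x)) \_ (@torus R n)) x) \_ I2pi) u.
Proof.
rewrite !patchE; have [u0|u0] := boolP (u \in I2pi); last first.
  by rewrite memNset// => /torus_consE[uI _]; move/negP: u0; apply; apply/mem_set.
have [xT|xT] := boolP (x \in (@torus R n)).
  by rewrite mem_set//; apply/torus_consE; split; [move/set_mem: u0|move/set_mem: xT].
by rewrite memNset// => /torus_consE[_ /mem_set]; exact/negP.
Qed.

Lemma measurable_patch_torus n (F : n.-tuple R -> \bar R) :
  measurable_fun setT F -> measurable_fun setT (F \_ (@torus R n)).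
Proof.
move=> mF; apply/(measurable_restrictT _ (@measurable_torus n)).
exact: measurable_funTS.
Qed.

Lemma integral_torus_cons n (F : n.+1.-tuple R -> \bar R) :
  measurable_fun setT F -> (forall x, 0 <= F x) ->
  \int[lebT (n.+1)%N]_(x in (@torus R n.+1)) F x =
  \int[leb]_(u in I2pi) \int[lebT n]_(x in (@torus R n)) F (u ::: x).
Proof.
move=> mF F0; rewrite integral_mkcond integral_tuple_cons; last 2 first.
- exact: measurable_patch_torus.
- by move=> x; apply: erestrict_ge0.
rewrite [RHS]integral_mkcond; apply: eq_integral => u _.
under eq_integral do rewrite torus_patch_cons.
rewrite !patchE; case: ifPn => uI; last first.
  by rewrite integral0_eq// => x _; rewrite patchE (negbTE uI).
rewrite [RHS]integral_mkcond; apply: eq_integral => x _.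
by rewrite patchE uI.
Qed.

Lemma integral_torus_consC n (F : n.+1.-tuple R -> \bar R) :
  measurable_fun setT F -> (forall x, 0 <= F x) ->
  \int[lebT (n.+1)%N]_(x in (@torus R n.+1)) F x =
  \int[lebT n]_(x in (@torus R n)) \int[leb]_(u in I2pi) F (u ::: x).
Proof.
move=> mF F0; rewrite integral_mkcond integral_tuple_consC; last 2 first.
- exact: measurable_patch_torus.
- by move=> x; apply: erestrict_ge0.
rewrite [RHS]integral_mkcond; apply: eq_integral => x _.
under eq_integral do rewrite torus_patch_cons.
rewrite !patchE; case: ifPn => xT; last first.
  by rewrite integral0_eq// => u _; rewrite !patchE (negbTE xT) if_same.
rewrite [RHS]integral_mkcond; apply: eq_integral => u _.
by rewrite !patchE xT.
Qed.

End tonelli_tuple.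

Section null_sets.
Context {R : realType}.
Local Open Scope ereal_scope.
Local Notation leb := (@lebesgue_measure R).
Local Notation lebT n := (@lebesgue_tuple R n).

Lemma measurable_cons_slice n (A : set (n.+1.-tuple R)) (x : n.-tuple R) :
  measurable A -> measurable ([set u | A (u ::: x)] : set (measurableTypeR R)).
Proof.
move=> mA; have := @measurable_ysection _ _ _ _ _ x (measurable_tcons measurableT mA).
by rewrite setTI; congr measurable; apply/seteqP; split => u; rewrite /ysection/= ?inE.
Qed.

Lemma slice_measureE n (A : set (n.+1.-tuple R)) (x : n.-tuple R) :
  measurable A -> leb [set u | A (u ::: x)] = \int[leb]_u (\1_A (u ::: x))%:E.
Proof.
move=> mA; have mx := measurable_cons_slice x mA.
by rewrite -[in LHS](setIT [set u | _]) -(integral_indic leb measurableT mx).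
Qed.

Lemma measurable_slice_measure n (A : set (n.+1.-tuple R)) : measurable A ->
  measurable_fun setT (fun x : n.-tuple R => leb [set u | A (u ::: x)]).
Proof.
move=> mA; rewrite (funext (fun x => slice_measureE x mA)).
apply: (@measurable_integral_l _ _ (fun z => (\1_A z)%:E)).
  exact/measurable_EFinP/measurable_indic.
by move=> x; rewrite lee_fin.
Qed.

Lemma integral0_null d (T : measurableType d) (mu : {measure set T -> \bar R})
    (D : set T) (f : T -> \bar R) : measurable D -> measurable_fun D f ->
  (forall x, D x -> 0 <= f x) -> \int[mu]_(x in D) f x = 0 ->
  mu (D `&` [set x | f x != 0]) = 0.
Proof.
move=> mD mf f0 If.
have /(ae_eq_integral_abs mu mD mf) : \int[mu]_(x in D) `|f x| = 0.
  rewrite -[RHS]If; apply: eq_integral => x /set_mem Dx.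
  by rewrite gee0_abs// f0.
move=> [B [mB B0 sB]]; apply/eqP; rewrite eq_le measure_ge0 andbT -[leRHS]B0.
apply: le_measure; rewrite ?inE//.
- rewrite (_ : [set x | f x != 0] = f @^-1` (~` [set 0])).
    by apply: mf => //; exact: measurableC.
  by apply/seteqP; split => x /=; move/eqP.
- by move=> x [Dx /= /eqP fx]; apply: sB => /= /(_ Dx).
Qed.

(** Almost all sections of a null set are null, in a form that does not involve
    the almost-everywhere filter. *)
Lemma slice_null n (N : set (n.+1.-tuple R)) : measurable N ->
  lebT (n.+1)%N N = 0 ->
  measurable [set x : n.-tuple R | leb [set u | N (u ::: x)] != 0] /\
  lebT n [set x : n.-tuple R | leb [set u | N (u ::: x)] != 0] = 0.
Proof.
move=> mN N0; split.
  rewrite (_ : [set x | _] = (fun x : n.-tuple R => leb [set u | N (u ::: x)]) @^-1` (~` [set 0])).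
    by rewrite -[X in measurable X]setTI; apply: (measurable_slice_measure mN) => //; exact: measurableC.
  by apply/seteqP; split => x /=; move/eqP.
rewrite -[X in lebT n X]setTI; apply: (integral0_null measurableT (measurable_slice_measure mN)).
  by move=> x _; exact: measure_ge0.
rewrite (eq_integral (fun x : n.-tuple R => \int[leb]_u (\1_N (u ::: x))%:E)); last first.
  by move=> x _; exact: slice_measureE.
rewrite -(integral_tuple_consC (F := fun z => (\1_N z)%:E)).
- by rewrite (integral_indic (lebT n.+1) measurableT mN) setIT.
- exact/measurable_EFinP/measurable_indic.
- by move=> x; rewrite lee_fin.
Qed.

(** A null set may carry infinite values without being seen by [star], at points
    with positive coordinates: almost all of its sections are null, so the
    first rearrangement is again infinite on a null set only. *)
Lemma star_null n (N : set (n.-tuple R)) t :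
  (forall j, (0 < tnth t j)%R) -> measurable N -> lebT n N = 0 ->
  star (fun x => if `[< N x >] then +oo else 0) t = 0.
Proof.
elim: n N t => [|n IH] N t t0 mN N0.
  move: N0; rewrite /= diracE; case: asboolP => // N1 /eqP.
  by rewrite mem_set// onee_eq0.
case/tupleP: t t0 => t0 t tpos.
have t0_gt0 : (0 < t0)%R by have := tpos ord0; rewrite tnth0.
apply/eqP; rewrite eq_le star_ge0 ?andbT; last by move=> x _; case: ifP.
rewrite star_cons.
pose S := [set x : n.-tuple R | leb [set u | N (u ::: x)] != 0].
have [mS S0] : measurable S /\ lebT n S = 0 by exact: slice_null.
have tpos' j : (0 < tnth t j)%R by have := tpos (lift ord0 j); rewrite tnthS.
rewrite -[leRHS](IH S t tpos' mS S0); apply: le_star => x _.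
have [_|/negP] := asboolP (S x); first exact: leey.
rewrite /S /= negbK => /eqP Sx.
apply: lee_realP => l l0; apply: rearrangement_le; first by rewrite -lte_fin.
apply: (@le_lt_trans _ _ 0); last by rewrite lte_fin.
apply: (@le_trans _ _ (leb [set u | [set v | N (v ::: x)] ((2 * pi) * u + 0)%R])).
  apply: le_outer_measure => u [_ /=]; rewrite addr0; case: asboolP => //.
  by move=> _ /lt_trans /(_ l0); rewrite ltxx.
apply: le_trans (lebesgue_outer_affine _ _ _) _; first by rewrite mulr_gt0// pi_gt0.
by rewrite [X in _ * X]Sx mule0.
Qed.

End null_sets.

Section tonelli_coordinate.
Context {R : realType}.
Local Open Scope ereal_scope.
Local Notation leb := (@lebesgue_measure R).
Local Notation lebT n := (@lebesgue_tuple R n).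
Local Notation I2pi := (`[0%R, (2 * pi)%R]%classic : set (measurableTypeR R)).

Lemma measurable_upd n (j : 'I_n) : measurable_fun setT
  (fun p : n.-tuple R * measurableTypeR R => upd p.1 j (p.2 : R)).
Proof.
apply/measurable_fun_tnthP => i.
rewrite (_ : _ \o _ = fun p : n.-tuple R * measurableTypeR R =>
   if i == j then (p.2 : R) else tnth p.1 i); last first.
  by apply/funext => p /=; rewrite tnth_mktuple.
case: (i == j); first exact: measurable_snd.
exact: (measurableT_comp (@measurable_tnth _ _ n i) measurable_fst).
Qed.

Lemma measurable_upd_l n (j : 'I_n) (x : n.-tuple R) :
  measurable_fun setT (fun u : measurableTypeR R => upd x j (u : R)).
Proof. exact: (measurableT_comp (@measurable_upd n j) (pair1_measurable x)). Qed.

(** Integration in an arbitrary coordinate, as a measurable function of all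
    coordinates, of which the integrated one is a dummy. *)
Lemma measurable_upd_integral n (F : n.-tuple R -> \bar R) (j : 'I_n) :
  measurable_fun setT F -> (forall x, 0 <= F x) ->
  measurable_fun setT (fun x => \int[leb]_(u in I2pi) F (upd x j u)).
Proof.
move=> mF F0.
pose G (p : n.-tuple R * measurableTypeR R) := ((fun p => F (upd p.1 j p.2)) \_ (setT `*` I2pi)) p.
rewrite (_ : (fun x => _) = fun x : n.-tuple R => \int[leb]_u G (x, u)); last first.
  apply/funext => x; rewrite integral_mkcond; apply: eq_integral => u _.
  have E : ((x, u) \in (setT : set (n.-tuple R)) `*` I2pi) = (u \in I2pi).
    apply/idP/idP => /set_mem H; apply/mem_set; first by case: H.
    by split.
  by rewrite /G !patchE E.
apply: (measurable_fun_fubini_tonelli_F (m2 := leb) G).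
  have mI : measurable ((setT : set (n.-tuple R)) `*` I2pi) by exact: measurableX.
  apply/(measurable_restrictT _ mI); apply: measurable_funTS.
  exact: measurableT_comp mF (@measurable_upd n j).
by move=> p; apply: erestrict_ge0.
Qed.

Lemma leb_I2pi : leb I2pi = (2 * pi)%:E.
Proof. by rewrite lebesgue_measure_itv/= lte_fin mulr_gt0 ?pi_gt0// oppr0 adde0. Qed.

Lemma measurable_torus_integral_r n (F : n.+1.-tuple R -> \bar R) :
  measurable_fun setT F -> (forall x, 0 <= F x) ->
  measurable_fun setT
    (fun u : measurableTypeR R => \int[lebT n]_(x in @torus R n) F (u ::: x)).
Proof.
move=> mF F0.
pose D := [set z : n.+1.-tuple R | torus [tuple of behead z]].
have mD : measurable D.
  by rewrite -[X in measurable X]setTI; apply: measurable_behead => //; exact: measurable_torus.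
have mFD : measurable_fun setT (F \_ D).
  by apply/(measurable_restrictT _ mD); exact: measurable_funTS.
rewrite (_ : (fun u => _) = fun u : measurableTypeR R => \int[lebT n]_x (F \_ D) (u ::: x)).
  apply: (measurable_fun_fubini_tonelli_F (m2 := lebT n) ((F \_ D) \o @tcons R n)).
    exact: measurable_cons_comp.
  by move=> p; apply: erestrict_ge0.
apply/funext => u; rewrite integral_mkcond; apply: eq_integral => x _.
have E : ((u : R) ::: x \in D) = (x \in @torus R n).
  by apply/idP/idP => /set_mem H; apply/mem_set; move: H; rewrite /D/= behead_tcons.
by rewrite !patchE E.
Qed.

(** Integrating in one coordinate and then over the torus counts the period of
    the dummy coordinate. *)
Lemma tonelli_torus n (F : n.-tuple R -> \bar R) (j : 'I_n) :
  measurable_fun setT F -> (forall x, 0 <= F x) ->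
  \int[lebT n]_(x in @torus R n) \int[leb]_(u in I2pi) F (upd x j u) =
  (2 * pi)%:E * \int[lebT n]_(x in @torus R n) F x.
Proof.
elim: n F j => [|n IH] F j mF F0; first by case: j.
have pi0 : (0 <= 2 * pi :> R)%R by rewrite mulr_ge0// pi_ge0.
have mI : measurable I2pi by [].
rewrite integral_torus_cons; [|exact: measurable_upd_integral|by move=> x; exact: integral_ge0].
case: (unliftP ord0 j) => [k ->|->].
  rewrite integral_torus_cons// -ge0_integralZl//; last 2 first.
  - by apply: measurable_funTS; exact: measurable_torus_integral_r.
  - by move=> u _; exact: integral_ge0.
  apply: eq_integral => u _; rewrite -(IH (fun x => F (u ::: x)) k)//.
    apply: eq_integral => x _; apply: eq_integral => v _.
    by rewrite upd_consS.
  exact: measurable_cons_r.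
under eq_integral do under eq_integral do under eq_integral do rewrite upd_cons0.
rewrite integral_cst// [X in _ * X](_ : _ = (2 * pi)%:E); last exact: leb_I2pi.
rewrite muleC; congr (_ * _).
by rewrite integral_torus_consC.
Qed.

End tonelli_coordinate.

(** * Lebesgue measurability and null sets *)

Section modulo_null_sets.
Import HBNNSimple.
Local Open Scope ereal_scope.
Context d (T : measurableType d) (R : realType) (mu : {measure set T -> \bar R}).

(** Lebesgue measurability is replaced by Borel measurability outside a Borel
    null set: collect the exceptional sets of the superlevel sets at rational
    heights. *)
Lemma lebesgue_measurable_borel (f : T -> R) : lebesgue_measurable_fun mu setT f ->
  exists N, [/\ measurable N, mu N = 0 & measurable_fun (~` N) f].
Proof.
move=> mf.
have /choice[B HB] (q : rat) : exists BM : set T * set T,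
    [/\ measurable BM.1, measurable BM.2, mu BM.2 = 0 &
        forall x, ~ BM.2 x -> (ratr q < f x)%R <-> BM.1 x].
  have [B mB [M [M' [mM' M0 MM']]]] := mf `]ratr q, +oo[%classic (measurable_itv _).
  rewrite setTI => E; exists (B, M'); split => //= x nM'.
  have : (B `|` M) x <-> (ratr q < f x)%R by rewrite E /= in_itv/= andbT.
  move=> <-; split; last by left.
  by case=> // /MM'.
pose F k := (B (odflt 0%R (unpickle k))).2.
have mF k : measurable (F k) by have [] := HB (odflt 0%R (unpickle k)).
exists (\bigcup_k F k); split.
- exact: bigcupT_measurable.
- apply/negligibleP; first exact: bigcupT_measurable.
  apply: negligible_bigcup => k; apply/negligibleP => //.
  by have [] := HB (odflt 0%R (unpickle k)).
have nF (q : rat) x : ~ (\bigcup_k F k) x -> ~ (B q).2 x.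
  by apply: contra_not => H; exists (pickle q) => //; rewrite /F pickleK.
apply: (measurability _ (RGenOInfty.measurableE R)) => _ [_ [c ->] <-].
rewrite (_ : _ `&` _ = ~` (\bigcup_k F k) `&`
   \bigcup_(q in [set q : rat | (c <= ratr q)%R]) (B q).1); last first.
  apply/seteqP; split => x /= [nx].
    rewrite in_itv/= andbT => /rat_in_itvoo[q /itvP qc]; split => //.
    exists q => /=; first by rewrite (ltW _)// qc.
    by have [_ _ _ /(_ x (nF q x nx))[+ _]] := HB q; apply; rewrite qc.
  move=> [q /= cq Bq]; split => //; rewrite in_itv/= andbT; apply: le_lt_trans cq _.
  by have [_ _ _ /(_ x (nF q x nx))[_]] := HB q; exact.
apply: measurableI; first exact/measurableC/bigcupT_measurable.
rewrite bigcup_mkcond; apply: bigcupT_measurable_rat => q; case: ifP => // _.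
by have [] := HB q.
Qed.

(** Null sets do not affect integrals of nonnegative functions that are not
    measurable either: the simple functions below them are measurable. *)
Lemma ge0_integral_null_ext (D E : set T) (g : T -> \bar R) :
  measurable D -> measurable E -> E `<=` D -> mu (D `\` E) = 0 ->
  (forall x, 0 <= g x) -> \int[mu]_(x in D) g x = \int[mu]_(x in E) g x.
Proof.
move=> mD mE ED DE g0; apply/eqP; rewrite eq_le; apply/andP; split; last first.
  rewrite integral_mkcond [leRHS]integral_mkcond; apply: ge0_le_integral_any => x _.
    exact: erestrict_ge0.
  rewrite !patchE; case: (boolP (x \in E)) => [/set_mem /ED xD|_]; first by rewrite mem_set.
  by case: ifP.
rewrite (ge0_integralE _ (fun x _ => g0 x)); apply: ub_ereal_sup => _ [h hg <-].
rewrite -integralT_nnsfun (ge0_negligible_integral _ _ _ _ DE)//; last 3 first.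
- exact: measurableD.
- by apply/measurable_EFinP; exact: measurable_funPT.
- by move=> x _; rewrite lee_fin.
rewrite integral_mkcond [leRHS]integral_mkcond; apply: ge0_le_integral_any => x _.
  by apply: erestrict_ge0 => y _; rewrite lee_fin.
rewrite !patchE; case: (boolP (x \in E)) => xE.
  case: ifP => // _; apply: le_trans (hg x) _; rewrite patchE.
  by rewrite mem_set//; apply: ED; exact/set_mem.
case: ifPn => // /set_mem [_ /not_andP[xD|/contrapT]]; last by move=> /mem_set; rewrite (negbTE xE).
by apply: le_trans (hg x) _; rewrite patchE memNset.
Qed.

Lemma integral_null_ext (D E : set T) (g : T -> \bar R) :
  measurable D -> measurable E -> E `<=` D -> mu (D `\` E) = 0 ->
  \int[mu]_(x in D) g x = \int[mu]_(x in E) g x.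
Proof.
move=> mD mE ED DE; rewrite integralE [RHS]integralE.
by rewrite (ge0_integral_null_ext mD mE ED DE)// (ge0_integral_null_ext mD mE ED DE).
Qed.

End modulo_null_sets.

(** * Integrability from the weak-type bound *)

Section integrability.
Context {R : realType}.
Local Open Scope ereal_scope.
Local Notation leb := (@lebesgue_measure R).
Local Notation lebT n := (@lebesgue_tuple R n).
Local Notation I2pi := (`[0%R, (2 * pi)%R]%classic : set (measurableTypeR R)).

Let pi2_gt0 : (0 < 2 * pi :> R)%R.
Proof. by rewrite mulr_gt0// pi_gt0. Qed.

Lemma superlevel_lt (g : R -> \bar R) (t l : R) :
  rearrangement (fun v => g (2 * pi * v)%R) t < l%:E ->
  leb (I2pi `&` [set u | l%:E < g u]) <= (2 * pi * t)%:E.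
Proof.
move=> /rearrangement_lt[l0 gl]; rewrite EFinM.
set A := _ `&` _ in gl.
apply: (@le_trans _ _ (leb [set u | A ((2 * pi)^-1 * u + 0)%R])).
  apply: le_outer_measure => u [/= u01 gu]; rewrite addr0; split => /=; last first.
    by rewrite mulrA divff ?mul1r// gt_eqF.
  move: u01; rewrite !in_itv/= => /andP[u0 u1].
  rewrite mulr_ge0 ?invr_ge0 ?(ltW pi2_gt0)//=.
  by rewrite mulrC ler_pdivrMr// mul1r.
apply: le_trans (lebesgue_outer_affine _ _ _) _; first by rewrite invr_gt0.
by rewrite invrK; apply: lee_wpmul2l (ltW gl); rewrite lee_fin ltW.
Qed.

(** [rearrangement_lt] at the levels slightly above the rearrangement, and
    continuity of the measure along the increasing union of the superlevel
    sets. *)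
Lemma superlevel_rearrangement (g : R -> \bar R) (t : R) : (0 < t)%R ->
  measurable_fun setT (g : measurableTypeR R -> \bar R) ->
  leb (I2pi `&` [set u | rearrangement (fun v => g (2 * pi * v)%R) t < g u])
  <= (2 * pi * t)%:E.
Proof.
move=> t0 mg; have := rearrangement_ge0 (fun v => g (2 * pi * v)%R) t.
move E : (rearrangement _ t) => [l| |] // _; last first.
  rewrite (_ : _ `&` _ = set0); last by apply/seteqP; split => u //= [_]; rewrite ltNge leey.
  by rewrite (measure0 leb) lee_fin mulr_ge0// ltW.
pose F n := I2pi `&` [set u | (l + n.+1%:R^-1)%:E < g u].
have mF n : measurable (F n).
  by apply: emeasurable_fun_o_infty => //; exact: measurable_funTS.
have -> : I2pi `&` [set u | l%:E < g u] = \bigcup_n F n.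
  apply/seteqP; split => u /=.
    move=> [uI lg]; have [n] : exists n : nat, (l + n.+1%:R^-1)%:E < g u.
      move: lg; case: (g u) => [r| |]//; last by exists 0%N; rewrite ltry.
      rewrite lte_fin => /ltr_add_invr[n]; exists n; by rewrite lte_fin.
    by exists n.
  by move=> [n _ [uI lg]]; split => //; apply: lt_trans lg; rewrite lte_fin ltrDl invr_gt0.
have ndF : nondecreasing_seq F.
  apply/nondecreasing_seqP => n; apply/subsetPset => u [uI /= lg]; split => //=.
  by apply: le_lt_trans lg; rewrite lee_fin lerD2l lef_pV2 ?posrE// ler_nat.
have cF : leb \o F @ \oo --> leb (\bigcup_n F n).
  by apply: nondecreasing_cvg_mu => //; exact: bigcupT_measurable.
rewrite -(cvg_lim _ cF)//.
apply: lime_le; first by apply/cvg_ex; eexists; exact: cF.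
near=> n; apply: superlevel_lt; rewrite E lte_fin ltrDl invr_gt0//.
Unshelve. all: by end_near. Qed.

(** The period is exhausted, up to a null set, by the sets on which [g] is between
    its rearrangements at [2^-k] and [2^-(k+1)]; such a set has measure at most
    [2 pi 2^-k]. *)
Lemma integral_rearrangement_le (g : R -> \bar R) :
  measurable_fun setT (g : measurableTypeR R -> \bar R) -> (forall u, 0 <= g u) ->
  \int[leb]_(u in I2pi) g u <=
  \sum_(k <oo) (4 * pi * 2 ^- k)%:E * rearrangement (fun v => g (2 * pi * v)%R) (2 ^- k).
Proof.
move=> mg g0; pose lam k := rearrangement (fun v => g (2 * pi * v)%R) (2 ^- k).
have lam0 k : 0 <= lam k by exact: rearrangement_ge0.
pose S k := [set u | lam k < g u].
(* U 0 is everything, so that the points outside U 1, where g is at most lam 1,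
   are counted in U 0. *)
pose U k := if k is 0%N then I2pi else I2pi `&` S k.
have mI : measurable I2pi by [].
have mU k : measurable (U k).
  by case: k => // k; apply: emeasurable_fun_o_infty => //; exact: measurable_funTS.
have UI k : U k `<=` I2pi by case: k => // k u [].
have lU k : leb (U k) <= (2 * pi * 2 ^- k)%:E.
  case: k => [|k]; last first.
    by apply: superlevel_rearrangement => //; have /andP[] := @half_pow_range R k.+1.
  by rewrite expr0 invr1 mulr1 leb_I2pi.
have half0 : leb (\bigcap_k U k) = 0.
  apply/eqP; rewrite eq_le measure_ge0 andbT; apply/lee_addgt0Pr => e e0; rewrite add0e.
  have [k Hk] := half_pow_lt (divr_gt0 e0 pi2_gt0).
  apply: (@le_trans _ _ (leb (U k))).
    by apply: le_outer_measure; exact: bigcap_inf.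
  apply: le_trans (lU k) _; rewrite lee_fin mulrC -ler_pdivlMr//; apply: ltW; exact: Hk.
have mN : measurable (\bigcap_k U k) by exact: bigcapT_measurable.
rewrite (ge0_negligible_integral mN mI _ _ half0)//; last exact: measurable_funTS.
apply: (@le_trans _ _ (\int[leb]_(u in I2pi `\` \bigcap_k U k)
    \sum_(k <oo) lam k.+1 * (\1_(U k) u)%:E)).
  apply: ge0_le_integral_any => // u [uI].
  move=> nU; have /existsNP[k0 nk0] : ~ forall k, U k u by move=> H; apply: nU => k _.
  have ex : exists k, u \notin U k by exists k0; apply/negP => /set_mem.
  case: (ex_minnP ex) => -[|j] nj minj; first by move/negP: nj; case; exact/mem_set.
  have uj : u \in U j by apply/negPn/negP => /minj; rewrite ltnn.
  have gu : g u <= lam j.+1.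
    by rewrite leNgt; apply/negP => H; move/negP: nj; apply; apply/mem_set; split.
  apply: le_trans (ge_nneseries_term (u := fun k => lam k.+1 * (\1_(U k) u)%:E) j _); last by move=> k; rewrite mule_ge0.
  by rewrite indicE uj mule1.
rewrite integral_nneseries//=; last 3 first.
- exact: measurableD.
- move=> k; apply: emeasurable_funM => //.
  by apply/measurable_EFinP; exact: measurable_indic.
- by move=> k u _; rewrite mule_ge0.
apply: (@le_trans _ _ (\sum_(k <oo) (4 * pi * 2 ^- k.+1)%:E * lam k.+1)).
  apply: lee_nneseries => [k _ _|k _].
    by apply: integral_ge0 => u _; rewrite mule_ge0.
  rewrite ge0_integralZl//; last 2 first.
  - exact: measurableD.
  - by apply/measurable_EFinP; exact: measurable_indic.
  rewrite muleC lee_wpmul2r// integral_indic//; last exact: measurableD.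
  apply: (@le_trans _ _ (leb (U k))); first by apply: le_outer_measure => u [].
  apply: le_trans (lU k) _; rewrite lee_fin.
  by rewrite exprS invfM; have := pi_gt0 R; set x := 2^-k; set p := pi; lra.
pose a k := (4 * pi * 2 ^- k)%:E * lam k.
have a0 k : 0 <= a k.
  by rewrite mule_ge0// lee_fin divr_ge0 ?mulr_ge0 ?pi_ge0// exprn_ge0.
rewrite -/(a _) [leRHS](nneseries_recl (f := a))// -(nneseries_addn (f := a) 1)//.
under [X in _ <= _ + X]eq_eseriesr do rewrite addn1.
by rewrite leeDr.
Qed.

(** Rearrangement in one variable of a measurable function of several variables:
    the superlevel sets of sections have a measure that is a measurable function
    of the remaining variables, and rational levels suffice. *)
Lemma measurable_rearrangement_slice n (F : n.+1.-tuple R -> \bar R) (t : R) :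
  measurable_fun setT F -> 
  measurable_fun setT (fun x : n.-tuple R => rearrangement (fun u => F (2 * pi * u ::: x)%R) t).
Proof.
move=> mF.
pose A l : set (n.+1.-tuple R) :=
  [set z | `[0%R, 1%R]%classic (thead z) /\ (l%:E < F ((2 * pi * thead z)%R ::: [tuple of behead z]))].
have mA l : measurable (A l).
  have -> : A l = (fun z : n.+1.-tuple R => thead z) @^-1` `[0%R, 1%R]%classic `&`
     (fun z : n.+1.-tuple R => F ((2 * pi * thead z)%R ::: [tuple of behead z])) @^-1` `]l%:E, +oo[%classic.
    by apply/seteqP; split => z; rewrite /A/= !in_itv/= ?andbT.
  have mh : measurable_fun setT (fun z : n.+1.-tuple R => thead z).
    exact: (@measurable_tnth _ _ n.+1 ord0).
  apply: measurableI; rewrite -[X in measurable X]setTI.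
    by apply: mh => //; exact: measurable_itv.
  apply: (measurableT_comp mF) => //; last exact: emeasurable_itv.
  apply: measurable_cons; last exact: measurable_behead.
  by apply: measurable_funM => //; exact: measurable_cst.
have mS l : measurable [set x : n.-tuple R | leb [set u | A l (u ::: x)] < t%:E].
  rewrite -[X in measurable X]setTI.
  by apply: emeasurable_fun_infty_o => //; apply: measurable_slice_measure.
apply: (measurability _ (ErealGenInftyO.measurableE R)) => _ [_ [c ->] <-].
rewrite (_ : _ `&` _ = \bigcup_(q in [set q : rat | (0 < ratr q :> R)%R /\ (ratr q)%:E < c%:E])
   [set x : n.-tuple R | leb [set u | A (ratr q) (u ::: x)] < t%:E]); last first.
  have AE l (x : n.-tuple R) : [set u : R | A l (u ::: x)] =
      `[0%R, 1%R]%classic `&` [set u | l%:E < F ((2 * pi * u)%R ::: x)].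
    by apply/seteqP; split => u; rewrite /A /mkset theadE behead_tcons.
  apply/seteqP; split => x /=.
    rewrite in_itv/= => -[_ /ereal_inf_lt[_ [l [l0 hl] <-] lc]].
    have [q [q1 q2]] : exists q : rat, (l < ratr q)%R /\ (ratr q)%:E < c%:E.
      move: lc; rewrite lte_fin => /rat_in_itvoo[q /itvP qc].
      by exists q; rewrite qc lte_fin qc.
    exists q => /=; first by split=> //; apply: lt_trans q1.
    rewrite AE; apply: le_lt_trans hl; apply: le_outer_measure => u [u01 /= h].
    by split => //=; apply: le_lt_trans h; rewrite lee_fin ltW.
  move=> [q /= [q0 qc]]; rewrite AE => H; split => //; rewrite in_itv/=.
  by apply: le_lt_trans qc; exact: rearrangement_le.
rewrite bigcup_mkcond; apply: bigcupT_measurable_rat => q; case: ifP => // _.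
Qed.

(** A weak-type bound with [2^-k / phi_j (2^-k)] summable gives integrability:
    [integral_rearrangement_le] in one variable after the other. *)
Lemma integral_torus_star n (phi : 'I_n -> R -> R) (B : 'I_n -> R)
    (F : n.-tuple R -> \bar R) (A : R) :
  (forall j k, 0 < phi j (2 ^- k))%R -> (0 <= A)%R ->
  (forall j, \sum_(k <oo) (2 ^- k / phi j (2 ^- k))%:E <= (B j)%:E) ->
  measurable_fun setT F -> (forall x, 0 <= F x) ->
  (forall t, (forall j, (0 < tnth t j <= 1)%R) ->
     star F t <= (A * \prod_j (phi j (tnth t j))^-1)%:E) ->
  \int[lebT n]_(x in @torus R n) F x <= (A * \prod_j (4 * pi * B j))%:E.
Proof.
elim: n phi B F A => [|n IH] phi B F A phi0 A0 HB mF F0 sF.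
  rewrite (_ : @torus R 0 = setT); last by apply/seteqP; split => // x _ [].
  rewrite integral_dirac// diracT mul1e big_ord0.
  by have := sF [tuple]; rewrite /= big_ord0; apply; case.
rewrite integral_torus_consC//.
pose Rk k (x : n.-tuple R) := rearrangement (fun u => F (2 * pi * u ::: x)%R) (2 ^- k).
have Rk0 k x : 0 <= Rk k x by exact: rearrangement_ge0.
have B0 j : (0 <= B j)%R.
  rewrite -lee_fin; apply: le_trans (HB j); apply: nneseries_ge0 => k _ _.
  by rewrite lee_fin divr_ge0// ?invr_ge0 ?exprn_ge0// ltW.
apply: (@le_trans _ _ (\int[lebT n]_(x in @torus R n)
    \sum_(k <oo) (4 * pi * 2 ^- k)%:E * Rk k x)).
  apply: ge0_le_integral_any => x _; first exact: integral_ge0.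
  by apply: integral_rearrangement_le => //; exact: measurable_cons_l.
have c0 k : (0 <= 4 * pi * 2 ^- k :> R)%R.
  by rewrite mulr_ge0// ?mulr_ge0 ?pi_ge0// invr_ge0 exprn_ge0.
rewrite integral_nneseries//; last 3 first.
- exact: measurable_torus.
- move=> k; apply: measurable_funTS; apply: emeasurable_funM => //.
  exact: measurable_rearrangement_slice.
- by move=> k x _; rewrite mule_ge0 ?lee_fin.
apply: (@le_trans _ _ (\sum_(k <oo) (A * (4 * pi) * \prod_(j < n) (4 * pi * B (lift ord0 j)))%:E *
   (2 ^- k / phi ord0 (2 ^- k))%:E)).
  apply: lee_nneseries => [k _ _|k _].
    by apply: integral_ge0 => x _; rewrite mule_ge0 ?lee_fin.
  rewrite ge0_integralZl ?lee_fin//; last 2 first.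
  - exact: measurable_torus.
  - by apply: measurable_funTS; exact: measurable_rearrangement_slice.
  have pk : (0 < phi ord0 (2 ^- k))%R by [].
  apply: (@le_trans _ _ ((4 * pi * 2 ^- k)%:E *
     (A / phi ord0 (2 ^- k) * \prod_(j < n) (4 * pi * B (lift ord0 j)))%:E)).
    apply: lee_wpmul2l; first by rewrite lee_fin.
    apply: (IH (fun j => phi (lift ord0 j))) => //.
    - by rewrite divr_ge0// ltW.
    - exact: measurable_rearrangement_slice.
    - move=> t t01; have := sF (2 ^- k ::: t).
      rewrite star_cons big_ord_recl tnth0.
      rewrite (eq_bigr (fun i => (phi (lift ord0 i) (tnth t i))^-1%R)); last first.
        by move=> i _; rewrite tnthS.
      rewrite mulrA; apply => j; case: (unliftP ord0 j) => [i ->|->]; rewrite ?tnthS// tnth0.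
      exact: half_pow_range.
  rewrite -!EFinM lee_fin le_eqVlt; apply/orP; left; apply/eqP; ring.
rewrite nneseriesZl; last first.
  by move=> k _; rewrite lee_fin divr_ge0// ?invr_ge0 ?exprn_ge0// ltW.
rewrite big_ord_recl.
apply: le_trans (lee_wpmul2l _ (HB ord0)) _.
  by rewrite lee_fin !mulr_ge0 ?pi_ge0// prodr_ge0// => j _; rewrite !mulr_ge0 ?pi_ge0.
by rewrite -EFinM lee_fin le_eqVlt; apply/orP; left; apply/eqP; ring.
Qed.

End integrability.

(** * Complex-valued integrals and characters *)

Section complex_integral.
Context d (T : measurableType d) (R : realType) (mu : {measure set T -> \bar R}).
Variables (D : set T) (mD : measurable D).
Implicit Types f g : T -> R[i].

Definition cintegrable f :=
  mu.-integrable D (EFin \o (fun x => complex.Re (f x))) /\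
  mu.-integrable D (EFin \o (fun x => complex.Im (f x))).

Lemma eq_cintegral f g : (forall x, D x -> f x = g x) ->
  cintegral mu D f = cintegral mu D g.
Proof.
by move=> fg; congr (fine _ +i* fine _)%C; apply: eq_integral => x /set_mem Dx; rewrite fg.
Qed.

Lemma eq_cintegrable f g : (forall x, D x -> f x = g x) -> cintegrable f -> cintegrable g.
Proof.
by move=> fg [fR fI]; split; [apply: eq_integrable fR|apply: eq_integrable fI] => //
  x /set_mem Dx /=; rewrite fg.
Qed.

Lemma cintegrable0 : cintegrable (fun=> 0).
Proof. by split; exact: integrable0. Qed.

Lemma cintegral0 : cintegral mu D (fun=> 0) = 0.
Proof. by rewrite /cintegral /= integral0. Qed.

Lemma cintegrableD f g : cintegrable f -> cintegrable g ->
  cintegrable (fun x => f x + g x).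
Proof.
move=> [fR fI] [gR gI]; split.
  apply: eq_integrable (integrableD mD fR gR) => // x _ /=.
  by case: (f x) => a b; case: (g x).
apply: eq_integrable (integrableD mD fI gI) => // x _ /=.
by case: (f x) => a b; case: (g x).
Qed.

Lemma cintegralD f g : cintegrable f -> cintegrable g ->
  cintegral mu D (fun x => f x + g x) = cintegral mu D f + cintegral mu D g.
Proof.
move=> [fR fI] [gR gI].
have := RintegralD mD fR gR; have := RintegralD mD fI gI.
rewrite /Rintegral /cintegral => EI ER.
apply/eqP; rewrite eq_complex /= -ER -EI; apply/andP; split; apply/eqP; congr fine;
by apply: eq_integral => x _; case: (f x) => a b; case: (g x).
Qed.

Lemma cintegrableZ (c : R[i]) f : cintegrable f -> cintegrable (fun x => c * f x).
Proof.
case: c => a b [fR fI]; split.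
  apply: eq_integrable (integrableD mD (integrableZl mD a fR) (integrableZl mD (- b) fI)) => // x _ /=.
  by case: (f x) => p q /=; rewrite -!EFinM -EFinD; congr EFin; ring.
apply: eq_integrable (integrableD mD (integrableZl mD a fI) (integrableZl mD b fR)) => // x _ /=.
by case: (f x) => p q /=; rewrite -!EFinM -EFinD; congr EFin; ring.
Qed.

Lemma cintegralZ (c : R[i]) f : cintegrable f ->
  cintegral mu D (fun x => c * f x) = c * cintegral mu D f.
Proof.
case: c => a b [fR fI].
rewrite /cintegral.
have ER := RintegralD mD (integrableZl mD a fR) (integrableZl mD (- b) fI).
have EI := RintegralD mD (integrableZl mD a fI) (integrableZl mD b fR).
rewrite /= !(RintegralZl _ _ fR, RintegralZl _ _ fI)// in ER EI.
apply/eqP; rewrite eq_complex /=; apply/andP; split; apply/eqP.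
  transitivity (\int[mu]_(x in D) (a * complex.Re (f x) + - b * complex.Im (f x)))%R.
    by congr fine; apply: eq_integral => x _; case: (f x) => p q /=; congr EFin; ring.
  by rewrite ER /Rintegral; ring.
transitivity (\int[mu]_(x in D) (a * complex.Im (f x) + b * complex.Re (f x)))%R.
  by congr fine; apply: eq_integral => x _; case: (f x) => p q /=; congr EFin; ring.
by rewrite EI /Rintegral; ring.
Qed.

Lemma cintegrable_sum (I : Type) (s : seq I) (P : pred I) (F : I -> T -> R[i]) :
  (forall i, cintegrable (F i)) -> cintegrable (fun x => \sum_(i <- s | P i) F i x).
Proof.
move=> HF; elim: s => [|i s IH].
  by apply: eq_cintegrable cintegrable0 => x _; rewrite big_nil.
case Pi : (P i).
  by apply: eq_cintegrable (cintegrableD (HF i) IH) => x _; rewrite big_cons Pi.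
by apply: eq_cintegrable IH => x _; rewrite big_cons Pi.
Qed.

Lemma cintegral_sum (I : Type) (s : seq I) (P : pred I) (F : I -> T -> R[i]) :
  (forall i, cintegrable (F i)) ->
  cintegral mu D (fun x => \sum_(i <- s | P i) F i x) =
  \sum_(i <- s | P i) cintegral mu D (F i).
Proof.
move=> HF; elim: s => [|i s IH].
  by rewrite big_nil -[RHS]cintegral0; apply: eq_cintegral => x _; rewrite big_nil.
rewrite big_cons -IH; case Pi : (P i).
  rewrite -(cintegralD (HF i)); last exact: cintegrable_sum.
  by apply: eq_cintegral => x _; rewrite big_cons Pi.
by apply: eq_cintegral => x _; rewrite big_cons Pi.
Qed.

Definition cmeasurable f :=
  measurable_fun D (fun x => complex.Re (f x)) /\
  measurable_fun D (fun x => complex.Im (f x)).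

Lemma normc_ReIm (z : R[i]) :
  `|complex.Re z| <= Normc.normc z /\ `|complex.Im z| <= Normc.normc z.
Proof.
case: z => a b /=; rewrite -!sqrtr_sqr; split; apply: ler_wsqrtr.
  by rewrite lerDl sqr_ge0.
by rewrite lerDr sqr_ge0.
Qed.

Lemma normc_le_ReIm (z : R[i]) :
  Normc.normc z <= `|complex.Re z| + `|complex.Im z|.
Proof.
case: z => a b /=; rewrite -(@ger0_norm _ (`|a| + `|b|)) ?addr_ge0//.
rewrite -sqrtr_sqr; apply: ler_wsqrtr.
rewrite sqrrD !real_normK ?num_real// lerD2r lerDl mulrn_wge0// mulr_ge0//.
Qed.

Lemma le_cintegrable f (g : T -> \bar R) : cmeasurable f ->
  (forall x, D x -> ((Normc.normc (f x))%:E <= g x)%E) ->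
  mu.-integrable D g -> cintegrable f.
Proof.
move=> [mR mI] fg ig; split; apply: (le_integrable mD _ _ ig).
- exact/measurable_EFinP.
- move=> x Dx /=; have /= := fg x Dx; have [h _] := normc_ReIm (f x).
  move=> H; apply: le_trans (lee_abs _); apply: le_trans H; by rewrite lee_fin.
- exact/measurable_EFinP.
- move=> x Dx /=; have /= := fg x Dx; have [_ h] := normc_ReIm (f x).
  move=> H; apply: le_trans (lee_abs _); apply: le_trans H; by rewrite lee_fin.
Qed.

Lemma cintegrable_measurable f : cintegrable f -> cmeasurable f.
Proof.
move=> [/measurable_int mR /measurable_int mI].
by split; [move/measurable_EFinP: mR|move/measurable_EFinP: mI].
Qed.

(** Dominated convergence for functions whose integrals are eventually constant,
    which is the case for the Fourier coefficients of partial sums. *)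
Lemma cdominated_limit (F : nat -> T -> R[i]) f (g : T -> \bar R) (c : R[i]) (K : nat) :
  (forall n, cmeasurable (F n)) ->
  (forall x, D x -> (fun n => complex.Re (F n x)) @ \oo --> complex.Re (f x)) ->
  (forall x, D x -> (fun n => complex.Im (F n x)) @ \oo --> complex.Im (f x)) ->
  (forall n x, D x -> ((Normc.normc (F n x))%:E <= g x)%E) ->
  mu.-integrable D g ->
  (forall n, (K <= n)%N -> cintegral mu D (F n) = c) ->
  cintegrable f /\ cintegral mu D f = c.
Proof.
move=> mF FR FI Fg ig Fc.
have part (p : R[i] -> R) : (forall n, measurable_fun D (fun x => p (F n x))) ->
    (forall x, D x -> (fun n => p (F n x)) @ \oo --> p (f x)) ->
    (forall z, `|p z| <= Normc.normc z) ->
    (forall n, (K <= n)%N -> fine (\int[mu]_(x in D) (p (F n x))%:E)%E = p c) ->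
    mu.-integrable D (EFin \o (fun x => p (f x))) /\
    fine (\int[mu]_(x in D) (p (f x))%:E)%E = p c.
  move=> mp cp ple pc.
  have mpf : measurable_fun D (fun x => p (f x)).
    by apply: measurable_fun_cvg cp => //.
  have [||||ip _ cvp] := @dominated_convergence _ _ _ mu D mD
    (fun n x => (p (F n x))%:E) (fun x => (p (f x))%:E) g _ _ _ ig.
  - by move=> n; apply/measurable_EFinP.
  - exact/measurable_EFinP.
  - by apply: aeW => x Dx; apply: cvg_EFin; [near=> n|exact: cp].
  - apply: aeW => x n Dx /=; apply: le_trans (Fg n x Dx).
    by rewrite lee_fin.
  split => //; move: cvp.
  have fin n : (\int[mu]_(x in D) (p (F n x))%:E)%E \is a fin_num.
    apply: integrable_fin_num => //; apply: (le_integrable mD _ _ ig).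
      exact/measurable_EFinP.
    move=> x Dx /=; apply: le_trans (lee_abs _); apply: le_trans (Fg n x Dx).
    by rewrite lee_fin.
  have cst : (fun n => (\int[mu]_(x in D) (p (F n x))%:E)%E) @ \oo --> (p c)%:E.
    apply: cvg_near_cst; exists K => // n /= Kn.
    by rewrite -(pc n Kn) fineK.
  by move=> /(cvg_unique _ cst) <-.
have [iR ER] := part (@complex.Re R) (fun n => (mF n).1) FR (fun z => (normc_ReIm z).1)
  (fun n Kn => congr1 (@complex.Re R) (Fc n Kn)).
have [iI EI] := part (@complex.Im R) (fun n => (mF n).2) FI (fun z => (normc_ReIm z).2)
  (fun n Kn => congr1 (@complex.Im R) (Fc n Kn)).
split; first by split.
by apply/eqP; rewrite eq_complex /= ER EI !eqxx.
Unshelve. all: by end_near. Qed.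

End complex_integral.

Section characters.
Context {R : realType}.

(** The half-spaces generate the Borel sets of the space of tuples. *)
Lemma tuple_sigma_ind n (G : set (set (n.-tuple R))) : sigma_algebra setT G ->
  (forall j (b : R), G [set x | tnth x j < b]) ->
  forall B : set (n.-tuple R), measurable B -> G B.
Proof.
move=> sG Gb B mB; apply: (smallest_sub sG _ mB).
apply: (big_ind (fun X => X `<=` G)) => //; first by move=> X Y HX HY A [/HX|/HY].
move=> j _ _ [A mA <-]; rewrite setTI.
have [G0 GC GU] := sG.
suff : <<s @RGenInftyO.G R >> `<=` [set A | G ((fun x : n.-tuple R => tnth x j) @^-1` A)].
  move=> H; apply: (H A); have : (@RGenInftyO.G R).-sigma.-measurable A; last by [].
  by rewrite -RGenInftyO.measurableE.
apply: smallest_sub.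
  split => /=.
  - by rewrite preimage_set0.
  - move=> A' /GC; congr G; apply/seteqP; split => x /=; tauto.
  - by move=> A' /GU; rewrite preimage_bigcup.
by move=> _ [b ->] /=; have := Gb j b; congr G.
Qed.

Definition tplus n (k l : n.-tuple int) : n.-tuple int :=
  [tuple tnth k j + tnth l j | j < n].

Definition topp n (k : n.-tuple int) : n.-tuple int := [tuple - tnth k j | j < n].

Definition tdelta n (j : 'I_n) (c : int) : n.-tuple int :=
  [tuple if i == j then c else 0 | i < n].

Lemma characterD n (k l : n.-tuple int) (x : n.-tuple R) :
  character (tplus k l) x = character k x * character l x.
Proof.
rewrite /character.
rewrite (eq_bigr (fun j => (tnth k j)%:~R * tnth x j + (tnth l j)%:~R * tnth x j)).
  rewrite big_split /= cosD sinD; apply/eqP; rewrite eq_complex /=.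
  by apply/andP; split; apply/eqP; ring.
by move=> j _; rewrite tnth_mktuple rmorphD mulrDl.
Qed.

Lemma characterN n (k : n.-tuple int) (x : n.-tuple R) :
  character (topp k) x = ((character k x)^*)%C.
Proof.
rewrite /character /= (eq_bigr (fun j => - ((tnth k j)%:~R * tnth x j))).
  by rewrite sumrN cosN sinN.
by move=> j _; rewrite tnth_mktuple rmorphN mulNr.
Qed.

Lemma normc_character n (k : n.-tuple int) (x : n.-tuple R) :
  Normc.normc (character k x) = 1.
Proof. by rewrite /character /= cos2Dsin2 sqrtr1. Qed.

Lemma character_delta n (j : 'I_n) (c : int) (x : n.-tuple R) :
  character (tdelta j c) x = (cos (c%:~R * tnth x j) +i* sin (c%:~R * tnth x j))%C.
Proof.
rewrite /character (bigD1 j)//= tnth_mktuple eqxx big1 ?addr0// => i ij.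
by rewrite tnth_mktuple (negbTE ij) mul0r.
Qed.

Lemma measurable_phase n (k : n.-tuple int) : measurable_fun setT
  (fun x : n.-tuple R => \sum_(j < n) (tnth k j)%:~R * tnth x j).
Proof.
apply: measurable_sum => j; apply: measurable_funM; first exact: measurable_cst.
exact: measurable_tnth.
Qed.

Lemma measurable_character n (k : n.-tuple int) (D : set (n.-tuple R)) :
  cmeasurable D (character k).
Proof.
split; apply: measurable_funTS.
  apply: measurableT_comp (measurable_phase k); apply: continuous_measurable_fun.
  exact: continuous_cos.
apply: measurableT_comp (measurable_phase k); apply: continuous_measurable_fun.
exact: continuous_sin.
Qed.

End characters.

Section complex_measurable.
Context d (T : measurableType d) (R : realType).
Implicit Types (D : set T) (f g : T -> R[i]).

Lemma cmeasurableM D f g : cmeasurable D f -> cmeasurable D g ->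
  cmeasurable D (fun x => f x * g x).
Proof.
move=> [fR fI] [gR gI]; split.
  apply: (eq_measurable_fun (fun x => complex.Re (f x) * complex.Re (g x) - complex.Im (f x) * complex.Im (g x))).
    by move=> x _; case: (f x) => a b; case: (g x).
  by apply: measurable_funB; apply: measurable_funM.
apply: (eq_measurable_fun (fun x => complex.Re (f x) * complex.Im (g x) + complex.Im (f x) * complex.Re (g x))).
  by move=> x _; case: (f x) => a b; case: (g x).
by apply: measurable_funD; apply: measurable_funM.
Qed.

Lemma cmeasurableD D f g : cmeasurable D f -> cmeasurable D g ->
  cmeasurable D (fun x => f x + g x).
Proof.
move=> [fR fI] [gR gI]; split.
  apply: (eq_measurable_fun (fun x => complex.Re (f x) + complex.Re (g x))).
    by move=> x _; case: (f x) => a b; case: (g x).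
  exact: measurable_funD.
apply: (eq_measurable_fun (fun x => complex.Im (f x) + complex.Im (g x))).
  by move=> x _; case: (f x) => a b; case: (g x).
exact: measurable_funD.
Qed.

Lemma cmeasurable_real D (v : T -> R) : measurable_fun D v ->
  cmeasurable D (fun x => (v x)%:C%C).
Proof. by move=> mv; split => //=; exact: measurable_cst. Qed.

Lemma cmeasurable_cst D (c : R[i]) : cmeasurable D (fun=> c).
Proof. by split; exact: measurable_cst. Qed.

Lemma cmeasurable_sum D (I : Type) (s : seq I) (P : pred I) (F : I -> T -> R[i]) :
  (forall i, cmeasurable D (F i)) -> cmeasurable D (fun x => \sum_(i <- s | P i) F i x).
Proof.
move=> HF; elim: s => [|i s IH].
  rewrite (funext (fun x => big_nil _ _ _ _)); exact: cmeasurable_cst.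
rewrite (funext (fun x => big_cons _ _ _ _ _ _)); case: (P i) => //.
exact: cmeasurableD.
Qed.

Lemma normc_ge0 (z : R[i]) : 0 <= Normc.normc z.
Proof. by case: z => a b; exact: sqrtr_ge0. Qed.

Lemma measurable_normc D f : cmeasurable D f ->
  measurable_fun D (fun x => Normc.normc (f x)).
Proof.
move=> [fR fI].
apply: (eq_measurable_fun (fun x => Num.sqrt (complex.Re (f x) ^+ 2 + complex.Im (f x) ^+ 2))).
  by move=> x _; case: (f x).
apply: (@measurableT_comp _ _ _ _ _ _ (@Num.sqrt R)); last first.
  by apply: measurable_funD; exact: measurable_funX.
apply: continuous_measurable_fun; exact: sqrt_continuous.
Qed.

End complex_measurable.

(** * Uniqueness of Fourier coefficients *)

Section threshold_powers.
Context {R : realType}.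

Lemma one_sub_pow_ge (x : R) M : 0 <= x <= 1 -> 1 - M%:R * x <= (1 - x) ^+ M.
Proof.
move=> /andP[x0 x1]; elim: M => [|M IH]; first by rewrite mul0r subr0 expr0.
rewrite exprS; apply: le_trans (ler_wpM2l _ IH); last by rewrite subr_ge0.
rewrite -natr1; have : 0 <= M%:R * x * x by rewrite !mulr_ge0.
set y := M%:R * x * x => y0.
rewrite [leRHS](_ : _ = 1 - (M%:R + 1) * x + y); last by rewrite /y; ring.
by rewrite lerDl.
Qed.

Lemma one_sub_pow_le (x : R) M : 0 <= x <= 1 -> (1 - x) ^+ M <= (1 + M%:R * x)^-1.
Proof.
move=> /andP[x0 x1].
have P0 : 0 < 1 + M%:R * x by rewrite ltr_pwDl// mulr_ge0.
rewrite -[leRHS]mul1r ler_pdivlMr//.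
elim: M P0 => [|M IH] P0; first by rewrite mul0r addr0 expr0 mulr1.
have P1 : 0 < 1 + M%:R * x by rewrite ltr_pwDl// mulr_ge0.
apply: le_trans (IH P1); rewrite exprSr -mulrA.
apply: ler_wpM2l; first by rewrite exprn_ge0// subr_ge0.
rewrite -natr1; have : 0 <= M%:R * x * x + x * x by rewrite addr_ge0// !mulr_ge0.
set y := _ + x * x => y0.
rewrite [leLHS](_ : _ = 1 + M%:R * x - y); last by rewrite /y; ring.
by rewrite gerBl.
Qed.

(** A threshold at 1/2 obtained from polynomials in [w]: [w ^ N] is compared with
    [(N 2^N)^-1].  No value is prescribed at 1/2 by continuity, but
    the choice of the exponents makes the limit 0 there. *)
Lemma threshold_pow_cvg (w : R) : 0 <= w <= 1 ->
  (fun N => (1 - w ^+ N) ^+ (N * 2 ^ N)) @ \oo --> ((w < 2^-1)%R%:R : R).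
Proof.
move=> /andP[w0 w1].
have wN N : 0 <= w ^+ N <= 1 by rewrite exprn_ge0//= exprn_ile1.
have [w2|w2] := ltP w 2^-1.
  (* With q = 2 w < 1, N q ^ N tends to 0: write q = (1 - x) s with s < 1, and
     bound N (1 - x) ^ N by 1 / x through Bernoulli's inequality. *)
  apply: (@squeeze_cvgr _ _ _ _ (fun N => 1 - (N * 2 ^ N)%:R * w ^+ N) (fun=> 1)); last 2 first.
  - rewrite -[X in _ --> X]subr0; apply: cvgB; first exact: cvg_cst.
    pose q := 2 * w.
    have q0 : 0 <= q by rewrite mulr_ge0.
    have q1 : q < 1 by rewrite /q; lra.
    rewrite (_ : (fun N => _) = (fun N => N%:R * q ^+ N)); last first.
      by apply/funext => N; rewrite natrM natrX /q exprMn mulrA.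
    pose s := (1 + q) / 2; pose x := (1 - q) / (1 + q).
    have q2 : 0 < 1 + q by lra.
    have x0 : 0 < x by rewrite divr_gt0// subr_gt0.
    have x01 : 0 <= x <= 1 by rewrite (ltW x0) ler_pdivrMr// mul1r; lra.
    have qE : q = (1 - x) * s by rewrite /x /s; field; lra.
    apply: (@squeeze_cvgr _ _ _ _ (fun=> 0) (fun N => x^-1 * s ^+ N)).
    + near=> N; rewrite mulr_ge0 ?exprn_ge0//=.
      rewrite {1}qE exprMn mulrA; apply: ler_wpM2r; first by rewrite exprn_ge0// /s; lra.
      apply: le_trans (ler_wpM2l _ (one_sub_pow_le N x01)) _ => //.
      have d0 : 0 < 1 + N%:R * x by rewrite ltr_pwDl// mulr_ge0//; exact: ltW.
      rewrite ler_pdivrMr//.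
      by rewrite mulrDr mulr1 mulrCA mulVf ?gt_eqF// mulr1 lerDr invr_ge0 ltW.
    + exact: cvg_cst.
    + apply: cvg_geometric; rewrite ger0_norm /s; lra.
  - exact: cvg_cst.
  near=> N; apply/andP; split; first exact: one_sub_pow_ge.
  by have /andP[a b] := wN N; rewrite exprn_ile1// ?subr_ge0// gerBl.
apply: (@squeeze_cvgr _ _ _ _ (fun=> 0) (fun N => (1 + N%:R)^-1)).
- near=> N; have /andP[a b] := wN N; rewrite exprn_ge0 ?subr_ge0//=.
  apply: le_trans (one_sub_pow_le _ (wN N)) _.
  rewrite lef_pV2 ?posrE; [|by rewrite ltr_pwDl// mulr_ge0|by rewrite ltr_pwDl].
  rewrite lerD2l natrM natrX -mulrA ler_peMr// -exprMn exprn_ege1//; lra.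
- exact: cvg_cst.
- rewrite (_ : (fun N => _) = (@harmonic R)); first exact: cvg_harmonic.
  by apply/funext => N; rewrite /harmonic nat1r.
Unshelve. all: by end_near. Qed.

End threshold_powers.

Section uniqueness.
Context {R : realType} (n : nat) (E : set (n.-tuple R)) (h : n.-tuple R -> R[i]).
Local Notation lebT n := (@lebesgue_tuple R n).
Hypothesis mE : measurable E.
Hypothesis E_open : forall x, E x -> forall j, 0 < tnth x j < 2 * pi.
Hypothesis ih : cintegrable (lebT n) E h.
Hypothesis h_perp : forall k, cintegral (lebT n) E (fun x => h x * character k x) = 0.
Implicit Types v w : n.-tuple R -> R.

Let weighted v k (x : n.-tuple R) := h x * ((v x)%:C%C * character k x).

(** Bounded functions [v] for which [h v] is orthogonal to all characters.  The
    class is closed under the operations that lead from characters to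
    indicators of Borel sets. *)
Definition perp v := [/\ measurable_fun setT v, exists M, forall x, `|v x| <= M &
  forall k, cintegral (lebT n) E (weighted v k) = 0].

Let G (M : R) (x : n.-tuple R) := (M%:E * (`|complex.Re (h x)| + `|complex.Im (h x)|)%:E)%E.

Let iG M : (lebT n).-integrable E (G M).
Proof.
apply: integrableZl => //; have [iR iI] := ih.
exact: (integrableD mE (integrable_abse iR) (integrable_abse iI)).
Qed.

Let weighted_le v k M x : `|v x| <= M -> ((Normc.normc (weighted v k x))%:E <= G M x)%E.
Proof.
move=> vM; rewrite /G -EFinM lee_fin /weighted !Normc.normcM normc_character mulr1.
have -> : Normc.normc ((v x)%:C)%C = `|v x| by rewrite /= expr0n/= addr0 sqrtr_sqr.
rewrite mulrC; apply: ler_pM => //; first exact: normc_ge0.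
exact: normc_le_ReIm.
Qed.

Let weighted_measurable v k : measurable_fun setT v -> cmeasurable E (weighted v k).
Proof.
move=> mv; apply: cmeasurableM; first exact: cintegrable_measurable ih.
apply: cmeasurableM; last exact: measurable_character.
by apply: cmeasurable_real; exact: measurable_funTS.
Qed.

Let weighted_integrable v k M : measurable_fun setT v -> (forall x, `|v x| <= M) ->
  cintegrable (lebT n) E (weighted v k).
Proof.
move=> mv vM; apply: (le_cintegrable mE (weighted_measurable k mv) _ (iG M)) => x _.
exact: weighted_le.
Qed.

Let perp_1 : perp (fun=> 1).
Proof.
split; [exact: measurable_cst|by exists 1 => x; rewrite normr1|move=> k].
rewrite -[RHS](h_perp k); apply: eq_cintegral => x _.
by rewrite /weighted mul1r.
Qed.

Let perp_ext v w : measurable_fun setT w -> (exists M, forall x, `|w x| <= M) ->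
  (forall x, E x -> v x = w x) -> perp v -> perp w.
Proof.
move=> mw bw vw [mv bv pv]; split => // k; rewrite -[RHS](pv k).
by apply: eq_cintegral => x Ex; rewrite /weighted vw.
Qed.

Let perp_lin (a b : R) v w : perp v -> perp w -> perp (fun x => a * v x + b * w x).
Proof.
move=> [mv [M Mv] pv] [mw [N Nw] pw]; split.
- by apply: measurable_funD; apply: measurable_funM => //; exact: measurable_cst.
- exists (`|a| * M + `|b| * N) => x; apply: le_trans (ler_normD _ _) _.
  by rewrite !normrM lerD// ler_wpM2l.
- move=> k; rewrite (eq_cintegral _ (g := fun x => a%:C%C * weighted v k x + b%:C%C * weighted w k x)).
    have iv := weighted_integrable k mv Mv; have iw := weighted_integrable k mw Nw.
    rewrite cintegralD//; [|exact: cintegrableZ..].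
    by rewrite !cintegralZ// pv pw !mulr0 addr0.
  by move=> x _; rewrite /weighted rmorphD !rmorphM /=; ring.
Qed.

Let perp_cos v j c : perp v -> perp (fun x => v x * cos (tnth x j - c)).
Proof.
move=> [mv [M Mv] pv].
have mc : measurable_fun setT (fun x : n.-tuple R => cos (tnth x j - c)).
  apply: measurableT_comp; first by apply: continuous_measurable_fun; exact: continuous_cos.
  by apply: measurable_funB; [exact: measurable_tnth|exact: measurable_cst].
split.
- exact: measurable_funM.
- exists M => x; rewrite normrM -[leRHS]mulr1; apply: ler_pM => //.
  by rewrite ler_norml cos_geN1 cos_le1.
- move=> k; pose z : R[i] := ((cos c / 2) +i* (- (sin c / 2)))%C.
  rewrite (eq_cintegral _ (g := fun x => z * weighted v (tplus (tdelta j 1) k) x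
      + (z^*)%C * weighted v (tplus (tdelta j (- 1)) k) x)).
    have iv k' := weighted_integrable k' mv Mv.
    rewrite cintegralD//; [|exact: cintegrableZ..].
    by rewrite !cintegralZ// !pv !mulr0 addr0.
  move=> x _; rewrite /weighted !characterD !character_delta.
  have -> : ((v x * cos (tnth x j - c))%:C)%C = (v x)%:C%C *
     (z * (cos (1%:~R * tnth x j) +i* sin (1%:~R * tnth x j))%C +
      (z^*)%C * (cos ((-1)%:~R * tnth x j) +i* sin ((-1)%:~R * tnth x j))%C).
    rewrite mulrN1z mulr1z mulN1r mul1r cosN sinN cosB.
    by apply/eqP; rewrite eq_complex /z /=; apply/andP; split; apply/eqP; field.
  ring.
Qed.

Let perp_lim (vN : nat -> n.-tuple R -> R) v M : (forall N, perp (vN N)) ->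
  (forall N x, `|vN N x| <= M) -> (forall x, vN ^~ x @ \oo --> v x) -> perp v.
Proof.
move=> pN vM vv.
have mv : measurable_fun setT v.
  by apply: measurable_fun_cvg (fun x _ => vv x) => N; have [] := pN N.
have bv x : `|v x| <= M.
  rewrite -(cvg_lim _ (cvg_norm (vv x)))//; apply: limr_le.
    by apply/cvg_ex; eexists; exact: cvg_norm (vv x).
  by near=> N; exact: vM.
split => //; first by exists M.
move=> k; have cz (z : R[i]) x : (fun N => complex.Re (z * (vN N x)%:C%C)) @ \oo -->
     complex.Re (z * (v x)%:C%C) /\ (fun N => complex.Im (z * (vN N x)%:C%C)) @ \oo -->
     complex.Im (z * (v x)%:C%C).
  case: z => a b /=; split.
    rewrite (_ : (fun N => _) = (fun N => a * vN N x)); last by apply/funext => N; ring.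
    by rewrite mulr0 subr0; apply: cvgMr.
  rewrite (_ : (fun N => _) = (fun N => b * vN N x)); last by apply/funext => N; ring.
  by rewrite mulr0 add0r; apply: cvgMr.
have sw w x : weighted w k x = (h x * character k x) * (w x)%:C%C.
  by rewrite /weighted; ring.
suff [] : cintegrable (lebT n) E (weighted v k) /\
  cintegral (lebT n) E (weighted v k) = 0 by [].
apply: (@cdominated_limit _ _ _ (lebT n) E mE (fun N => weighted (vN N) k)
  _ (G M) 0 0%N _ _ _ _ (iG M)).
- by move=> N; apply: weighted_measurable; have [] := pN N.
- by move=> x _; rewrite sw (funext (fun N => congr1 (@complex.Re R) (sw (vN N) x))); have [] := cz (h x * character k x) x.
- by move=> x _; rewrite sw (funext (fun N => congr1 (@complex.Im R) (sw (vN N) x))); have [] := cz (h x * character k x) x.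
- by move=> N x _; exact: weighted_le.
- by move=> N _; have [_ _] := pN N; apply.
Unshelve. all: by end_near. Qed.

(** The indicator of a superlevel set of the cosine is a bounded limit of
    polynomials in the cosine, by [threshold_pow_cvg]. *)
Let perp_cos_gt v j (c d : R) : -1 <= d <= 1 -> perp v ->
  perp (fun x => v x * (d < cos (tnth x j - c))%R%:R).
Proof.
move=> /andP[d1 d2] pv.
(* An affine function of the cosine with values in [0, 1], which is below 1/2
   exactly when the cosine exceeds d. *)
pose w x := 2^-1 - (cos (tnth x j - c) - d) / 4.
have w01 (x : n.-tuple R) : 0 <= w x <= 1.
  by rewrite /w; have := cos_geN1 (tnth x j - c); have := cos_le1 (tnth x j - c);
    set u := cos _; move=> *; lra.
have pw u : perp u -> perp (fun x => u x * w x).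
  move=> pu; have := perp_lin (2^-1 + d / 4) (- 4^-1) pu (perp_cos j c pu).
  congr perp; apply/funext => x; by rewrite /w; field.
have pwk u k : perp u -> perp (fun x => u x * w x ^+ k).
  elim: k u => [|k IH] u pu; first by under eq_fun do rewrite expr0 mulr1.
  by under eq_fun do rewrite exprS mulrA; apply: IH; exact: pw.
have pM u k M : perp u -> perp (fun x => u x * (1 - w x ^+ k) ^+ M).
  elim: M u => [|M IH] u pu; first by under eq_fun do rewrite expr0 mulr1.
  under eq_fun do rewrite exprS mulrA; apply: IH.
  have := perp_lin 1 (-1) pu (pwk u k pu).
  by congr perp; apply/funext => x; ring.
have [_ [M vM] _] := pv.
apply: (perp_lim (vN := fun N x => v x * (1 - w x ^+ N) ^+ (N * 2 ^ N)) (M := M)).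
- by move=> N; exact: pM.
- move=> N x; rewrite normrM -[leRHS]mulr1; apply: ler_pM => //.
  have /andP[w0 w1] := w01 x.
  have e0 : 0 <= 1 - w x ^+ N by rewrite subr_ge0 exprn_ile1.
  have e1 : 1 - w x ^+ N <= 1 by rewrite gerBl exprn_ge0.
  by rewrite ger0_norm ?exprn_ge0 ?exprn_ile1.
- move=> x; apply: cvgMr; rewrite (_ : (d < _)%R = (w x < 2^-1)%R).
    exact: threshold_pow_cvg.
  by apply/idP/idP; rewrite /w => ?; lra.
Qed.

(** The sets whose indicators may multiply every [v] without leaving [perp]; unlike
    the sets with indicator in [perp], they are visibly stable under
    intersection, and no pi-lambda argument is needed. *)
Let good : set (set (n.-tuple R)) := [set B | measurable B /\
  forall v, perp v -> perp (fun x => v x * \1_B x)].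

Let good_sigma : sigma_algebra setT good.
Proof.
have gC A : good A -> good (setT `\` A).
  move=> [mA gA]; split; first exact: measurableD.
  move=> v pv; have := perp_lin 1 (-1) pv (gA _ pv).
  congr perp; apply/funext => x; rewrite !indicE in_setD mem_setT /=.
  by case: (x \in A) => /=; ring.
split => //.
- split => // v pv; have := perp_lin 0 0 pv pv.
  by congr perp; apply/funext => x; rewrite indicE in_set0 mulr0 !mul0r addr0.
- move=> A gA; have mA k : measurable (A k) by have [] := gA k.
  rewrite -[X in good X]setCK -[X in good X]setTD; apply: (gC); split.
    exact/measurableC/bigcupT_measurable.
  move=> v pv; have [_ [M vM] _] := pv.
  apply: (perp_lim (vN := fun N x => v x * \1_(~` \big[setU/set0]_(i < N) A i) x) (M := M)).
  + elim=> [|N IH].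
      by under eq_fun do rewrite big_ord0 setC0 indicT mulr1.
    have [_ /(_ _ IH)] := gC _ (gA N); congr perp; apply/funext => x.
    rewrite big_ord_recr /= setCU setTD -mulrA; congr (_ * _).
    by rewrite !indicE in_setI; case: (_ \in _); case: (_ \in _); rewrite /= ?mulr1 ?mulr0.
  + move=> N x; rewrite normrM -[leRHS]mulr1; apply: ler_pM => //.
    by rewrite indicE; case: (_ \in _); rewrite ?normr1 ?normr0.
  + move=> x; apply: cvgMr.
    have [Ax|Ax] := pselect ((\bigcup_k A k) x).
      have [N _ AN] := Ax; apply: cvg_near_cst; exists N.+1 => // N' /= NN'.
      rewrite !indicE; congr (nat_of_bool _)%:R; transitivity false.
        by apply: memNset; apply; rewrite -bigcup_mkord; exists N.
      by apply/esym; apply: memNset => /(_ Ax).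
    apply: cvg_near_cst; near=> N; rewrite !indicE !mem_set//.
    by rewrite -bigcup_mkord => -[k _ Ak]; apply: Ax; exists k.
Unshelve. all: by end_near. Qed.

(** On the open torus the half-space [x_j < b] is an arc around [b / 2], that is,
    a superlevel set of [cos (x_j - b / 2)]. *)
Let good_measurable B : measurable B -> good B.
Proof.
apply: tuple_sigma_ind; first exact: good_sigma.
move=> j b; have mb : measurable [set x : n.-tuple R | tnth x j < b].
  rewrite (_ : [set x | _] = (fun x : n.-tuple R => tnth x j) @^-1` `]-oo, b[%classic).
    by rewrite -[X in measurable X]setTI; apply: measurable_tnth => //; exact: measurable_itv.
  by apply/seteqP; split => x /=; rewrite in_itv.
split => // v pv; have [mv [M vM] _] := pv.
have mw : measurable_fun setT (fun x : n.-tuple R => v x * \1_[set x : n.-tuple R | tnth x j < b] x).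
  by apply: measurable_funM => //; exact: measurable_indic.
have bw : exists M, forall x, `|v x * \1_[set x : n.-tuple R | tnth x j < b] x| <= M.
  exists M => x; rewrite normrM -[leRHS]mulr1; apply: ler_pM => //.
  by rewrite indicE; case: (_ \in _); rewrite ?normr1 ?normr0.
have iE (x : n.-tuple R) : \1_[set x : n.-tuple R | tnth x j < b] x = (tnth x j < b)%R%:R :> R.
  by rewrite indicE; congr ((nat_of_bool _)%:R); apply/idP/idP => [/set_mem|H] //; exact/mem_set.
have [b0|b0] := leP b 0.
  apply: (perp_ext mw bw _ (perp_lin 0 0 pv pv)) => x Ex; rewrite iE.
  have /andP[x0 _] := E_open Ex j.
  by rewrite ltNge (le_trans b0 (ltW x0))/=; ring.
have [b2|b2] := leP (2 * pi) b.
  apply: (perp_ext mw bw _ pv) => x Ex; rewrite iE.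
  have /andP[_ x2] := E_open Ex j.
  by rewrite (lt_le_trans x2 b2) mulr1.
have d1 : -1 <= cos (b / 2) <= 1 by rewrite cos_geN1 cos_le1.
apply: (perp_ext mw bw _ (perp_cos_gt j (b / 2) d1 pv)) => x Ex; rewrite iE.
congr (_ * (nat_of_bool _)%:R); have /andP[x0 x2] := E_open Ex j.
have bI : b / 2 \in `[0, pi] by rewrite in_itv/=; apply/andP; split; lra.
have [y1|y1] := leP (tnth x j - b / 2) pi.
  rewrite -(cos_norm (_ - _)) ltr_cos//; last first.
    by rewrite in_itv/= normr_ge0 ler_norml; apply/andP; split; lra.
  apply/idP/idP => [|xb]; rewrite ltr_norml; last by apply/andP; split; lra.
  by move=> /andP[? ?]; lra.
rewrite -(cosN (_ - _)) -[cos (- _)]cosD2pi ltr_cos//; last first.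
  by rewrite in_itv/= -mulr_natl; apply/andP; split; lra.
rewrite -mulr_natl.
by apply/idP/idP => H; lra.
Qed.

(** Integrable functions orthogonal to all characters vanish almost everywhere.
    All Borel indicators belong to [perp]; for the set on which the real part
    of [c h] is positive, this says that the set is null, and four values of
    [c] cover the complement of the zero set of [h]. *)
Lemma negligible_of_perp : (lebT n).-negligible (E `&` [set x | h x != 0]).
Proof.
pose pos c := E `&` [set x | 0 < complex.Re (c * h x)].
have pos0 c : (lebT n).-negligible (pos c).
  have [[mR _] [iR _]] : cmeasurable E (fun x => c * h x) /\ cintegrable (lebT n) E (fun x => c * h x).
    by split; [apply: (@cintegrable_measurable _ _ _ (lebT n))|]; exact: cintegrableZ.
  pose B := E `&` [set x | 0 < complex.Re (c * h x)]; rewrite /pos -/B.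
  have mB : measurable B.
    rewrite (_ : B = E `&` (fun x => complex.Re (c * h x)) @^-1` `]0, +oo[%classic).
      by apply: mR => //; exact: measurable_itv.
    by apply/seteqP; split => x /=; rewrite /B /= in_itv/= andbT.
  pose k0 : n.-tuple int := [tuple 0 | j < n].
  have k01 x : character k0 x = 1 :> R[i].
    rewrite /character big1 ?cos0 ?sin0// => j _.
    by rewrite tnth_mktuple mul0r.
  have [_ /(_ _ perp_1)[mB1 [M MB] /(_ k0) pB]] := good_measurable mB.
  have iB := weighted_integrable k0 mB1 MB.
  have := cintegralZ mE c iB; rewrite pB mulr0 => /(congr1 (@complex.Re R)).
  have [icB _] := cintegrableZ mE c iB.
  pose f x := complex.Re (c * h x) * \1_B x.
  have fE x : complex.Re (c * weighted (fun x => 1 * \1_B x) k0 x) = f x.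
    rewrite /weighted k01 mulr1 mul1r mulrA /f.
    by case: (c * h x) => a b /=; rewrite mulr0 subr0.
  have f0 x : 0 <= f x.
    rewrite /f indicE; case: (boolP (x \in B)) => [/set_mem[_ /= /ltW c0]|_]; last by rewrite mulr0.
    by rewrite mulr1.
  rewrite /cintegral /= (eq_integral (fun x => (f x)%:E)); last by move=> x _; rewrite fE.
  move=> If0.
  have ifE : (lebT n).-integrable E (EFin \o f).
    by apply: eq_integrable icB => // x _ /=; rewrite fE.
  have If : (\int[lebT n]_(x in E) (f x)%:E = 0)%E.
    by rewrite -[LHS]fineK ?If0//; exact: integrable_fin_num.
  apply/negligibleP => //.
  have <- : E `&` [set x | (f x)%:E != 0%E] = B; last first.
    exact: (integral0_null mE (measurable_int _ ifE) (fun x _ => f0 x) If).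
  apply/seteqP; split => x [Ex /=]; last first.
    move=> c0; split => //; rewrite /f eqe indicE mem_set ?mulr1 ?gt_eqF//.
  move=> fx; suff /set_mem : x \in B by [].
  by apply: contraNT fx => xB; rewrite /f indicE (negbTE xB) mulr0.
apply: (negligibleS (A := (pos 1 `|` pos (-1)) `|` (pos (0 +i* -1)%C `|` pos (0 +i* 1)%C))); last first.
  by apply: negligibleU; apply: negligibleU.
move=> x [Ex /=]; rewrite /pos /=; case: (h x) => a b /=.
rewrite eq_complex /= negb_and => /orP[]; rewrite neq_lt => /orP[] H.
- by left; right; split => //; rewrite !(mul1r, mul0r, mulN1r, oppr0, subr0, sub0r, opprK) ?oppr_gt0.
- by left; left; split => //; rewrite !(mul1r, mul0r, mulN1r, oppr0, subr0, sub0r, opprK) ?oppr_gt0.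
- by right; right; split => //; rewrite !(mul1r, mul0r, mulN1r, oppr0, subr0, sub0r, opprK) ?oppr_gt0.
- by right; left; split => //; rewrite !(mul1r, mul0r, mulN1r, oppr0, subr0, sub0r, opprK) ?oppr_gt0.
Qed.

End uniqueness.

(** * Functions of mean zero in one coordinate *)

Section coordinate_mean.
Context {R : realType}.
Local Open Scope ereal_scope.
Local Notation leb := (@lebesgue_measure R).
Local Notation lebT n := (@lebesgue_tuple R n).
Local Notation I2pi := (`[0%R, (2 * pi)%R]%classic : set (measurableTypeR R)).

Let pi2_gt0 : (0 < 2 * pi :> R)%R.
Proof. by rewrite mulr_gt0// pi_gt0. Qed.

(** Fubini's theorem, with the positive and the negative part integrated
    separately by [tonelli_torus]. *)
Lemma mean0_Rintegral n (j : 'I_n) (g : n.-tuple R -> R) : measurable_fun setT g ->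
  \int[lebT n]_(x in @torus R n) `|(g x)%:E| < +oo ->
  {ae lebT n, forall x, torus x ->
     fine (\int[leb]_(u in I2pi) (g (upd x j u))%:E) = 0%R} ->
  fine (\int[lebT n]_(x in @torus R n) (g x)%:E) = 0%R.
Proof.
move=> mg goo g0.
have mT := @measurable_torus R n.
pose f x := (g x)%:E.
have mf : measurable_fun setT f by exact/measurable_EFinP.
have part (h : n.-tuple R -> \bar R) : measurable_fun setT h -> (forall x, 0 <= h x) ->
    (forall x, h x <= `|f x|) -> \int[lebT n]_(x in @torus R n) h x < +oo /\
    {ae lebT n, forall x, torus x -> \int[leb]_(u in I2pi) h (upd x j u) \is a fin_num}.
  move=> mh h0 hf.
  have hoo : \int[lebT n]_(x in @torus R n) h x < +oo.
    by apply: le_lt_trans goo; apply: ge0_le_integral_any => x _.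
  split => //; apply: (@integrable_ae _ _ _ (lebT n) _ _ (fun x => \int[leb]_(u in I2pi) h (upd x j u))) => //.
  apply/integrableP; split; first by apply: measurable_funTS; exact: measurable_upd_integral.
  under eq_integral do rewrite gee0_abs ?integral_ge0//.
  rewrite tonelli_torus//; apply: lte_mul_pinfty => //; rewrite ?lee_fin ?ltW//.
have [|poo pfin] := part f^\+ (measurable_funepos mf) (funepos_ge0 f) _.
  by move=> x; rewrite funeposE ge_max lee_abs abse_ge0.
have [|noo nfin] := part f^\- (measurable_funeneg mf) (funeneg_ge0 f) _.
  by move=> x; rewrite funenegE ge_max -[X in _ <= X]abseN lee_abs abse_ge0.
have E : \int[lebT n]_(x in @torus R n) f^\+ x = \int[lebT n]_(x in @torus R n) f^\- x.
  have pi2N0 : (2 * pi)%:E != 0 :> \bar R by rewrite eqe gt_eqF.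
  have : (2 * pi)%:E * \int[lebT n]_(x in @torus R n) f^\+ x =
         (2 * pi)%:E * \int[lebT n]_(x in @torus R n) f^\- x.
    rewrite -(tonelli_torus j); [|exact: measurable_funepos|exact: funepos_ge0].
    rewrite -(tonelli_torus j); [|exact: measurable_funeneg|exact: funeneg_ge0].
    apply: ge0_ae_eq_integral => //.
    - by apply: measurable_funTS; apply: measurable_upd_integral; [exact: measurable_funepos|exact: funepos_ge0].
    - by apply: measurable_funTS; apply: measurable_upd_integral; [exact: measurable_funeneg|exact: funeneg_ge0].
    - by move=> x _; apply: integral_ge0 => u _; exact: funepos_ge0.
    - by move=> x _; apply: integral_ge0 => u _; exact: funeneg_ge0.
    have FF : Filter (almost_everywhere (lebT n)) by apply: ae_filter_ringOfSetsType.
    apply: filterS (filterI g0 (filterI pfin nfin)) => x [Hg [Hp Hn]] Tx.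
    have IE : \int[leb]_(u in I2pi) (g (upd x j u))%:E =
       \int[leb]_(u in I2pi) f^\+ (upd x j u) - \int[leb]_(u in I2pi) f^\- (upd x j u).
      rewrite integralE; congr (_ - _); apply: eq_integral => u _.
        by rewrite !funeposE.
      by rewrite !funenegE.
    have := Hg Tx; have := Hp Tx; have := Hn Tx; rewrite IE.
    case: (integral _ _ _) => // a; case: (integral _ _ _) => // b _ _ /=.
    by move=> /eqP; rewrite subr_eq0 => /eqP ->.
  have p0 : 0 <= \int[lebT n]_(x in @torus R n) f^\+ x by apply: integral_ge0 => x _; exact: funepos_ge0.
  have n0 : 0 <= \int[lebT n]_(x in @torus R n) f^\- x by apply: integral_ge0 => x _; exact: funeneg_ge0.
  move: poo noo p0 n0; case: (integral _ _ _) => // a _; case: (integral _ _ _) => // b _ _ _ [] /mulfI -> //.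
by rewrite integralE E; case: (integral _ _ _) => //= a; rewrite subrr.
Qed.

Lemma FTC_global (F f : R -> R) (a b : R) : (a < b)%R -> continuous f ->
  (forall x : R, is_derive x 1%R F (f x)) ->
  \int[leb]_(x in `[a, b]) (f x)%:E = (F b - F a)%:E.
Proof.
move=> ab cf dF.
have cF : continuous F.
  by move=> x; apply: differentiable_continuous; apply/derivable1_diffP; have [] := dF x.
rewrite (continuous_FTC2 (F := F))// ?EFinB//.
- exact: continuous_subspaceT.
- split => [x _||]; first by have [] := dF x.
  + exact/cvg_at_right_filter/cF.
  + exact/cvg_at_left_filter/cF.
- by move=> x _; rewrite derive1E; have [_ ->] := dF x.
Qed.

Lemma integral_cos_sin (k : int) : (k != 0)%R ->
  \int[leb]_(u in I2pi) (cos (k%:~R * u))%:E = 0 /\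
  \int[leb]_(u in I2pi) (sin (k%:~R * u))%:E = 0.
Proof.
move=> k0; have kR : (k%:~R != 0 :> R)%R by rewrite intr_eq0.
have c1 : continuous (fun u : R => k%:~R * u)%R.
  by move=> u; apply: cvgMr; exact: cvg_id.
have csn (i : nat) : (cos (i%:R * (2 * pi)) = 1 :> R /\ sin (i%:R * (2 * pi)) = 0 :> R)%R.
  elim: i => [|i [IHc IHs]]; first by rewrite mul0r cos0 sin0.
  rewrite -natr1 mulrDl mul1r mulr_natl cosD sinD -mulr_natl IHc IHs mulr_natl.
  by rewrite cos2pi sin2pi !mul1r !mul0r subr0 addr0.
have [ck sk] : (cos (k%:~R * (2 * pi)) = 1 :> R /\ sin (k%:~R * (2 * pi)) = 0 :> R)%R.
  case: k {k0 kR c1} => i; first exact: csn.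
  rewrite NegzE rmorphN mulNr cosN sinN; have [-> ->] := csn i.+1.
  by rewrite oppr0.
have dk (u : R) : is_derive u 1%R (fun u : R => k%:~R * u)%R (k%:~R : R).
  have := is_deriveZ (k%:~R : R) (is_derive_id u (1 : R)%R).
  by rewrite [X in is_derive _ _ _ X](_ : _ = k%:~R)// /GRing.scale /= mulr1.
have ds (u : R) : is_derive u 1%R (fun u : R => k%:~R^-1 * sin (k%:~R * u))%R (cos (k%:~R * u)).
  have := is_deriveZ (k%:~R^-1 : R) (is_derive1_comp (is_derive_sin (k%:~R * u)%R) (dk u)).
  by rewrite [X in is_derive _ _ _ X](_ : _ = cos (k%:~R * u))// /GRing.scale /= mulrCA mulVf// mulr1.
have dc (u : R) : is_derive u 1%R (fun u : R => - k%:~R^-1 * cos (k%:~R * u))%R (sin (k%:~R * u)).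
  have := is_deriveZ (- k%:~R^-1 : R)%R (is_derive1_comp (is_derive_cos (k%:~R * u)%R) (dk u)).
  by rewrite [X in is_derive _ _ _ X -> _](_ : _ = sin (k%:~R * u)); last by rewrite /GRing.scale /=; field.
split.
  apply: etrans (FTC_global pi2_gt0 _ ds) _.
    by move=> u; apply: continuous_comp; [exact: c1|exact: continuous_cos].
  by rewrite sk !mulr0 sin0 mulr0 subrr.
apply: etrans (FTC_global pi2_gt0 _ dc) _.
  by move=> u; apply: continuous_comp; [exact: c1|exact: continuous_sin].
by rewrite ck mulr0 cos0 subrr.
Qed.

Lemma mean0_cintegral n (j : 'I_n) (F : n.-tuple R -> R[i]) : cmeasurable setT F ->
  \int[lebT n]_(x in @torus R n) (Normc.normc (F x))%:E < +oo ->
  {ae lebT n, forall x, torus x -> cintegral leb I2pi (fun u => F (upd x j u)) = 0%R} ->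
  cintegral (lebT n) (@torus R n) F = 0%R.
Proof.
move=> [mR mI] Foo F0.
have FF : Filter (almost_everywhere (lebT n)) by apply: ae_filter_ringOfSetsType.
apply/eqP; rewrite eq_complex /=; apply/andP; split; apply/eqP.
  apply: (mean0_Rintegral (j := j) mR).
    apply: le_lt_trans Foo; apply: ge0_le_integral_any => x _ //.
    by rewrite lee_fin; have [] := normc_ReIm (F x).
  by apply: filterS F0 => x H /H /(congr1 (@complex.Re R)).
apply: (mean0_Rintegral (j := j) mI).
  apply: le_lt_trans Foo; apply: ge0_le_integral_any => x _ //.
  by rewrite lee_fin; have [] := normc_ReIm (F x).
by apply: filterS F0 => x H /H /(congr1 (@complex.Im R)).
Qed.

Lemma cintegrable_bounded d (T : measurableType d) (mu : {measure set T -> \bar R})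
    (D : set T) (F : T -> R[i]) (M : R) : measurable D -> mu D < +oo ->
  cmeasurable D F -> (forall x, D x -> (Normc.normc (F x) <= M)%R) -> cintegrable mu D F.
Proof.
move=> mD Doo mF FM; apply: (le_cintegrable mD mF (g := cst M%:E)).
  by move=> x Dx; rewrite lee_fin FM.
apply/integrableP; split; first exact: measurable_cst.
by rewrite /= integral_cst// lte_mul_pinfty.
Qed.

Lemma lebesgue_torus n : lebT n (@torus R n) = ((2 * pi) ^+ n)%:E.
Proof.
elim: n => [|n IH].
  rewrite expr0 (_ : @torus R 0 = setT); first exact: diracT.
  by apply/seteqP; split => // x _ [].
have mT k := @measurable_torus R k.
rewrite -[LHS]mul1e -(integral_cst (lebT n.+1) (mT _)).
rewrite (integral_torus_cons (F := cst 1))//.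
rewrite (eq_integral (cst ((2 * pi) ^+ n)%:E)); last first.
  move=> u _; transitivity (1 * lebT n (@torus R n)).
    exact: (integral_cst (lebT n) (mT n) 1).
  by rewrite mul1e; exact: IH.
transitivity (((2 * pi) ^+ n)%:E * leb I2pi); first exact: integral_cst.
by rewrite exprSr EFinM; congr (_ * _); exact: leb_I2pi.
Qed.

Lemma integral_torus_cst n (c : R) :
  \int[lebT n]_(x in @torus R n) c%:E = (c * (2 * pi) ^+ n)%:E.
Proof.
rewrite integral_cst//; last exact: measurable_torus.
by rewrite EFinM; congr (_ * _); exact: lebesgue_torus.
Qed.

(** A character factors through each coordinate. *)
Lemma character_upd n (k : n.-tuple int) (x : n.-tuple R) (j : 'I_n) (u : R) :
  (character k (upd x j u) = character k (upd x j 0) *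
    (cos ((tnth k j)%:~R * u) +i* sin ((tnth k j)%:~R * u))%C)%R.
Proof.
rewrite /character /=.
rewrite (bigD1 j)//= [in RHS](bigD1 j)//= !tnth_mktuple eqxx mulr0 add0r.
rewrite (eq_bigr (fun i => (tnth k i)%:~R * tnth x i)%R); last first.
  by move=> i ij; rewrite tnth_mktuple (negbTE ij).
rewrite [in RHS](eq_bigr (fun i => (tnth k i)%:~R * tnth x i)%R); last first.
  by move=> i ij; rewrite tnth_mktuple (negbTE ij).
rewrite addrC cosD sinD; apply/eqP; rewrite eq_complex /=.
by apply/andP; split; apply/eqP; ring.
Qed.

Lemma cintegral_character n (k : n.-tuple int) :
  cintegral (lebT n) (@torus R n) (character k) =
  if k == [tuple 0%R | j < n] then (((2 * pi) ^+ n)%:C)%C else 0%R.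
Proof.
have mT := @measurable_torus R n.
case: eqP => [->|/eqP k0].
  rewrite (eq_cintegral _ (g := fun=> 1%R)); last first.
    move=> x _; rewrite /character big1 ?cos0 ?sin0// => j _.
    by rewrite tnth_mktuple mul0r.
  apply/eqP; rewrite eq_complex /=; apply/andP; split; apply/eqP.
    by rewrite integral_torus_cst mul1r.
  by rewrite integral_torus_cst mul0r.
have [j kj] : exists j, (tnth k j != 0)%R.
  apply/existsP; apply: contraNT k0; rewrite negb_exists => /forallP H.
  by apply/eqP/eq_from_tnth => j; rewrite tnth_mktuple; apply/eqP; have := H j; rewrite negbK.
apply: (mean0_cintegral (j := j)); first exact: measurable_character.
  under eq_integral do rewrite normc_character.
  by rewrite integral_torus_cst ltry.
apply: aeW => x _; rewrite (eq_cintegral _ (g := fun u : measurableTypeR R => (character k (upd x j 0) *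
    (cos ((tnth k j)%:~R * (u : R)) +i* sin ((tnth k j)%:~R * (u : R)))%C)%R)); last first.
  by move=> u _; exact: character_upd.
have [ic is_] := integral_cos_sin kj.
rewrite cintegralZ//; last first.
  apply: (@cintegrable_bounded _ _ leb _ _ 1%R) => //.
  - by rewrite [X in X < _]leb_I2pi ltry.
  - split; apply: measurable_funTS; apply: continuous_measurable_fun => u;
    (apply: continuous_comp; [apply: cvgMr; exact: cvg_id|]).
      exact: continuous_cos.
    exact: continuous_sin.
  - by move=> u _; rewrite /= cos2Dsin2 sqrtr1.
by rewrite /cintegral /= ic is_ mulr0.
Qed.

End coordinate_mean.

(** * Dyadic blocks *)

Section dyadic_blocks.
Context {R : realType}.
Local Notation lebT n := (@lebesgue_tuple R n).

(** The only index [s] for which [rho s] may contain the frequency [k]; blocks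
    partition the frequencies without vanishing component. *)
Definition level n (k : n.-tuple int) : n.-tuple nat :=
  [tuple (trunc_log 2 `|tnth k j|%N).+1 | j < n].

Lemma rhoP n (s : n.-tuple nat) (k : n.-tuple int) :
  rho R s k <-> (forall j, tnth k j != 0) /\ s = level k.
Proof.
have natE (j : 'I_n) (i : nat) : ((`|tnth k j|%:~R : R) < 2 ^ i.+1%:Z) = (`|tnth k j| < 2 ^ i.+1)%N.
  by rewrite -exprnP -natrX -[`|tnth k j|]abszE -pmulrn ltr_nat.
have natE' (j : 'I_n) (i : nat) : ((2 : R) ^ (i.+1%:Z - 1) <= `|tnth k j|%:~R) = (2 ^ i <= `|tnth k j|)%N.
  rewrite (_ : i.+1%:Z - 1 = i%:Z); last by lia.
  by rewrite -exprnP -natrX -[`|tnth k j|]abszE -pmulrn ler_nat.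
split => [H|[k0 ->] j]; last first.
  have k1 : (0 < `|tnth k j|)%N by rewrite absz_gt0.
  by rewrite tnth_mktuple natE natE' trunc_logP// trunc_log_ltn.
have kj j : tnth k j != 0.
  apply/eqP => kj; have := H j; rewrite kj normr0 => /andP[+ _].
  by rewrite leNgt exprz_gt0.
split => //; apply: eq_from_tnth => j; rewrite tnth_mktuple.
have := H j; case: (tnth s j) => [|i].
  rewrite expr0z => /andP[_].
  by rewrite -[`|tnth k j|]abszE -pmulrn -[1]/(1%:R) ltr_nat ltnS leqn0 absz_eq0 (negbTE (kj j)).
rewrite natE natE' => /andP[i1 i2]; congr S.
by apply/esym; apply: trunc_log_eq => //; rewrite i1.
Qed.

Lemma rho_lt n (s : n.-tuple nat) (k : n.-tuple int) j : rho R s k ->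
  (`|tnth k j| < 2 ^ tnth s j)%N.
Proof.
move=> /rhoP[k0 ->]; rewrite tnth_mktuple.
by rewrite trunc_log_ltn.
Qed.

Lemma finite_rho n (s : n.-tuple nat) : finite_set (rho R s).
Proof.
pose K := (\max_(j < n) 2 ^ tnth s j)%N.
pose h (t : {ffun 'I_n -> 'I_(K + K).+1}) : n.-tuple int :=
  [tuple (val (t j))%:Z - K%:Z | j < n].
apply: (@sub_finite_set _ _ (h @` setT)); last exact: finite_image.
move=> k sk; have kK j : (`|tnth k j| < K)%N.
  by apply: leq_trans (rho_lt j sk) _; exact: (@leq_bigmax _ (fun j => 2 ^ tnth s j)%N).
exists [ffun j => inord (absz (tnth k j + K%:Z)%R)] => //.
apply: eq_from_tnth => j; rewrite tnth_mktuple ffunE /= inordK; have := kK j; lia.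
Qed.

Lemma dyadic_blockE n (s : n.-tuple nat) (f : n.-tuple R -> R[i]) (x : n.-tuple R) :
  dyadic_block s f x =
  \sum_(k <- finmap.enum_fset (fset_set (rho R s))) fourier_coef f k * character k x.
Proof. by rewrite /dyadic_block fsbig_finite//; exact: finite_rho. Qed.

Lemma dyadic_block_cmeasurable n (s : n.-tuple nat) f (D : set (n.-tuple R)) :
  cmeasurable D (dyadic_block s f).
Proof.
rewrite (funext (dyadic_blockE s f)); apply: cmeasurable_sum => k.
by apply: cmeasurableM; [exact: cmeasurable_cst|exact: measurable_character].
Qed.

Lemma lebesgue_torus_fin n : (lebT n (@torus R n) < +oo)%E.
Proof. by rewrite [X in (X < _)%E]lebesgue_torus ltry. Qed.

Lemma character_cintegrable n (k : n.-tuple int) :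
  cintegrable (lebT n) (@torus R n) (character k).
Proof.
apply: (@cintegrable_bounded _ _ _ (lebT n) _ _ 1).
- exact: measurable_torus.
- exact: lebesgue_torus_fin.
- exact: measurable_character.
- by move=> x _; rewrite normc_character.
Qed.

(** The coefficients of a block are those of [f] on its frequencies and zero
    elsewhere, by orthogonality of the characters. *)
Lemma cintegral_dyadic_block n (s : n.-tuple nat) f (k : n.-tuple int) :
  cintegral (lebT n) (@torus R n) (fun x => dyadic_block s f x * character (topp k) x) =
  if `[< rho R s k >] then fourier_coef f k * (((2 * pi) ^+ n)%:C)%C else 0.
Proof.
have mT := @measurable_torus R n.
have ci (l : n.-tuple int) := character_cintegrable l.
rewrite (eq_cintegral _ (g := fun x => \sum_(l <- finmap.enum_fset (fset_set (rho R s)))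
   fourier_coef f l * character (tplus l (topp k)) x)); last first.
  move=> x _; rewrite dyadic_blockE mulr_suml; apply: eq_bigr => l _.
  by rewrite characterD mulrA.
rewrite cintegral_sum//; last by move=> l; apply: cintegrableZ.
have E (l : n.-tuple int) : (tplus l (topp k) == [tuple 0 | j < n]) = (l == k).
  apply/eqP/eqP => [H|->]; apply: eq_from_tnth => j; last by rewrite !tnth_mktuple subrr.
  have := congr1 (fun t => tnth t j) H; rewrite !tnth_mktuple => /eqP.
  by rewrite subr_eq0 => /eqP.
under eq_bigr do rewrite cintegralZ// cintegral_character E.
case: asboolP => sk.
  have kin : k \in finmap.enum_fset (fset_set (rho R s)).
    by rewrite in_fset_set ?mem_set//; exact: finite_rho.
  rewrite (bigD1_seq k kin (finmap.fset_uniq _))/= eqxx big1 ?addr0// => l /negbTE ->.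
  by rewrite mulr0.
rewrite big_seq big1// => l; rewrite in_fset_set; last exact: finite_rho.
move=> /set_mem sl; case: eqP => [lk|_]; last by rewrite mulr0.
by rewrite lk in sl.
Qed.

End dyadic_blocks.

(** * The series of the dyadic blocks *)

Section representation.
Context {R : realType}.
Local Notation lebT n := (@lebesgue_tuple R n).

Lemma hyperplane_null n (j : 'I_n) (c : R) :
  measurable [set x : n.-tuple R | tnth x j = c] /\
  lebT n [set x : n.-tuple R | tnth x j = c] = 0%E.
Proof.
have mA m (i : 'I_m) : measurable [set x : m.-tuple R | tnth x i = c].
  rewrite (_ : [set x | _] = (fun x : m.-tuple R => tnth x i) @^-1` [set c]); last by [].
  by rewrite -[X in measurable X]setTI; apply: measurable_tnth => //; exact: measurable_set1.
split; first exact: mA.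
elim: n j => [|n IH] j; first by case: j.
case: (unliftP ord0 j) => [i ->|->].
  rewrite /= integral0_eq// => u _; rewrite -[RHS](IH i); congr lebesgue_tuple.
  by apply/seteqP; split => x /=; rewrite tnthS.
rewrite -[X in lebesgue_tuple X]setIT -(integral_indic (lebT n.+1) measurableT (mA _ ord0)).
rewrite integral_tuple_consC; last 2 first.
- by apply/measurable_EFinP; apply: measurable_indic; exact: mA.
- by move=> x; rewrite lee_fin.
rewrite integral0_eq// => x _; rewrite -(slice_measureE x (mA _ ord0)).
rewrite -[RHS](lebesgue_measure_set1 c); congr (_ _).
Qed.

(** The uniqueness argument lives on the open torus, where half-spaces are
    arcs. *)
Lemma torus_boundary_negligible n :
  (lebT n).-negligible (@torus R n `\` [set x | forall j, 0 < tnth x j < 2 * pi]).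
Proof.
apply: (negligibleS (A := \bigcup_k oapp (fun j : 'I_n =>
    [set x : n.-tuple R | tnth x j = 0] `|` [set x : n.-tuple R | tnth x j = 2 * pi]) set0 (unpickle k))).
  move=> x [xT /= /existsNP[j nj]]; exists (pickle j) => //; rewrite pickleK /=.
  have := xT j; rewrite in_itv/= !le_eqVlt => /andP[/orP[/eqP <-|x0] /orP[/eqP|x2]]; [by left|by left|by right|].
  by exfalso; apply: nj; rewrite x0.
apply: negligible_bigcup => k; case: unpickle => [j|] /=; last exact: negligible_set0.
by apply: negligibleU; apply/negligibleP; have [] := hyperplane_null j 0; have [] := hyperplane_null j (2 * pi).
Qed.

Lemma Re_sum (I : Type) (r : seq I) (P : pred I) (F : I -> R[i]) :
  complex.Re (\sum_(i <- r | P i) F i) = \sum_(i <- r | P i) complex.Re (F i).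
Proof. by apply: (big_morph (@complex.Re R)) => // -[a b] [c d]. Qed.

Lemma Im_sum (I : Type) (r : seq I) (P : pred I) (F : I -> R[i]) :
  complex.Im (\sum_(i <- r | P i) F i) = \sum_(i <- r | P i) complex.Im (F i).
Proof. by apply: (big_morph (@complex.Im R)) => // -[a b] [c d]. Qed.

Lemma normc_sum_le (I : Type) (r : seq I) (P : pred I) (F : I -> R[i]) :
  Normc.normc (\sum_(i <- r | P i) F i) <= \sum_(i <- r | P i) Normc.normc (F i).
Proof.
elim/big_rec2: _ => [|i y z _ IH]; first by rewrite Normc.normc0.
by apply: le_trans (le_normcD _ _) _; rewrite lerD2l.
Qed.

Lemma abs_series_cvg (b : nat -> R) : (\sum_(k <oo) `|b k|%:E < +oo)%E ->
  cvgn (fun N => \sum_(i < N) b i).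
Proof.
move=> boo; rewrite (_ : (fun N => _) = [series b k]_k); last first.
  by apply/funext => N; rewrite /series /= big_mkord.
apply: normed_cvg; rewrite (_ : [normed _] = fun N => \sum_(0 <= i < N) `|b i|)//.
apply: nondecreasing_is_cvgn.
  by apply/nondecreasing_seqP => N; rewrite big_nat_recr//= lerDl.
have b0 : (0 <= \sum_(k <oo) `|b k|%:E)%E by apply: nneseries_ge0 => k _ _; rewrite lee_fin.
exists (fine (\sum_(k <oo) `|b k|%:E)%E) => _ [N _ <-].
rewrite -lee_fin fineK ?ge0_fin_numE// -sumEFin.
by apply: nneseries_lim_ge => k _ _; rewrite lee_fin.
Qed.

Definition clim (S : nat -> R[i]) : R[i] :=
  (limn (fun N => complex.Re (S N)) +i* limn (fun N => complex.Im (S N)))%C.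

Lemma cseries_cvg (u : nat -> R[i]) (S := fun N => \sum_(i < N) u i) :
  (\sum_(k <oo) (Normc.normc (u k))%:E < +oo)%E ->
  [/\ (fun N => complex.Re (S N)) @ \oo --> complex.Re (clim S),
      (fun N => complex.Im (S N)) @ \oo --> complex.Im (clim S),
      forall N, ((Normc.normc (S N))%:E <= \sum_(k <oo) (Normc.normc (u k))%:E)%E &
      ((Normc.normc (clim S))%:E <= \sum_(k <oo) (Normc.normc (u k))%:E)%E].
Proof.
move=> uoo.
have cR : cvgn (fun N => complex.Re (S N)).
  rewrite (_ : (fun N => _) = (fun N => \sum_(i < N) complex.Re (u i))); last first.
    by apply/funext => N; rewrite /S Re_sum.
  apply: (@abs_series_cvg (fun i => complex.Re (u i))); apply: le_lt_trans uoo.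
  apply: lee_nneseries => [k _ _|k _]; rewrite lee_fin//.
  by have [] := normc_ReIm (u k).
have cI : cvgn (fun N => complex.Im (S N)).
  rewrite (_ : (fun N => _) = (fun N => \sum_(i < N) complex.Im (u i))); last first.
    by apply/funext => N; rewrite /S Im_sum.
  apply: (@abs_series_cvg (fun i => complex.Im (u i))); apply: le_lt_trans uoo.
  apply: lee_nneseries => [k _ _|k _]; rewrite lee_fin//.
  by have [] := normc_ReIm (u k).
have SN N : ((Normc.normc (S N))%:E <= \sum_(k <oo) (Normc.normc (u k))%:E)%E.
  apply: (@le_trans _ _ (\sum_(i < N) Normc.normc (u i))%:E).
    by rewrite lee_fin; exact: normc_sum_le.
  rewrite -sumEFin -(big_mkord xpredT (fun i => (Normc.normc (u i))%:E)).
  by apply: nneseries_lim_ge => k _ _; rewrite lee_fin normc_ge0.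
split => //.
have G0 : (0 <= \sum_(k <oo) (Normc.normc (u k))%:E)%E.
  by apply: nneseries_ge0 => k _ _; rewrite lee_fin normc_ge0.
move: SN G0 uoo; case: (limn _) => // g SN g0 _.
rewrite lee_fin /clim /= -[leRHS]ger0_norm// -sqrtr_sqr; apply: ler_wsqrtr.
rewrite lee_fin in g0.
have cv : (fun N => complex.Re (S N) ^+ 2 + complex.Im (S N) ^+ 2) @ \oo -->
    limn (fun N => complex.Re (S N)) ^+ 2 + limn (fun N => complex.Im (S N)) ^+ 2.
  by apply: cvgD; apply: cvgM.
rewrite -(cvg_lim _ cv)//; apply: limr_le; first by apply/cvg_ex; eexists; exact: cv.
near=> N; have := SN N; rewrite lee_fin => h.
rewrite -[leLHS]sqr_sqrtr ?addr_ge0 ?sqr_ge0//.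
apply: lerXn2r; rewrite ?nnegrE ?sqrtr_ge0//.
by move: h; case: (S N).
Unshelve. all: by end_near. Qed.

End representation.

Lemma cintegral_null_ext d (T : measurableType d) (R : realType)
    (mu : {measure set T -> \bar R}) (D E : set T) (g : T -> R[i]) :
  measurable D -> measurable E -> E `<=` D -> mu (D `\` E) = 0%E ->
  cintegral mu D g = cintegral mu E g.
Proof.
by move=> mD mE ED DE; congr (fine _ +i* fine _)%C; exact: integral_null_ext.
Qed.

Section character_products.
Context {R : realType} (n : nat).
Local Notation lebT n := (@lebesgue_tuple R n).
Local Notation leb := (@lebesgue_measure R).
Local Notation I2pi := (`[0, 2 * pi]%classic : set (measurableTypeR R)).

Lemma character0 (x : n.-tuple R) : character [tuple 0 | j < n] x = 1.
Proof.
rewrite /character big1 ?cos0 ?sin0// => j _.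
by rewrite tnth_mktuple mul0r.
Qed.

Lemma cintegrable_character (E : set (n.-tuple R)) (F : n.-tuple R -> R[i]) k :
  measurable E -> cintegrable (lebT n) E F ->
  cintegrable (lebT n) E (fun x => F x * character k x).
Proof.
move=> mE iF; have [iR iI] := iF.
have mF : cmeasurable E (fun x => F x * character k x).
  by apply: cmeasurableM; [exact: cintegrable_measurable iF|exact: measurable_character].
apply: (le_cintegrable mE mF _ (integrableD mE (integrable_abse iR) (integrable_abse iI))) => x _.
by rewrite Normc.normcM normc_character mulr1 -EFinD lee_fin; exact: normc_le_ReIm.
Qed.

Lemma cvg_mulc (z : nat -> R[i]) (l w : R[i]) :
  (fun N => complex.Re (z N)) @ \oo --> complex.Re l ->
  (fun N => complex.Im (z N)) @ \oo --> complex.Im l ->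
  (fun N => complex.Re (z N * w)) @ \oo --> complex.Re (l * w) /\
  (fun N => complex.Im (z N * w)) @ \oo --> complex.Im (l * w).
Proof.
move=> cR cI.
have ReM (u v : R[i]) : complex.Re (u * v) =
    complex.Re u * complex.Re v - complex.Im u * complex.Im v by case: u; case: v.
have ImM (u v : R[i]) : complex.Im (u * v) =
    complex.Re u * complex.Im v + complex.Im u * complex.Re v by case: u; case: v.
split.
  rewrite (funext (fun N => ReM (z N) w)) ReM.
  by apply: cvgB; apply: cvgMl.
rewrite (funext (fun N => ImM (z N) w)) ImM.
by apply: cvgD; apply: cvgMl.
Qed.

(** If [f] has mean zero in the variable [j], its coefficients at frequencies with
    [k_j = 0] vanish, because the character is then constant in [x_j].  The
    function is replaced by a Borel version [f1], which differs from it on a null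
    set and hence, on almost every line, on a null set of that line. *)
Lemma mean0_torus (f f1 : n.-tuple R -> R[i]) (N : set (n.-tuple R)) k j :
  cmeasurable setT f1 ->
  (\int[lebT n]_(x in @torus R n) (Normc.normc (f1 x))%:E < +oo)%E ->
  measurable N -> lebT n N = 0%E -> (forall x, ~ N x -> f1 x = f x) ->
  tnth k j = 0 ->
  {ae lebT n, forall x, cintegral leb `[0, 2 * pi] (fun u => f (upd x j u)) = 0} ->
  cintegral (lebT n) (@torus R n) (fun x => f1 x * character k x) = 0.
Proof.
move=> mf1 f1oo mN N0 f1f kj mean0.
have mT := @measurable_torus R n.
have mI : measurable I2pi by [].
apply: (mean0_cintegral (j := j)).
- by apply: cmeasurableM => //; exact: measurable_character.
- by under eq_integral do rewrite Normc.normcM normc_character mulr1.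
have FF : Filter (almost_everywhere (lebT n)) by apply: ae_filter_ringOfSetsType.
have mnf : measurable_fun setT (fun x => (Normc.normc (f1 x))%:E).
  by apply/measurable_EFinP; exact: measurable_normc.
have nf0 x : (0 <= (Normc.normc (f1 x))%:E)%E by rewrite lee_fin normc_ge0.
have slice_fin : {ae lebT n, forall x, torus x ->
    (\int[leb]_(u in I2pi) (Normc.normc (f1 (upd x j u)))%:E \is a fin_num)%E}.
  apply: (@integrable_ae _ _ _ (lebT n) _ mT (fun x => \int[leb]_(u in I2pi) (Normc.normc (f1 (upd x j u)))%:E)%E).
  apply/integrableP; split; first by apply: measurable_funTS; exact: (measurable_upd_integral j mnf nf0).
  under eq_integral do rewrite gee0_abs ?integral_ge0//.
  rewrite (tonelli_torus j mnf nf0) lte_mul_pinfty ?lee_fin ?mulr_ge0 ?pi_ge0//.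
have mN1 : measurable_fun setT (fun x => (\1_N x)%:E : \bar R).
  by apply/measurable_EFinP; exact: measurable_indic.
have N10 x : (0 <= (\1_N x)%:E :> \bar R)%E by rewrite lee_fin.
have slice0 : {ae lebT n, forall x, torus x ->
    (\int[leb]_(u in I2pi) (\1_N (upd x j u))%:E = 0)%E}.
  have := @ae_eq_integral_abs _ _ _ (lebT n) _ mT (fun x => \int[leb]_(u in I2pi) (\1_N (upd x j u))%:E)%E
    (measurable_funTS (measurable_upd_integral j mN1 N10)).
  move=> [+ _]; apply.
  under eq_integral do rewrite gee0_abs ?integral_ge0//.
  rewrite (tonelli_torus j mN1 N10) (integral_indic (lebT n) mT mN).
  rewrite [X in (_ * X)%E](_ : _ = 0%E) ?mule0//; apply/negligibleP; first exact: measurableI.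
  by apply: (negligibleS (A := N)); [move=> x []|apply/negligibleP].
apply: filterS (filterI mean0 (filterI slice_fin slice0)) => x [Hm [Hf H0]] xT.
pose g u := f1 (upd x j u).
have mg D : cmeasurable D (g : measurableTypeR R -> R[i]).
  have [mR mIm] := mf1; split; apply: measurable_funTS.
    exact: (measurableT_comp mR (measurable_upd_l j x)).
  exact: (measurableT_comp mIm (measurable_upd_l j x)).
have ig : cintegrable leb I2pi g.
  apply: (le_cintegrable (g := fun u => (Normc.normc (g u))%:E) mI (mg _)) => //.
  apply/integrableP; split; first by apply/measurable_EFinP; exact: measurable_normc.
  under eq_integral do rewrite gee0_abs ?nf0//.
  by move/fin_numPlt: (Hf xT) => /andP[].
rewrite (eq_cintegral _ (g := fun u => character k (upd x j 0) * g u)); last first.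
  move=> u _; rewrite character_upd kj mul0r cos0 sin0 mulr1 mulrC.
  by congr (_ * _); rewrite mulr1.
rewrite cintegralZ// -[RHS](mulr0 (character k (upd x j 0))); congr (_ * _).
rewrite -[RHS]Hm.
pose S : set (measurableTypeR R) := [set u | N (upd x j u)].
have mS : measurable S.
  by rewrite -[X in measurable X]setTI; exact: (measurable_upd_l j x).
have S0 : leb (I2pi `\` (I2pi `\` S)) = 0%E.
  rewrite setDD setIC -(integral_indic leb mI mS) -[RHS](H0 xT).
  by apply: eq_integral => u _; rewrite !indicE.
rewrite (cintegral_null_ext _ mI (measurableD mI mS) _ S0)//.
rewrite [RHS](cintegral_null_ext _ mI (measurableD mI mS) _ S0)//.
by apply: eq_cintegral => u [_ nS]; rewrite /g f1f.
Qed.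

End character_products.

Section representation_theorem.
Context {R : realType} (n : nat).
Local Notation lebT n := (@lebesgue_tuple R n).
Local Notation leb := (@lebesgue_measure R).
Local Notation norm_of F := (fun x => (Normc.normc (F x))%:E).
Variables (phi : 'I_n -> R -> R) (B : 'I_n -> R).
Hypothesis phi_gt0 : forall j k, 0 < phi j (2 ^- k).
Hypothesis phi_sum : forall j, (\sum_(k <oo) (2 ^- k / phi j (2 ^- k))%:E <= (B j)%:E)%E.
Variables (f : n.-tuple R -> R[i]) (A : R) (a : n.-tuple nat -> R).
Hypothesis f_measurable :
  lebesgue_measurable_fun (lebT n) setT (fun x => complex.Re (f x)) /\
  lebesgue_measurable_fun (lebT n) setT (fun x => complex.Im (f x)).
Hypothesis A_ge0 : 0 <= A.
Hypothesis a_ge0 : forall s, 0 <= a s.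
Hypothesis star_f : forall t, (forall j, 0 < tnth t j <= 1) ->
  (star (norm_of f) t <= (A * \prod_j (phi j (tnth t j))^-1)%:E)%E.
Hypothesis star_block : forall s t, (forall j, 0 < tnth t j <= 1) ->
  (star (norm_of (dyadic_block s f)) t <= (a s * \prod_j (phi j (tnth t j))^-1)%:E)%E.
Hypothesis a_summable : (\esum_(s in [set: n.-tuple nat]) (a s)%:E < +oo)%E.
Hypothesis mean0 : forall j, {ae lebT n, forall x,
  cintegral leb `[0, 2 * pi] (fun u => f (upd x j u)) = 0}.

Let mT := @measurable_torus R n.
Let C := \prod_j (4 * pi * B j).

Let integral_norm_le (F : n.-tuple R -> R[i]) (D : R) : cmeasurable setT F -> 0 <= D ->
  (forall t, (forall j, 0 < tnth t j <= 1) ->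
    (star (norm_of F) t <= (D * \prod_j (phi j (tnth t j))^-1)%:E)%E) ->
  (\int[lebT n]_(x in @torus R n) (Normc.normc (F x))%:E <= (D * C)%:E)%E.
Proof.
move=> mF D0; apply: integral_torus_star => //.
  by apply/measurable_EFinP; exact: measurable_normc.
by move=> x; rewrite lee_fin normc_ge0.
Qed.

Let C_ge0 : 0 <= C.
Proof.
apply: prodr_ge0 => j _; rewrite mulr_ge0 ?mulr_ge0 ?pi_ge0// -lee_fin.
apply: le_trans (phi_sum j); apply: nneseries_ge0 => k _ _.
by rewrite lee_fin divr_ge0 ?invr_ge0 ?exprn_ge0// ltW.
Qed.

(** The blocks as a sequence, through the enumeration of the tuples; indices
    that code no tuple give zero. *)
Let block k (x : n.-tuple R) : R[i] :=
  oapp (fun s => dyadic_block s f x) 0 (@pickle_inv (n.-tuple nat) k).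

Let block_cmeasurable k D : cmeasurable D (block k).
Proof.
rewrite /block; case: pickle_inv => [s|] /=; last exact: cmeasurable_cst.
exact: dyadic_block_cmeasurable.
Qed.

Let total (x : n.-tuple R) : \bar R := (\sum_(k <oo) (Normc.normc (block k x))%:E)%E.

Let totalE x : total x = (\esum_(s in [set: n.-tuple nat]) (Normc.normc (dyadic_block s f x))%:E)%E.
Proof.
rewrite esum_pickle; last by move=> s; rewrite lee_fin normc_ge0.
apply: eq_eseriesr => k _; rewrite /block; case: pickle_inv => [s|] //=.
by rewrite expr0n/= addr0 sqrtr0.
Qed.

Let total_ge0 x : (0 <= total x)%E.
Proof. by apply: nneseries_ge0 => k _ _; rewrite lee_fin normc_ge0. Qed.

Let total_measurable : measurable_fun setT total.
Proof.
apply: ge0_emeasurable_sum => [k x _ _|k _]; first by rewrite lee_fin normc_ge0.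
by apply/measurable_EFinP/measurable_normc; exact: block_cmeasurable.
Qed.

Let total_integral : (\int[lebT n]_(x in @torus R n) total x < +oo)%E.
Proof.
rewrite integral_nneseries//; last 2 first.
- move=> k; apply/measurable_EFinP/measurable_normc; exact: block_cmeasurable.
- by move=> k x _; rewrite lee_fin normc_ge0.
apply: (@le_lt_trans _ _ (\sum_(k <oo) C%:E * oapp (fun s => (a s)%:E) 0%E (@pickle_inv (n.-tuple nat) k))%E).
  apply: lee_nneseries => [k _ _|k _]; first by apply: integral_ge0 => x _; rewrite lee_fin normc_ge0.
  rewrite /block; case: pickle_inv => [s|] /=.
    rewrite -EFinM mulrC; apply: integral_norm_le => //; last exact: star_block.
    exact: dyadic_block_cmeasurable.
  rewrite mule0 integral0_eq// => x _; by rewrite expr0n/= addr0 sqrtr0.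
rewrite nneseriesZl; last by move=> k _; case: pickle_inv => [s|] //=; rewrite lee_fin.
rewrite -(esum_pickle (a := fun s => (a s)%:E)); last by move=> s; rewrite lee_fin.
by apply: lte_mul_pinfty; rewrite ?lee_fin.
Qed.

(** The series of the blocks converges absolutely outside a null set, as the
    integrals of its terms are summable.  Its sum and [f] have the same Fourier
    coefficients, thus agree almost everywhere. *)
Lemma dyadic_representation : exists N, [/\ measurable N, lebT n N = 0%E &
  forall x, torus x -> ~ N x ->
   ((Normc.normc (f x))%:E <= \esum_(s in [set: n.-tuple nat]) (Normc.normc (dyadic_block s f x))%:E)%E].
Proof.
have [[N1 [mN1 N10 mR]] [N2 [mN2 N20 mI]]] :
    (exists N, [/\ measurable N, lebT n N = 0%E & measurable_fun (~` N) (fun x => complex.Re (f x))]) /\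
    (exists N, [/\ measurable N, lebT n N = 0%E & measurable_fun (~` N) (fun x => complex.Im (f x))]).
  by split; apply: lebesgue_measurable_borel; case: f_measurable.
have [N3 [mN3 N30 bd]] := @torus_boundary_negligible R n.
pose N0 := N1 `|` N2 `|` N3.
have mN0 : measurable N0 by apply: measurableU => //; exact: measurableU.
have N00 : lebT n N0 = 0%E.
  by apply/negligibleP => //; apply: negligibleU; first apply: negligibleU; apply/negligibleP.
have mf0 : cmeasurable (~` N0) f.
  have s1 : ~` N0 `<=` ~` N1 by move=> x nx Nx; apply: nx; left; left.
  have s2 : ~` N0 `<=` ~` N2 by move=> x nx Nx; apply: nx; left; right.
  by split; [exact: (measurable_funS (measurableC mN1) s1 mR)|exact: (measurable_funS (measurableC mN2) s2 mI)].
(* f1 is a Borel version of f. *)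
pose f1 x := (\1_(~` N0) x)%:C%C * f x.
have f1E x : ~ N0 x -> f1 x = f x by move=> nx; rewrite /f1 indicE mem_set// mul1r.
have f1_le x : Normc.normc (f1 x) <= Normc.normc (f x).
  rewrite /f1 indicE; case: (_ \in _); first by rewrite mul1r.
  by rewrite mul0r Normc.normc0 normc_ge0.
have mf1 : cmeasurable setT f1.
  have mN0C : measurable (~` N0) by exact: measurableC.
  have part (p : R[i] -> R) : (forall (b : bool) z, p (b%:R%:C%C * z) = if b then p z else 0) ->
      measurable_fun (~` N0) (fun x => p (f x)) -> measurable_fun setT (fun x => p (f1 x)).
    move=> pE /(measurable_restrictT _ mN0C); apply: eq_measurable_fun => x _.
    by rewrite patchE /f1 indicE pE.
  by split; apply: part => [[] z|]; rewrite ?mul1r ?mul0r//; case: mf0.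
have f1oo : (\int[lebT n]_(x in @torus R n) (Normc.normc (f1 x))%:E < +oo)%E.
  apply: le_lt_trans (integral_norm_le mf1 A_ge0 _) (ltry _) => t t01.
  by apply: le_trans (star_f t01); apply: le_star => x _; rewrite lee_fin.
have total_fin : {ae lebT n, forall x, torus x -> total x \is a fin_num}.
  apply: (@integrable_ae _ _ _ (lebT n) _ mT total); apply/integrableP; split.
    exact: measurable_funTS.
  by under eq_integral do rewrite gee0_abs//.
have [N4 [mN4 N40 tot]] := total_fin.
(* A set of full measure on which f is Borel, the series converges, and the
   coordinates are interior. *)
pose E := @torus R n `\` (N0 `|` N4).
have mE : measurable E by apply: measurableD => //; exact: measurableU.
have ET : E `<=` @torus R n by move=> x [].
have TE : lebT n (@torus R n `\` E) = 0%E.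
  apply/negligibleP; first exact: measurableD.
  apply: (negligibleS (A := N0 `|` N4)); last by apply: negligibleU; apply/negligibleP.
  by move=> x [xT nE]; apply: contrapT => nN; apply: nE.
have EN0 x : E x -> ~ N0 x by move=> [_ nN] ?; apply: nN; left.
have Eopen x : E x -> forall j, 0 < tnth x j < 2 * pi.
  move=> Ex; apply: contrapT => nx; apply: (EN0 x Ex); right.
  by apply: bd; split => //; exact: ET.
have Etot x : E x -> (total x < +oo)%E.
  move=> [xT nN]; rewrite -ge0_fin_numE//.
  by apply: contrapT => nt; apply: nN; right; apply: tot => /= /(_ xT).
pose S N x := \sum_(i < N) block i x.
pose D x := clim (S ^~ x).
have itot : (lebT n).-integrable E total.
  apply/integrableP; split; first exact: measurable_funTS.
  under eq_integral do rewrite gee0_abs//.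
  by rewrite -(integral_null_ext total mT mE ET TE).
have if_ : cintegrable (lebT n) E f.
  have if1 : cintegrable (lebT n) E f1.
    apply: (le_cintegrable (g := norm_of f1) mE).
    - by split; apply: measurable_funTS; case: mf1.
    - by [].
    - apply/integrableP; split.
        by apply/measurable_EFinP/measurable_funTS/measurable_normc.
      under eq_integral do rewrite gee0_abs ?lee_fin ?normc_ge0//.
      by rewrite -(integral_null_ext _ mT mE ET TE).
  by apply: (eq_cintegrable mE _ if1) => x Ex; rewrite f1E//; exact: EN0.
have coefE k : cintegral (lebT n) E (fun x => f x * character (topp k) x) =
    fourier_coef f k * (((2 * pi) ^+ n)%:C)%C.
  rewrite -(cintegral_null_ext _ mT mE ET TE) /fourier_coef.
  under [in RHS]eq_fun do rewrite -characterN.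
  rewrite mulrAC -rmorphM mulVf ?mul1r// expf_neq0// gt_eqF// mulr_gt0// pi_gt0//.
have coef0 k j : tnth k j = 0 -> fourier_coef f k * (((2 * pi) ^+ n)%:C)%C = 0.
  move=> kj; rewrite -coefE (eq_cintegral _ (g := fun x => f1 x * character (topp k) x)); last first.
    by move=> x Ex; rewrite f1E//; exact: EN0.
  rewrite -(cintegral_null_ext _ mT mE ET TE).
  apply: (mean0_torus mf1 f1oo mN0 N00 f1E (j := j)); last exact: mean0.
  by rewrite tnth_mktuple kj oppr0.
have intS k N : cintegral (lebT n) E (fun x => S N x * character (topp k) x) =
    \sum_(i < N) oapp (fun s => if `[< rho R s k >] then fourier_coef f k * (((2 * pi) ^+ n)%:C)%C else 0) 0
       (@pickle_inv (n.-tuple nat) i).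
  rewrite -(cintegral_null_ext _ mT mE ET TE).
  rewrite (eq_cintegral _ (g := fun x => \sum_(i < N) block i x * character (topp k) x)); last first.
    by move=> x _; rewrite /S mulr_suml.
  rewrite cintegral_sum//; last first.
    move=> i; apply: cintegrable_character => //; rewrite /block.
    case: pickle_inv => [s|] /=; last exact: cintegrable0.
    rewrite (funext (dyadic_blockE s f)); apply: cintegrable_sum => // l.
    by apply: cintegrableZ => //; exact: character_cintegrable.
  apply: eq_bigr => i _; rewrite /block; case: pickle_inv => [s|] /=.
    exact: cintegral_dyadic_block.
  by under eq_fun do rewrite mul0r; rewrite cintegral0.
(* From the index of the block of k on, the coefficient at k of the partial
   sums is the one of f; if k has a zero component there is no such block, and
   the coefficient is zero by the mean zero condition. *)
have coefS k : exists K, forall N, (K <= N)%N ->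
    cintegral (lebT n) E (fun x => S N x * character (topp k) x) =
    fourier_coef f k * (((2 * pi) ^+ n)%:C)%C.
  have [k0|] := pselect (forall j, tnth k j != 0); last first.
    move=> /existsNP[j /negP]; rewrite negbK => /eqP kj; exists 0%N => N _.
    rewrite intS (coef0 k j kj) big1// => i _.
    by case: pickle_inv => [s|] //=; rewrite if_same.
  exists (pickle (level k)).+1 => N KN; rewrite intS (bigD1 (Ordinal KN))//= pickleK_inv /=.
  rewrite asboolT; last exact/rhoP.
  rewrite big1 ?addr0// => i ineq; case E' : pickle_inv => [s|] //=.
  case: asboolP => // /rhoP[_ sk]; exfalso; move/eqP: ineq; apply; apply/val_inj => /=.
  by rewrite -sk; have := @pickle_invK _ (i : nat) : oapp _ _ (@pickle_inv (n.-tuple nat) i) = _; rewrite E'.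
have intD k : cintegrable (lebT n) E (fun x => D x * character (topp k) x) /\
    cintegral (lebT n) E (fun x => D x * character (topp k) x) =
    fourier_coef f k * (((2 * pi) ^+ n)%:C)%C.
  have [K SK] := coefS k.
  apply: (cdominated_limit (K := K) mE (F := fun N x => S N x * character (topp k) x) _ _ _ _ itot) => //.
  - move=> N; apply: cmeasurableM; last exact: measurable_character.
    by apply: cmeasurable_sum => i; exact: block_cmeasurable.
  - move=> x Ex; have [cR cI _ _] := cseries_cvg (Etot x Ex).
    by have [] := cvg_mulc (character (topp k) x) cR cI.
  - move=> x Ex; have [cR cI _ _] := cseries_cvg (Etot x Ex).
    by have [] := cvg_mulc (character (topp k) x) cR cI.
  - move=> N x Ex; have [_ _ + _] := cseries_cvg (Etot x Ex).
    by rewrite Normc.normcM normc_character mulr1; apply.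
pose h x := f x + (-1) * D x.
have iD : cintegrable (lebT n) E D.
  have [] := intD [tuple 0 | j < n].
  move=> + _; apply: (eq_cintegrable mE) => x _.
  rewrite (_ : topp _ = [tuple 0 | j < n]) ?character0 ?mulr1//.
  by apply: eq_from_tnth => j; rewrite !tnth_mktuple oppr0.
have ih : cintegrable (lebT n) E h by apply: cintegrableD => //; exact: cintegrableZ.
have h_perp k : cintegral (lebT n) E (fun x => h x * character k x) = 0.
  have -> : k = topp (topp k) by apply: eq_from_tnth => j; rewrite !tnth_mktuple opprK.
  move: (topp k) => {}k.
  rewrite (eq_cintegral _ (g := fun x => f x * character (topp k) x + (-1) * (D x * character (topp k) x))); last first.
    by move=> x _; rewrite /h mulrDl mulrA.
  have [iDk IDk] := intD k.
  rewrite cintegralD//; last 2 first.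
  - exact: cintegrable_character.
  - exact: cintegrableZ.
  by rewrite cintegralZ// IDk coefE mulN1r subrr.
have [N5 [mN5 N50 hN5]] := negligible_of_perp mE Eopen ih h_perp.
exists (N0 `|` N4 `|` N5); split.
- by apply: measurableU => //; exact: measurableU.
- by apply/negligibleP; [by apply: measurableU => //; exact: measurableU|];
    apply: negligibleU; first apply: negligibleU; apply/negligibleP.
- move=> x xT nN; have Ex : E x by split => // nN'; apply: nN; left.
  have [_ _ _ Dle] := cseries_cvg (Etot x Ex).
  rewrite -totalE; suff -> : f x = D x by [].
  apply: contrapT => fD; apply: nN; right; apply: hN5; split => //=.
  by apply/eqP; rewrite /h mulN1r => /eqP; rewrite subr_eq0 => /eqP.
Qed.

End representation_theorem.

(** * A rapidly decaying sampling kernel *)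

Section sampling_kernel.
Context {R : realType}.

(** The exponential of [i t]. *)
Definition cis (t : R) : R[i] := (cos t +i* sin t)%C.

Lemma cisD s t : cis (s + t) = cis s * cis t.
Proof.
rewrite /cis cosD sinD; apply/eqP; rewrite eq_complex /=.
by apply/andP; split; apply/eqP; ring.
Qed.

Lemma cis0 : cis 0 = 1.
Proof. by rewrite /cis cos0 sin0. Qed.

Lemma normc_cis t : Normc.normc (cis t) = 1.
Proof. by rewrite /cis /= cos2Dsin2 sqrtr1. Qed.

Lemma cis_natM (n : nat) t : cis (n%:R * t) = cis t ^+ n.
Proof.
elim: n => [|n IH]; first by rewrite mul0r cis0 expr0.
by rewrite -natr1 mulrDl mul1r cisD IH exprSr.
Qed.

Lemma cis_2piM (k : int) : cis (k%:~R * (2 * pi)) = 1.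
Proof.
have nat_case (n : nat) : cis (n%:R * (2 * pi)) = 1.
  by rewrite cis_natM /cis mulr_natl cos2pi sin2pi expr1n.
case: k => n; first exact: nat_case.
rewrite NegzE rmorphN mulNr; apply: (mulfI (x := cis (n.+1%:R * (2 * pi)))).
  by rewrite nat_case oner_eq0.
by rewrite -cisD subrr cis0 nat_case mulr1.
Qed.

Lemma cis_neq1 (t : R) : 0 < t < 2 * pi -> cis t != 1.
Proof.
move=> /andP[t0 t2]; apply/negP => /eqP /(congr1 (@complex.Re R)) /= /eqP.
have -> : t = (t / 2) *+ 2 by rewrite -mulr_natr; field.
rewrite cos_mulr2n cos2sin2 => /eqP H.
have : 0 < sin (t / 2) by apply: sin_gt0_pi; apply/andP; split; lra.
by move=> s0; have := exprn_gt0 2 s0; move: H; rewrite -mulr_natr; lra.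
Qed.

(** The nodes [2 pi l / L] integrate exactly the exponentials whose frequency is
    not a nonzero multiple of [L]. *)
Lemma sum_roots (L : nat) (q : int) : (0 < L)%N ->
  \sum_(l < L) cis (q%:~R * (2 * pi * (l%:R / L%:R))) =
  if (L %| q)%Z then L%:R else 0.
Proof.
move=> L0; have LR : L%:R != 0 :> R by rewrite pnatr_eq0 -lt0n.
set w := cis (q%:~R * (2 * pi / L%:R)).
have wE (l : nat) : cis (q%:~R * (2 * pi * (l%:R / L%:R))) = w ^+ l.
  by rewrite /w -cis_natM; congr cis; field.
under eq_bigr do rewrite wE.
have [/dvdzP[p qE]|ndv] := boolP (L %| q)%Z.
  have -> : w = 1.
    rewrite /w qE rmorphM /= -[RHS](cis_2piM p); congr cis.
    by rewrite -pmulrn; field.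
  by under eq_bigr do rewrite expr1n; rewrite sumr_const card_ord.
have wL : w ^+ L = 1.
  by rewrite /w -cis_natM -[RHS](cis_2piM q); congr cis; field.
have w1 : w != 1.
  have -> : w = cis ((q %% L)%Z%:~R * (2 * pi / L%:R)).
    rewrite /w {1}(divz_eq q L) rmorphD rmorphM /= mulrDl cisD.
    rewrite (_ : _ * _ * _ = (q %/ L)%Z%:~R * (2 * pi)); first by rewrite cis_2piM mul1r.
    by rewrite -pmulrn; field.
  have r0 : 0 < (q %% L)%Z.
    have Lz : L%:Z != 0 by rewrite eqz_nat -lt0n.
    rewrite lt_neqAle modz_ge0// andbT eq_sym; apply/eqP => r0.
    by move/negP: ndv; apply; apply/dvdz_mod0P.
  have rL : (q %% L)%Z < L by rewrite ltz_pmod.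
  have L0' : 0 < L%:R :> R by rewrite ltr0n.
  apply: cis_neq1; apply/andP; split.
    by rewrite mulr_gt0 ?ltr0z// divr_gt0// mulr_gt0// pi_gt0.
  rewrite mulrA ltr_pdivrMr// mulrC ltr_pM2l ?mulr_gt0 ?pi_gt0//.
  by rewrite pmulrn ltr_int.
(* The geometric sum: w is an L-th root of unity other than 1. *)
apply: (mulfI (x := w - 1)); first by rewrite subr_eq0.
by rewrite -subrX1 wL subrr mulr0.
Qed.

(** Sampling at [L] equidistant nodes and summing against the kernel [kap]
    recovers every exponential with frequency between [a] and [b], wherever the
    nodes start. *)
Definition reproduces (L : nat) (kap : R -> R[i]) (a b : int) := forall (k : int) (x y : R),
  a <= k <= b ->
  \sum_(l < L) cis (k%:~R * (x + 2 * pi * (l%:R / L%:R))) *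
     kap (y - (x + 2 * pi * (l%:R / L%:R))) = cis (k%:~R * y).

(** The kernel with frequencies from [- p] to [L - 1 - p], normalized by the number
    of nodes; it reproduces these frequencies but does not decay. *)
Definition dirichlet (L p : nat) (u : R) : R[i] :=
  (L%:R^-1) * \sum_(i < L) cis ((i%:R - p%:R) * u).

Lemma dirichlet_reproduces L p : (0 < L)%N ->
  reproduces L (dirichlet L p) (- p%:Z) (L%:Z - 1 - p%:Z).
Proof.
move=> L0 k x y /andP[k1 k2]; rewrite /dirichlet.
have LR : L%:R != 0 :> R[i] by rewrite pnatr_eq0 -lt0n.
have kp : (absz (k + p%:Z)%R < L)%N by lia.
pose i0 : 'I_L := Ordinal kp.
have i0E : (i0%:R - p%:R = k%:~R :> R).
  rewrite /= pmulrn gez0_abs; last by lia.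
  by rewrite rmorphD /= -pmulrn; ring.
under eq_bigr do rewrite mulrCA mulr_sumr.
rewrite -mulr_sumr exchange_big /=.
have term (i : 'I_L) : \sum_(l < L) cis (k%:~R * (x + 2 * pi * (l%:R / L%:R))) *
     cis ((i%:R - p%:R) * (y - (x + 2 * pi * (l%:R / L%:R)))) =
   cis (k%:~R * x + (i%:R - p%:R) * (y - x)) * (if (L %| (k + p%:Z - i%:Z)%R)%Z then L%:R else 0).
  rewrite -sum_roots// mulr_sumr; apply: eq_bigr => l _.
  rewrite -!cisD; congr cis.
  by rewrite rmorphB rmorphD /= -!pmulrn; ring.
have ki : (k + p%:Z - (i0 : nat)%:Z = 0)%R by rewrite /= gez0_abs; lia.
rewrite (bigD1 i0 isT) term ki dvdz0 big1 ?addr0; last first.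
  move=> i ii0; rewrite term; case: ifP => [dv|_]; last by rewrite mulr0.
  exfalso; move/eqP: ii0; apply; apply/val_inj => /=.
  have := ltn_ord i; move: dv => /dvdzP[z zE] iL.
  have z0 : z = 0 by nia.
  by move: zE; rewrite z0 mul0r; lia.
transitivity (L%:R^-1 * (cis (k%:~R * x + (i0%:R - p%:R) * (y - x)) * L%:R)).
  by congr (_ * _); exact: addr0.
rewrite mulrCA mulVf// mulr1; congr cis.
by rewrite i0E; ring.
Qed.

Definition mean (N : nat) (u : R) : R[i] := N%:R^-1 * \sum_(i < N) cis (i%:R * u).

(** Multiplication of a kernel by [exp (i j u)] shifts the reproduced
    frequencies by [j]; averaging over [N] shifts keeps those common to all of
    them.  Each factor [mean N] costs [N - 1] frequencies and gains a factor
    [1 / (N |u|)] of decay. *)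
Lemma mean_reproduces L kap a b N : (0 < N)%N -> reproduces L kap a b ->
  reproduces L (fun u => mean N u * kap u) (a + N%:Z - 1) b.
Proof.
move=> N0 rep k x y /andP[k1 k2]; rewrite /mean.
have NR : N%:R != 0 :> R[i] by rewrite pnatr_eq0 -lt0n.
transitivity (N%:R^-1 * \sum_(l < L) \sum_(i < N) cis (k%:~R * (x + 2 * pi * (l%:R / L%:R))) *
    (cis (i%:R * (y - (x + 2 * pi * (l%:R / L%:R)))) * kap (y - (x + 2 * pi * (l%:R / L%:R))))).
  rewrite mulr_sumr; apply: eq_bigr => l _.
  by rewrite -mulr_sumr -mulr_suml; ring.
rewrite exchange_big /=.
rewrite (eq_bigr (fun=> cis (k%:~R * y))); last first.
  move=> i _; have iN := ltn_ord i.
  transitivity (cis (i%:R * y) * \sum_(l < L) cis ((k - i%:Z)%:~R * (x + 2 * pi * (l%:R / L%:R))) *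
     kap (y - (x + 2 * pi * (l%:R / L%:R)))).
    rewrite mulr_sumr; apply: eq_bigr => l _; rewrite !mulrA -!cisD; congr (cis _ * _).
    by rewrite rmorphB /= -pmulrn; ring.
  rewrite rep; last by lia.
  by rewrite -cisD rmorphB /= -pmulrn; congr cis; ring.
by rewrite sumr_const card_ord -[X in _ * X]mulr_natl mulrA mulVf// mul1r.
Qed.

(** [D] factors of decay and a Dirichlet kernel wide enough to pay for them: the
    frequencies of absolute value below [N] survive. *)
Definition sampling_kernel (D N : nat) (u : R) : R[i] :=
  mean N u ^+ D * dirichlet ((D + 2) * N) ((D + 1) * N) u.

Lemma sampling_kernel_reproduces D N (k : int) : (0 < N)%N -> (`|k| < N)%N ->
  forall x y, \sum_(l < (D + 2) * N) cis (k%:~R * (x + 2 * pi * (l%:R / ((D + 2) * N)%:R))) *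
     sampling_kernel D N (y - (x + 2 * pi * (l%:R / ((D + 2) * N)%:R))) = cis (k%:~R * y).
Proof.
move=> N0 kN x y; rewrite /sampling_kernel.
have L0 : (0 < (D + 2) * N)%N by rewrite muln_gt0 addn2.
set L := ((D + 2) * N)%N in L0 *; set p := ((D + 1) * N)%N.
have rep d : reproduces L (fun u => mean N u ^+ d * dirichlet L p u)
    (- p%:Z + (d * N)%:Z - d%:Z) (L%:Z - 1 - p%:Z).
  elim: d => [|d IH].
    have := @dirichlet_reproduces L p L0; congr reproduces; last by lia.
    by apply/funext => u; rewrite expr0 mul1r.
  have := @mean_reproduces _ _ _ _ N N0 IH; congr reproduces; last by lia.
  by apply/funext => u; rewrite exprS mulrA.
by apply: rep; rewrite /p /L; nia.
Qed.

Lemma normc_real (x : R) : Normc.normc (x%:C)%C = `|x|.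
Proof. by rewrite /= expr0n/= addr0 sqrtr_sqr. Qed.

Lemma normc_avg (I : finType) (N : nat) (F : I -> R[i]) : (0 < N)%N -> #|I| = N ->
  (forall i, Normc.normc (F i) = 1) -> Normc.normc (N%:R^-1 * \sum_i F i) <= 1.
Proof.
move=> N0 cN F1; have NR : 0 < N%:R :> R by rewrite ltr0n.
rewrite Normc.normcM Normc.normcV -(rmorph_nat (real_complex R)) normc_real ger0_norm ?ler0n//.
rewrite mulrC ler_pdivrMr// mul1r; apply: le_trans (normc_sum_le _ _ _) _.
by rewrite (eq_bigr (fun=> 1)) ?sumr_const ?cN.
Qed.

Lemma normc_mean_le1 N u : (0 < N)%N -> Normc.normc (mean N u) <= 1.
Proof. by move=> N0; apply: normc_avg; rewrite ?card_ord// => i; exact: normc_cis. Qed.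

Lemma normc_dirichlet_le1 L p u : (0 < L)%N -> Normc.normc (dirichlet L p u) <= 1.
Proof. by move=> N0; apply: normc_avg; rewrite ?card_ord// => i; exact: normc_cis. Qed.

Lemma normc_cis_sub1 u : Normc.normc (cis u - 1) = 2 * `|sin (u / 2)|.
Proof.
rewrite /cis /= subr0.
have uE : u = (u / 2) *+ 2 by rewrite -mulr_natr; field.
rewrite -[RHS]ger0_norm ?mulr_ge0// -sqrtr_sqr; congr Num.sqrt.
rewrite exprMn real_normK ?num_real// {1 2}uE cos_mulr2n sin_mulr2n.
have := sin2cos2 (u / 2); set c := cos _; set t := sin _ => st.
have -> : (c ^+ 2 *+ 2 - 1 - 1) ^+ 2 + (c * t *+ 2) ^+ 2 =
  4 * ((1 - c ^+ 2) ^+ 2 + c ^+ 2 * t ^+ 2) by ring.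
by rewrite st; ring.
Qed.

Lemma normc_mean_sin N u : (0 < N)%N ->
  Normc.normc (mean N u) * (N%:R * `|sin (u / 2)|) <= 1.
Proof.
move=> N0; have NR : N%:R != 0 :> R[i] by rewrite pnatr_eq0 -lt0n.
have E : (mean N u * N%:R) * (cis u - 1) = cis u ^+ N - 1.
  rewrite subrX1 mulrC; congr (_ * _); rewrite /mean mulrC mulrA mulfV// mul1r.
  by apply: eq_bigr => i _; rewrite cis_natM.
have := congr1 (@Normc.normc R) E; rewrite (Normc.normcM (mean N u * N%:R)) (Normc.normcM (mean N u)) normc_cis_sub1 => E'.
have : Normc.normc (cis u ^+ N - 1) <= 2.
  rewrite -cis_natM; apply: le_trans (le_normcD _ _) _.
  by rewrite normcN normc_cis Normc.normc1.
rewrite -E' -(rmorph_nat (real_complex R)) normc_real ger0_norm ?ler0n// => H.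
have : 2 * (Normc.normc (mean N u) * (N%:R * `|sin (u / 2)|)) <= 2.
  by apply: le_trans H; rewrite le_eqVlt; apply/orP; left; apply/eqP; ring.
by rewrite -[leRHS]mulr1 ler_pM2l.
Qed.

(** A lower bound of Jordan type.  The constant [cos 1 / 2] is not optimal but is
    easily justified by the mean value theorem. *)
Lemma sin_ge_linear (v : R) : 0 <= v <= pi / 2 -> cos 1 / 2 * v <= sin v.
Proof.
move=> /andP[v0 v2]; have c1 := @cos1_gt0 R.
have p2 := @pi_ge2 R; have /andP[_ p4] := (@pihalf_02_cos_pihalf R).1.
have sin_small (w : R) : 0 <= w <= 1 -> cos 1 * w <= sin w.
  move=> /andP[w0 w1]; have [->|wN0] := eqVneq w 0; first by rewrite mulr0 sin0.
  have wp : 0 < w by rewrite lt_neqAle eq_sym wN0.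
  have [x] := @MVT R sin cos 0 w wp (fun x _ => is_derive_sin x)
    (continuous_subspaceT (@continuous_sin R)).
  rewrite in_itv/= sin0 !subr0 => /andP[x0 xw] ->; apply: ler_wpM2r => //.
  by rewrite leNgt; apply/negP; rewrite ltr_cos ?in_itv/=; [lra|apply/andP; split; lra..].
have [v1|v1] := leP v 1.
  apply: le_trans (sin_small v _); last by rewrite v0.
  by apply: ler_wpM2r => //; lra.
have s1 := sin_small 1; rewrite ler01 lexx mulr1 in s1.
apply: (@le_trans _ _ (sin 1)).
  by apply: le_trans (s1 isT); nra.
by apply: ltW; rewrite ltr_sin ?in_itv/= => //; apply/andP; split; lra.
Qed.

Lemma sin_ge_away (w v : R) : 0 <= w -> w <= v <= pi - w -> cos 1 / 2 * w <= sin v.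
Proof.
move=> w0 /andP[wv vw]; have c1 := @cos1_gt0 R.
have [v2|v2] := leP v (pi / 2).
  apply: le_trans (sin_ge_linear _); last by apply/andP; split; lra.
  by apply: ler_wpM2l; lra.
rewrite -[sin v]opprK -sinN -sinDpi (addrC _ pi).
apply: le_trans (sin_ge_linear _); last by apply/andP; split; lra.
by apply: ler_wpM2l; lra.
Qed.

(** The distance to 0 of the node [l] on the circle with [L] nodes; beyond [L] the
    value is the one for which the sums over nodes stay bounded. *)
Definition circular_dist (L l : nat) := if (l < L)%N then minn l (L - l) else l.

(** Large enough for the nodes at circular distance at most 1, where the kernel is
    merely bounded by 1, and for the others, where it decays. *)
Definition kernel_const (D : nat) : R := 2 + 3 * (D + 2)%:R / (cos 1 / 2 * pi).

Lemma kernel_const_ge2 D : 2 <= kernel_const D.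
Proof.
rewrite lerDl divr_ge0// ?mulr_ge0 ?ler0n ?pi_ge0//.
by have := @cos1_gt0 R; lra.
Qed.

(** The point [z] accounts for the position inside a cell; it moves the distance
    to a node by at most one step, which is why nodes at distance 0 and 1 are
    treated by the trivial bound. *)
Lemma normc_sampling_kernel D N (l : nat) (z : R) : (0 < N)%N ->
  (l < (D + 2) * N)%N -> `|z| <= 2 * pi / ((D + 2) * N)%:R ->
  Normc.normc (sampling_kernel D N (z - 2 * pi * (l%:R / ((D + 2) * N)%:R))) <=
  (kernel_const D / (1 + (circular_dist ((D + 2) * N) l)%:R)) ^+ D.
Proof.
move=> N0; set L := ((D + 2) * N)%N; rewrite /circular_dist => lL zL; rewrite lL.
have L0 : (0 < L)%N by apply: leq_ltn_trans lL.
have LR : 0 < L%:R :> R by rewrite ltr0n.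
set d := minn l (L - l); set u := z - _.
rewrite /sampling_kernel Normc.normcM.
have normcX (w : R[i]) k : Normc.normc (w ^+ k) = Normc.normc w ^+ k.
  by elim: k => [|k IH]; rewrite ?expr0 ?Normc.normc1// !exprS Normc.normcM IH.
apply: (@le_trans _ _ (Normc.normc (mean N u) ^+ D)).
  rewrite normcX -[leRHS]mulr1; apply: ler_wpM2l; first by rewrite exprn_ge0// normc_ge0.
  exact: normc_dirichlet_le1.
have K2 := kernel_const_ge2 D; have d0 : 0 < 1 + d%:R :> R by rewrite ltr_pwDl.
have c1 := @cos1_gt0 R; have pi0 := pi_gt0 R.
apply: lerXn2r; rewrite ?nnegrE ?normc_ge0 ?divr_ge0 ?(ltW d0)//; first by lra.
rewrite ler_pdivlMr//.
have [d1|d1] := leqP d 1.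
  apply: le_trans K2; apply: (@le_trans _ _ (1 * (1 + d%:R))).
    by apply: ler_wpM2r; [exact: ltW|exact: normc_mean_le1].
  have : d%:R <= 1 :> R by rewrite -[leRHS]/(1%:R) ler_nat.
  by lra.
pose w : R := pi * (d%:R - 1) / L%:R.
have d2 : 2 <= d%:R :> R by rewrite ler_nat.
have w0 : 0 <= w by rewrite /w divr_ge0 ?(ltW LR)// mulr_ge0 ?(ltW pi0)//; lra.
have dl : (d <= l)%N by rewrite geq_minl.
have dLl : (d + l <= L)%N.
  by move: lL; rewrite /d; move: L {w w0 zL L0 LR u d d0 d1 d2 dl} => L; lia.
have dlR : d%:R <= l%:R :> R by rewrite ler_nat.
have dLlR : d%:R + l%:R <= L%:R :> R by rewrite -natrD ler_nat.
have sw : cos 1 / 2 * w <= `|sin (u / 2)|.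
  rewrite -normrN -sinN; apply: le_trans (ler_norm _); apply: sin_ge_away => //.
  move: zL; rewrite ler_norml => /andP[z1 z2].
  have -> : - (u / 2) = pi * l%:R / L%:R - z / 2 by rewrite /u; field; exact: lt0r_neq0.
  have e1 : w + pi / L%:R = pi * d%:R / L%:R by rewrite /w; field; exact: lt0r_neq0.
  have e2 : (pi : R) * d%:R / L%:R <= pi * l%:R / L%:R.
    by rewrite ler_pM2r ?invr_gt0// ler_pM2l.
  have e3 : (pi : R) * d%:R / L%:R + pi * l%:R / L%:R <= pi.
    by rewrite -mulrDl -mulrDr ler_pdivrMr// ler_pM2l.
  have e4 : 2 * (pi : R) / L%:R = 2 * (pi / L%:R) by rewrite mulrA.
  by apply/andP; split; lra.
have H := normc_mean_sin u N0.
have NR : 0 < N%:R :> R by rewrite ltr0n.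
have M0 := normc_ge0 (mean N u).
have H2 : Normc.normc (mean N u) * (N%:R * (cos 1 / 2 * w)) <= 1.
  by apply: le_trans H; apply: ler_wpM2l => //; apply: ler_wpM2l => //; exact: ltW.
have D0 : 0 < (D + 2)%:R :> R by rewrite ltr0n addn2.
have E : N%:R * (cos 1 / 2 * w) = cos 1 / 2 * pi * (d%:R - 1) / (D + 2)%:R.
  rewrite /w /L natrM; field; apply/andP; split; exact: lt0r_neq0.
pose q : R := cos 1 / 2 * pi / (D + 2)%:R.
have q0 : 0 < q by rewrite /q divr_gt0// mulr_gt0//; lra.
have H3 : Normc.normc (mean N u) * (d%:R - 1) <= q^-1.
  rewrite -[leRHS]mul1r ler_pdivlMr//; apply: le_trans H2.
  by rewrite E /q le_eqVlt; apply/orP; left; apply/eqP; field; exact: lt0r_neq0.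
have -> : kernel_const D = 2 + 3 * q^-1.
  by rewrite /kernel_const /q invf_div mulrA.
apply: (@le_trans _ _ (3 * (Normc.normc (mean N u) * (d%:R - 1)))); last by lra.
rewrite mulrCA; apply: ler_wpM2l => //; lra.
Qed.

End sampling_kernel.

(** * A majorant of a block that is constant on cells *)

Section sampling_majorant.
Context {R : realType} (n : nat).
Implicit Types (s : n.-tuple nat) (x y t : n.-tuple R) (f : n.-tuple R -> R[i]).
Local Notation norm_of F := (fun x => (Normc.normc (F x))%:E).

(** The weights of the nodes have to absorb the factors [v ^ n], where [v] is
    proportional to the inverse square of the spread, and still be summable: this
    takes the exponent [2 n + 2]. *)
Definition decay := (2 * n + 2)%N.

Definition oversampled s (j : 'I_n) := ((decay + 2) * 2 ^ tnth s j)%N.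

Lemma oversampled_gt0 s j : (0 < oversampled s j)%N.
Proof. by rewrite muln_gt0 addn2 expn_gt0. Qed.

Definition same_cell s x y := forall j,
  Num.floor ((oversampled s j)%:R * (tnth x j / (2 * pi))) =
  Num.floor ((oversampled s j)%:R * (tnth y j / (2 * pi))).

Definition cell_sup s (F : n.-tuple R -> \bar R) x : \bar R :=
  ereal_sup [set F y | y in [set y | same_cell s y x]].

Lemma cell_sup_ge s F x : (F x <= cell_sup s F x)%E.
Proof. by apply: ereal_sup_ubound; exists x. Qed.

Lemma cell_sup_same s F x y : same_cell s x y -> cell_sup s F x = cell_sup s F y.
Proof.
move=> xy; congr ereal_sup; apply/seteqP; split => _ [z zx <-]; exists z => // j.
  by rewrite (zx j) (xy j).
by rewrite (zx j) (xy j).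
Qed.

(** A common range for the node numbers of all coordinates, so that the nodes are
    indexed by plain functions; those out of range in their coordinate get the
    weight 0. *)
Definition max_oversampled s := (\max_(j < n) oversampled s j)%N.

Definition node s (g : {ffun 'I_n -> 'I_(max_oversampled s)}) : n.-tuple R :=
  [tuple (g j)%:R / (oversampled s j)%:R | j < n].

Definition node_weight s (g : {ffun 'I_n -> 'I_(max_oversampled s)}) : R :=
  \prod_j (if (g j < oversampled s j)%N then
    (kernel_const decay / (1 + (circular_dist (oversampled s j) (g j))%:R)) ^+ decay else 0).

Lemma character_prod (k : n.-tuple int) x :
  character k x = \prod_j cis ((tnth k j)%:~R * tnth x j).
Proof.
rewrite /character -/(cis _); elim/big_rec2 : _ => [|j y z _ <-]; first exact: cis0.
exact: cisD.
Qed.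

Lemma same_cell_dist s x y j : same_cell s x y ->
  `|tnth x j - tnth y j| <= 2 * pi / (oversampled s j)%:R.
Proof.
move=> /(_ j); set L := (oversampled s j)%:R => xy.
have L0 : 0 < L by rewrite ltr0n oversampled_gt0.
have p0 : 0 < 2 * pi :> R by rewrite mulr_gt0// pi_gt0.
have := floor_itv (L * (tnth x j / (2 * pi))); have := floor_itv (L * (tnth y j / (2 * pi))).
rewrite xy; set q := (_%:~R); rewrite intrD mulr1z -/q => /andP[y1 y2] /andP[x1 x2].
have rescale (u v p l : R) : p != 0 -> l != 0 ->
    u - v = (l * (u / (2 * p)) - l * (v / (2 * p))) * (2 * p / l).
  by move=> pN lN; field; rewrite pN lN.
rewrite (rescale _ _ pi L) ?lt0r_neq0 ?pi_gt0//.
rewrite normrM [X in _ * X]ger0_norm; last by rewrite divr_ge0// ltW.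
rewrite -[leRHS]mul1r; apply: ler_wpM2r; first by rewrite divr_ge0// ltW.
by rewrite ler_norml; apply/andP; split; lra.
Qed.

(** The one-variable sampling formula at the nodes starting from [x], applied in
    each variable; the product of the formulas is expanded into a sum over the
    multi-indices [g]. *)
Lemma sampling_bound s f x y : same_cell s y x ->
  Normc.normc (dyadic_block s f y) <=
  \sum_(g : {ffun 'I_n -> 'I_(max_oversampled s)})
    node_weight g * Normc.normc (dyadic_block s f (tadd x (node g))).
Proof.
move=> yx.
pose kap j (l : nat) : R[i] := if (l < oversampled s j)%N then
  sampling_kernel decay (2 ^ tnth s j) (tnth y j - (tnth x j + 2 * pi * (l%:R / (oversampled s j)%:R))) else 0.
have expand k : rho R s k -> character k y =
    \sum_(g : {ffun 'I_n -> 'I_(max_oversampled s)})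
      (\prod_j kap j (g j)) * character k (tadd x (node g)).
  move=> sk; rewrite character_prod.
  have one j : cis ((tnth k j)%:~R * tnth y j) = \sum_(l < max_oversampled s)
      (cis ((tnth k j)%:~R * (tnth x j + 2 * pi * (l%:R / (oversampled s j)%:R))) * kap j l).
    rewrite -(@sampling_kernel_reproduces R decay (2 ^ tnth s j) (tnth k j) _ _ (tnth x j)); last 2 first.
    - by rewrite expn_gt0.
    - exact: rho_lt.
    rewrite -/(oversampled s j).
    have LM : (oversampled s j <= max_oversampled s)%N by exact: (@leq_bigmax _ (oversampled s)).
    rewrite (big_ord_widen _ (fun l : nat => cis ((tnth k j)%:~R * (tnth x j + 2 * pi * (l%:R / (oversampled s j)%:R))) *
       sampling_kernel decay (2 ^ tnth s j) (tnth y j - (tnth x j + 2 * pi * (l%:R / (oversampled s j)%:R)))) LM) big_mkcond /=.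
    apply: eq_bigr => l _; rewrite /kap; case: ifP => // _.
    by rewrite mulr0.
  rewrite (eq_bigr _ (fun j _ => one j)) bigA_distr_bigA /=; apply: eq_bigr => g _.
  rewrite big_split /= mulrC character_prod; congr (_ * _); apply: eq_bigr => j _.
  by rewrite !tnth_mktuple.
have -> : dyadic_block s f y = \sum_(g : {ffun 'I_n -> 'I_(max_oversampled s)})
    (\prod_j kap j (g j)) * dyadic_block s f (tadd x (node g)).
  rewrite dyadic_blockE; under [RHS]eq_bigr do rewrite dyadic_blockE mulr_sumr.
  rewrite exchange_big /= big_seq [RHS]big_seq; apply: eq_bigr => k.
  rewrite in_fset_set; last exact: finite_rho.
  move=> /set_mem /expand ->; rewrite mulr_sumr; apply: eq_bigr => g _.
  by rewrite mulrCA.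
apply: le_trans (normc_sum_le _ _ _) _; apply: ler_sum => g _.
rewrite Normc.normcM; apply: ler_wpM2r; first exact: normc_ge0.
rewrite (big_morph (@Normc.normc R) (@Normc.normcM R) (@Normc.normc1 R)) /node_weight.
apply: ler_prod => j _; rewrite normc_ge0 /= /kap; case: ifP => [gL|_]; last by rewrite Normc.normc0.
rewrite opprD addrA; apply: normc_sampling_kernel => //; first by rewrite expn_gt0.
exact: same_cell_dist.
Qed.

Lemma node_unit s (g : {ffun 'I_n -> 'I_(max_oversampled s)}) j :
  (g j < oversampled s j)%N -> tnth (node g) j \in `[0, 1].
Proof.
move=> gL; rewrite tnth_mktuple in_itv/= divr_ge0//=.
by rewrite ler_pdivrMr ?ltr0n ?oversampled_gt0// mul1r ler_nat ltnW.
Qed.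

(** The size by which node weights are measured: it is summable to the power
    [-2]. *)
Definition node_spread s (g : {ffun 'I_n -> 'I_(max_oversampled s)}) : R :=
  \prod_j (1 + (circular_dist (oversampled s j) (g j))%:R).

Lemma node_spread_gt0 s (g : {ffun 'I_n -> 'I_(max_oversampled s)}) : 0 < node_spread g.
Proof. by apply: prodr_gt0 => j _; rewrite ltr_pwDl. Qed.

Lemma sum_inv_sqr_le (M : nat) : \sum_(l < M) ((1 + l%:R) ^+ 2)^-1 <= 2 :> R.
Proof.
suff H : \sum_(l < M.+1) ((1 + l%:R) ^+ 2)^-1 <= 2 - (M.+1%:R)^-1 :> R.
  case: M H => [|M] H; first by rewrite big_ord0.
  apply: (@le_trans _ _ (2 - M.+2%:R^-1)); last by rewrite gerBl invr_ge0.
  by apply: le_trans H; rewrite [leRHS]big_ord_recr /= lerDl invr_ge0 exprn_ge0// addr_ge0.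
elim: M => [|M IH]; first by rewrite big_ord1 /= addr0 expr1n invr1; lra.
rewrite big_ord_recr /=; apply: le_trans (lerD IH (lexx _)) _.
rewrite nat1r; set x := (M.+2%:R : R).
have xE : M.+1%:R = x - 1 :> R by rewrite /x -[M.+2]addn1 natrD addrK.
have x2 : 2 <= x by rewrite /x ler_nat.
rewrite xE -subr_ge0.
have -> : 2 - x^-1 - (2 - (x - 1)^-1 + (x ^+ 2)^-1) = ((x - 1) * x ^+ 2)^-1.
  by field; apply/andP; split; apply: lt0r_neq0; lra.
by rewrite invr_ge0 mulr_ge0// ?exprn_ge0//; lra.
Qed.

Lemma sum_circular_le (L M : nat) : (0 < L <= M)%N ->
  \sum_(l < M) ((1 + (circular_dist L l)%:R) ^+ 2)^-1 <= 4 :> R.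
Proof.
move=> /andP[L0 LM].
have pos (k : nat) : 0 <= ((1 + k%:R) ^+ 2)^-1 :> R by rewrite invr_ge0 exprn_ge0// addr_ge0.
apply: (@le_trans _ _ (\sum_(l < M) (((1 + l%:R) ^+ 2)^-1 + if (l < L)%N then ((1 + (L - l)%:R) ^+ 2)^-1 else 0))).
  apply: ler_sum => l _; rewrite /circular_dist; case: ifP => _; last by rewrite addr0.
  rewrite /minn; case: ifP => _; first by rewrite lerDl.
  by rewrite lerDr.
rewrite big_split /= -big_mkcond /= -(big_ord_widen _ (fun l => ((1 + (L - l)%:R) ^+ 2)^-1) LM).
have -> : 4 = 2 + 2 :> R by rewrite -natrD.
apply: lerD; first exact: sum_inv_sqr_le.
rewrite (reindex_inj rev_ord_inj) /=.
apply: le_trans (sum_inv_sqr_le L); apply: ler_sum => l _.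
have l1 := ltn_ord l; rewrite subKn//.
rewrite lef_pV2 ?posrE ?exprn_gt0 ?ltr_pwDl//.
by apply: lerXn2r; rewrite ?nnegrE ?addr_ge0// lerD2l ler_nat.
Qed.

Lemma sum_spread_le s :
  \sum_(g : {ffun 'I_n -> 'I_(max_oversampled s)}) (node_spread g ^+ 2)^-1 <= 4 ^+ n.
Proof.
rewrite (eq_bigr (fun g : {ffun 'I_n -> 'I_(max_oversampled s)} =>
  \prod_j ((1 + (circular_dist (oversampled s j) (g j))%:R) ^+ 2)^-1)); last first.
  by move=> g _; rewrite prodfV prodrXl.
rewrite -(bigA_distr_bigA (fun j (l : 'I_(max_oversampled s)) =>
  ((1 + (circular_dist (oversampled s j) l)%:R) ^+ 2)^-1)) /=.
rewrite -[X in _ ^+ X](card_ord n) -prodr_const; apply: ler_prod => j _.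
rewrite sumr_ge0 /=; last by move=> l _; rewrite invr_ge0 exprn_ge0// addr_ge0.
apply: sum_circular_le; rewrite oversampled_gt0 /=.
exact: (@leq_bigmax _ (oversampled s)).
Qed.

Lemma node_weight_le s (g : {ffun 'I_n -> 'I_(max_oversampled s)}) :
  0 <= node_weight g <= (kernel_const decay ^+ decay) ^+ n / node_spread g ^+ decay.
Proof.
have K2 := @kernel_const_ge2 R decay.
have K0 : 0 <= kernel_const decay :> R by lra.
have cd0 j : 0 <= kernel_const decay / (1 + (circular_dist (oversampled s j) (g j))%:R) :> R.
  by rewrite divr_ge0// addr_ge0.
apply/andP; split; first by apply: prodr_ge0 => j _; case: ifP => // _; rewrite exprn_ge0.
rewrite /node_spread -prodrXl -[X in (_ ^+ _) ^+ X](card_ord n) -prodr_const -prodf_div.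
apply: ler_prod => j _; case: ifP => _.
  by rewrite exprn_ge0//= expr_div_n.
by rewrite lexx -expr_div_n exprn_ge0.
Qed.

Section majorant.
Variables (phi : 'I_n -> R -> R) (s : n.-tuple nat) (F : n.-tuple R -> R[i]) (A : R).
Hypothesis phi_Phi : forall j, Phi_function (phi j).
Hypothesis A_ge0 : 0 <= A.
Hypothesis star_F : forall t, (forall j, 0 < tnth t j <= 1) ->
  (star (norm_of F) t <= (A * \prod_j (phi j (tnth t j))^-1)%:E)%E.
Hypothesis F_periodic : forall x j, F (upd x j (tnth x j + 2 * pi)) = F x.
Hypothesis F_sampling : forall x y, same_cell s y x -> Normc.normc (F y) <=
  \sum_(g : {ffun 'I_n -> 'I_(max_oversampled s)}) node_weight g * Normc.normc (F (tadd x (node g))).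

(** Independent of the block and of the function, which is what the final constant
    requires. *)
Definition majorant_const : R :=
  (decay + 2)%:R ^+ n * ((kernel_const decay ^+ decay) ^+ n * (4 ^+ n.+1) ^+ n * 4 ^+ n).

Lemma majorant_const_gt0 : 0 < majorant_const.
Proof.
have K2 := @kernel_const_ge2 R decay.
have K0 : 0 < kernel_const decay :> R by lra.
by rewrite !mulr_gt0 ?exprn_gt0// ltr0n addn2.
Qed.

(** Weights for [star_esum], with sum at most 1/2. *)
Let v (g : {ffun 'I_n -> 'I_(max_oversampled s)}) : R := (2 * 4 ^+ n)^-1 / node_spread g ^+ 2.

Let v_gt0 g : 0 < v g.
Proof. by rewrite divr_gt0// ?invr_gt0 ?mulr_gt0 ?exprn_gt0 ?node_spread_gt0. Qed.

Let esum_fin (a : {ffun 'I_n -> 'I_(max_oversampled s)} -> R) : (forall g, 0 <= a g) ->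
  (\esum_(g in [set: {ffun 'I_n -> 'I_(max_oversampled s)}]) (a g)%:E)%E = (\sum_g a g)%:E.
Proof.
move=> a0; rewrite esum_fset; [|exact: finite_finset|by move=> g _; rewrite lee_fin].
rewrite -sumEFin [RHS]fsbig_seq ?index_enum_uniq//; apply: eq_fsbigl.
by apply/seteqP; split => g //= _; exact: mem_index_enum.
Qed.

Let v_sum : (\esum_(g in [set: {ffun 'I_n -> 'I_(max_oversampled s)}]) (v g)%:E < 1)%E.
Proof.
rewrite esum_fin; last by move=> g; exact: ltW.
rewrite lte_fin -mulr_sumr; apply: (@le_lt_trans _ _ 2^-1); last by lra.
have p4 : 0 < 2 * 4 ^+ n :> R by rewrite mulr_gt0// exprn_gt0.
rewrite ler_pdivrMl// [leRHS](_ : _ = 4 ^+ n); first exact: sum_spread_le.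
by rewrite mulrC mulKf.
Qed.

Let v_le1 g : v g <= 1.
Proof.
rewrite -lee_fin; apply: le_trans (ltW v_sum); apply: esum_term => h.
by rewrite lee_fin ltW.
Qed.

(** One node: the translate costs a factor 2 in [t], the weight [v] a factor [v],
    and both are taken out of [phi] by concavity. *)
Let star_node t g : (forall j, 0 < tnth t j <= 1) ->
  (star (fun x => (node_weight g)%:E * (Normc.normc (F (tadd x (node g))))%:E) (tscale (v g) t) <=
   (node_weight g * (A * \prod_j (phi j (tnth t j))^-1 * (2 / v g) ^+ n))%:E)%E.
Proof.
move=> t01; have /andP[w0 _] := node_weight_le g.
have phi0 j : 0 < phi j (tnth t j) by apply: Phi_gt0.
have vg := v_gt0 g.
have [w00|wN0] := eqVneq (node_weight g) 0.
  rewrite w00 mul0r; apply: le_trans (le_star (G := fun x => if `[< (set0 : set (n.-tuple R)) x >] then +oo%E else 0%E) _ _) _.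
    by move=> x _; rewrite mul0e; case: asboolP.
  have tp j : 0 < tnth (tscale (v g) t) j.
    by rewrite tnth_tscale mulr_gt0//; have /andP[] := t01 j.
  by rewrite (star_null tp measurable0 (measure0 (@lebesgue_tuple R n))).
have wpos : 0 < node_weight g by rewrite lt_neqAle eq_sym wN0.
apply: le_trans (star_scale _ _ wpos) _; rewrite EFinM; apply: lee_wpmul2l; first by rewrite lee_fin.
have gL j : (g j < oversampled s j)%N.
  by apply: contraNT wN0 => gj; rewrite /node_weight (bigD1 j)//= (negbTE gj) mul0r.
apply: le_trans (star_shift _ (F := norm_of F) _ _) _.
- by move=> j; exact: node_unit.
- by move=> x j; rewrite F_periodic.
have u01 j : 0 < 2^-1 * (v g * tnth t j) <= 1.
  have /andP[tj0 tj1] := t01 j; have vt : 0 < v g * tnth t j by rewrite mulr_gt0.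
  have : v g * tnth t j <= 1 * 1 by apply: ler_pM => //; exact: ltW.
  by move=> ?; apply/andP; split; lra.
apply: le_trans (star_F _) _; first by move=> j; rewrite !tnth_tscale.
rewrite lee_fin -mulrA; apply: ler_wpM2l => //.
rewrite -[X in _ ^+ X](card_ord n) -prodr_const -big_split /=; apply: ler_prod => j _.
have /andP[tj0 tj1] := t01 j; have /andP[uj0 uj1] := u01 j.
rewrite !tnth_tscale invr_ge0 (ltW (Phi_gt0 (phi_Phi j) (u01 j))) /=.
rewrite -[2 / v g]invf_div -invfM lef_pV2 ?posrE; last 2 first.
- exact: Phi_gt0.
- by rewrite mulr_gt0// divr_gt0.
rewrite mulrC [in leRHS]mulrA [2^-1 * _]mulrC; apply: Phi_scale => //.
  by rewrite divr_ge0 ?(ltW vg)//= ler_pdivrMr// mul1r; have := v_le1 g; lra.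
by rewrite (ltW tj0).
Qed.

(** The cell supremum is constant on cells, so [star] does not change below the
    side of the cells ([star_cell]); above it, the sampling bound compares it with
    translates of [F]. *)
Lemma star_cell_sup t : (forall j, 0 < tnth t j <= 1) ->
  (star (cell_sup s (norm_of F)) t <=
   (majorant_const * A * \prod_j (phi j (Num.max (tnth t j) (2 ^- tnth s j)))^-1)%:E)%E.
Proof.
move=> t01.
have tpos j : 0 < tnth t j by have /andP[] := t01 j.
apply: le_trans (star_cell (L := oversampled s) _ tpos _) _.
- by move=> j; exact: oversampled_gt0.
- by move=> x y; exact: cell_sup_same.
set t' := [tuple _ | j < n].
have LR j : 1 <= (oversampled s j)%:R :> R by rewrite -[leLHS]/(1%:R) ler_nat oversampled_gt0.
have t'01 j : 0 < tnth t' j <= 1.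
  rewrite tnth_mktuple lt_max tpos ge_max; have /andP[_ ->] := t01 j.
  by rewrite /= invf_le1// (lt_le_trans ltr01 (LR j)).
have t'pos j : 0 < tnth t' j by have /andP[] := t'01 j.
have w0 g : 0 <= @node_weight s g by have /andP[] := node_weight_le g.
apply: le_trans (star_esum (Fi := fun g x => ((node_weight g)%:E * (Normc.normc (F (tadd x (node g))))%:E)%E)
   t'pos v_gt0 v_sum _ _) _.
- by move=> g x; rewrite mule_ge0// lee_fin ?normc_ge0.
- move=> x _; apply: ge_ereal_sup => _ [y yx <-].
  under eq_esum do rewrite -EFinM.
  rewrite esum_fin; last by move=> g; rewrite mulr_ge0// normc_ge0.
  by rewrite lee_fin; exact: F_sampling.
have phi'0 j : 0 < phi j (tnth t' j) by exact: Phi_gt0.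
have P0 : 0 <= \prod_j (phi j (tnth t' j))^-1 by apply: prodr_ge0 => j _; rewrite invr_ge0 ltW.
pose Kc : R := (kernel_const decay ^+ decay) ^+ n.
have K2 := @kernel_const_ge2 R decay.
have Kc0 : 0 <= Kc by rewrite !exprn_ge0//; lra.
pose b (g : {ffun 'I_n -> 'I_(max_oversampled s)}) : R :=
  (A * \prod_j (phi j (tnth t' j))^-1 * (Kc * (4 ^+ n.+1) ^+ n)) * (node_spread g ^+ 2)^-1.
apply: (@le_trans _ _ (\esum_(g in [set: {ffun 'I_n -> 'I_(max_oversampled s)}]) (b g)%:E)%E).
  apply: le_esum => g _; apply: le_trans (star_node g t'01) _; rewrite lee_fin /b.
  have S0 := node_spread_gt0 g; set S := node_spread g in S0 *.
  have SN := lt0r_neq0 S0.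
  have vE : 2 / v g = 4 ^+ n.+1 * S ^+ 2.
    have gen (q u : R) : q != 0 -> u != 0 -> 2 / ((2 * q)^-1 / u ^+ 2) = 4 * q * u ^+ 2.
      by move=> qN uN; field; rewrite qN uN.
    by rewrite /v -/S gen ?expf_neq0// (exprS 4 n).
  have /andP[_ wle] := node_weight_le g.
  apply: (@le_trans _ _ (Kc / S ^+ decay * (A * \prod_j (phi j (tnth t' j))^-1 * (2 / v g) ^+ n))).
    apply: ler_wpM2r => //; rewrite mulr_ge0 ?mulr_ge0// exprn_ge0// vE mulr_ge0// exprn_ge0// ltW//.
  rewrite vE exprMn le_eqVlt; apply/orP; left; apply/eqP.
  rewrite /decay exprD -[(S ^+ 2) ^+ n]exprM.
  have gen (k q u a1 b1 c : R) : q != 0 -> u != 0 ->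
      k / (q * u) * (a1 * b1 * (c * q)) = a1 * b1 * (k * c) / u.
    by move=> qN uN; field; rewrite qN uN.
  by apply: gen; rewrite expf_neq0.
rewrite esum_fin; last first.
  move=> g; have S0 := ltW (node_spread_gt0 g); rewrite /b.
  apply: mulr_ge0; last by rewrite invr_ge0 exprn_ge0.
  by rewrite mulr_ge0// mulr_ge0// !exprn_ge0.
rewrite lee_fin /b -mulr_sumr.
apply: (@le_trans _ _ (A * \prod_j (phi j (tnth t' j))^-1 * (Kc * (4 ^+ n.+1) ^+ n) * 4 ^+ n)).
  by apply: ler_wpM2l; [rewrite mulr_ge0// mulr_ge0// !exprn_ge0|exact: sum_spread_le].
have -> : majorant_const * A * \prod_j (phi j (Num.max (tnth t j) (2 ^- tnth s j)))^-1 =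
  A * ((decay + 2)%:R ^+ n * \prod_j (phi j (Num.max (tnth t j) (2 ^- tnth s j)))^-1) *
    (Kc * (4 ^+ n.+1) ^+ n) * 4 ^+ n.
  by rewrite /majorant_const -/Kc; ring.
apply: ler_wpM2r; first by rewrite exprn_ge0.
apply: ler_wpM2r; first by rewrite mulr_ge0// exprn_ge0// exprn_ge0.
apply: ler_wpM2l => //.
rewrite -[X in _ ^+ X](card_ord n) -prodr_const -big_split /=; apply: ler_prod => j _.
rewrite invr_ge0 ltW//=.
have d0 : 0 < (decay + 2)%:R :> R by rewrite ltr0n addn2.
set m := Num.max _ (2 ^- _).
have m01 : 0 < m <= 1.
  by rewrite /m lt_max tpos ge_max /=; have /andP[_ ->] := t01 j; have /andP[_ ->] := @half_pow_range R (tnth s j).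
have pm : 0 < phi j m by exact: Phi_gt0.
rewrite -[(decay + 2)%:R]invrK -invfM lef_pV2 ?posrE ?mulr_gt0 ?invr_gt0//.
have d1 : 0 <= ((decay + 2)%:R^-1 : R) <= 1.
  by rewrite invr_ge0 ler0n invf_le1// -[leLHS]/(1%:R) ler_nat addn2.
apply: le_trans (@Phi_scale _ _ (phi_Phi j) _ m d1 _) _; first by have /andP[m0 ->] := m01; rewrite ltW.
have /andP[d10 d11] := d1; have /andP[m0 m1] := m01.
apply: Phi_mono => //; [by rewrite mulr_ge0// ltW| |by have /andP[] := t'01 j].
rewrite tnth_mktuple /m maxr_pMr// ge_max !le_max; apply/andP; split; apply/orP.
  by left; rewrite ler_piMl// ltW.
by right; rewrite /oversampled natrM natrX invfM.
Qed.

End majorant.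

End sampling_majorant.

(** * The embedding *)

Section embedding.
Context {R : realType}.
Local Notation norm_of F := (fun x => (Normc.normc (F x))%:E).

Lemma dyadic_block_periodic n (s : n.-tuple nat) (f : n.-tuple R -> R[i]) x j :
  dyadic_block s f (upd x j (tnth x j + 2 * pi)) = dyadic_block s f x.
Proof.
have character_periodic k : character k (upd x j (tnth x j + 2 * pi)) = character k x.
  rewrite -[LHS]/(cis _) -[RHS]/(cis _).
  rewrite (bigD1 j)//= [in RHS](bigD1 j)//= /upd tnth_mktuple eqxx mulrDr.
  under eq_bigr => i /negbTE ij do rewrite tnth_mktuple ij.
  by rewrite addrAC cisD cis_2piM mulr1.
by rewrite /dyadic_block; under eq_fsbigr do rewrite character_periodic.
Qed.

(** Also for the value that the norm takes outside of the space. *)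
Lemma aniso_norm_ge0 n (X : 'I_n -> symmetric_space R) (f : n.-tuple R -> R[i]) :
  (0 <= aniso_norm X f)%E.
Proof.
have nonneg m (Y : 'I_m -> symmetric_space R) F : (forall t, 0 <= F t)%E ->
    (0 <= mixed_norm (0 : R)%R (fun j => ss_enorm (Y j)) F)%E.
  elim: m Y F => [|m IH] Y F F0; first by rewrite mixed_norm0.
  rewrite mixed_norm_cons; apply: IH => t; rewrite /ss_enorm.
  by case: asboolP => // -[_ mem]; rewrite lee_fin; exact: ss_norm_ge0.
apply: nonneg => t; rewrite iterated_rearrangementE.
by apply: star_ge0 => x _; rewrite lee_fin normc_ge0.
Qed.

Lemma star_aniso_norm n (X : 'I_n -> symmetric_space R) (phi : 'I_n -> R -> R)
    (f : n.-tuple R -> R[i]) (A : R) (t : n.-tuple R) :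
  (forall j, fundamental_function (X j) (phi j)) ->
  (forall j, Phi_function (phi j)) -> (forall j, 0 < tnth t j <= 1) ->
  (aniso_norm X f <= A%:E)%E ->
  (star (norm_of f) t <= (A * \prod_j (phi j (tnth t j))^-1)%:E)%E.
Proof.
move=> Xphi phiP t01; rewrite /aniso_norm.
rewrite (_ : iterated_rearrangement f = star (norm_of f)); last first.
  by apply/funext => u; rewrite iterated_rearrangementE.
apply: star_weak_type => //.
- by move=> j; exact: Phi_gt0.
- by move=> x; rewrite lee_fin normc_ge0.
Qed.

Lemma esum_option (T : countType) (a : option T -> \bar R) : (forall i, 0 <= a i)%E ->
  (\esum_(i in [set: option T]) a i = a None + \esum_(i in [set: T]) a (Some i))%E.
Proof.
move=> a0; rewrite (esumID [set None])//; congr (_ + _)%E.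
  by rewrite setTI esum_set1.
rewrite setTI; apply: (reindex_esum _ _ some) => //.
split; [by move=> ? _ | by move=> ? ? _ _ [] |].
by move=> [i|] //= _; exists i.
Qed.

(** Weights for [star_esum], adapted to the dyadic box [k] of the point: their sum
    over [s] is at most 1/4. *)
Definition block_weight n (rho : R) (k s : n.-tuple nat) : R :=
  (4 * (2 / (1 - rho)) ^+ n)^-1 * geom_ker rho k s.

Definition expansion_const n (rho : R) : R :=
  majorant_const n * (2 * (4 * (2 / (1 - rho)) ^+ n)) ^+ n.

Lemma block_weight_gt0 n rho (k s : n.-tuple nat) : 0 < rho < 1 -> 0 < block_weight rho k s.
Proof.
move=> /andP[r0 r1]; rewrite mulr_gt0 ?geom_ker_gt0// invr_gt0 mulr_gt0// exprn_gt0//.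
by rewrite divr_gt0// subr_gt0.
Qed.

Lemma expansion_const_gt0 n (rho : R) : 0 < rho < 1 -> 0 < expansion_const n rho.
Proof.
move=> /andP[r0 r1]; rewrite mulr_gt0 ?majorant_const_gt0// exprn_gt0// mulr_gt0// mulr_gt0//.
by rewrite exprn_gt0// divr_gt0// subr_gt0.
Qed.

Lemma block_weight_sum n rho (k : n.-tuple nat) : 0 < rho < 1 ->
  (\esum_(s in [set: n.-tuple nat]) (block_weight rho k s)%:E <= (4^-1)%:E)%E.
Proof.
move=> rho01; have /andP[r0 r1] := rho01.
have d0 : 0 < (2 / (1 - rho)) ^+ n :> R by rewrite exprn_gt0// divr_gt0// subr_gt0.
under eq_esum do rewrite EFinM.
rewrite esumZl; [|by rewrite invr_ge0 mulr_ge0// ltW|by move=> s; rewrite lee_fin ltW// geom_ker_gt0].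
apply: le_trans (lee_wpmul2l _ (geom_ker_sum k rho01)) _; first by rewrite lee_fin invr_ge0 mulr_ge0// ltW.
by rewrite -EFinM lee_fin invfM -mulrA mulVf ?mulr1// lt0r_neq0.
Qed.

(** The point [t] lies in the box [k].  The exceptional null set of the
    representation is one more term of the sum, with infinite values and zero
    rearrangement. *)
Lemma star_expansion n (X : 'I_n -> symmetric_space R) (phi : 'I_n -> R -> R)
    (f : n.-tuple R -> R[i]) (A : R) (a : n.-tuple nat -> R) (rho : R)
    (k : n.-tuple nat) (t : n.-tuple R) :
  (forall j, fundamental_function (X j) (phi j)) ->
  (forall j, Phi_function (phi j)) ->
  (forall j, (dil_upper (phi j) < 2%:E)%E) ->
  aniso_space0 X f ->
  0 <= A -> (aniso_norm X f <= A%:E)%E ->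
  (forall s, 0 <= a s) -> (forall s, (aniso_norm X (dyadic_block s f) <= (a s)%:E)%E) ->
  (\esum_(s in [set: n.-tuple nat]) (a s)%:E < +oo)%E ->
  0 < rho < 1 ->
  (forall j, 2 ^- (tnth k j).+1 < tnth t j <= 2 ^- tnth k j) ->
  (star (norm_of f) t <= \esum_(s in [set: n.-tuple nat])
     (expansion_const n rho * (geom_ker rho k s ^+ n)^-1 *
      (a s * \prod_j (phi j (Num.max (2 ^- tnth k j) (2 ^- tnth s j)))^-1))%:E)%E.
Proof.
move=> Xphi phiP phi2 [[[mRe mIm _] _] mean0] A0 fA a0 fa asum rho01 tk.
have p2 (k' : nat) := @half_pow_range R k'.
have t01 j : 0 < tnth t j <= 1.
  have /andP[t0 t1] := tk j; have /andP[_ k1] := p2 (tnth k j).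
  by rewrite (le_trans t1 k1) andbT (lt_trans _ t0)//; have /andP[] := p2 (tnth k j).+1.
have tpos j : 0 < tnth t j by have /andP[] := t01 j.
have phi0 j (k' : nat) : 0 < phi j (2 ^- k') by exact: Phi_gt0.
pose B j := fine (\sum_(i <oo) (2 ^- i / phi j (2 ^- i))%:E)%E.
have phi_sum j : (\sum_(i <oo) (2 ^- i / phi j (2 ^- i))%:E <= (B j)%:E)%E.
  have term0 i : (0 <= (2 ^- i / phi j (2 ^- i))%:E)%E.
    by rewrite lee_fin divr_ge0// ltW//; have /andP[] := p2 i.
  rewrite fineK// ge0_fin_numE; first exact: dilation_summable.
  by apply: nneseries_ge0 => i _ _.
have star_f u : (forall j, 0 < tnth u j <= 1) ->
    (star (norm_of f) u <= (A * \prod_j (phi j (tnth u j))^-1)%:E)%E.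
  by move=> u01; exact: star_aniso_norm fA.
have star_block s u : (forall j, 0 < tnth u j <= 1) ->
    (star (norm_of (dyadic_block s f)) u <= (a s * \prod_j (phi j (tnth u j))^-1)%:E)%E.
  by move=> u01; exact: star_aniso_norm (fa s).
have [N [mN N0 repr]] := dyadic_representation phi0 phi_sum (conj mRe mIm) A0 a0 star_f star_block asum mean0.
(* None stands for the exceptional null set. *)
pose Fi (o : option (n.-tuple nat)) (x : n.-tuple R) : \bar R := match o with
  | Some s => cell_sup s (norm_of (dyadic_block s f)) x
  | None => if `[< N x >] then +oo%E else 0%E end.
pose v (o : option (n.-tuple nat)) : R := oapp (block_weight rho k) 4^-1 o.
have v0 o : 0 < v o by case: o => [s|] /=; [exact: block_weight_gt0|rewrite invr_gt0].
have Fi0 o x : (0 <= Fi o x)%E.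
  case: o => [s|] /=; last by case: asboolP.
  by apply: le_trans (cell_sup_ge s _ _); rewrite lee_fin normc_ge0.
have v1 : (\esum_(o in [set: option (n.-tuple nat)]) (v o)%:E < 1)%E.
  rewrite esum_option; last by move=> o; rewrite lee_fin ltW.
  apply: le_lt_trans (leeD2l _ (block_weight_sum _ rho01)) _ => /=.
  by rewrite -EFinD lte_fin; lra.
apply: le_trans (star_esum (Fi := Fi) tpos v0 v1 Fi0 _) _.
  move=> x xT; rewrite esum_option//=; case: asboolP => [Nx|Nx].
    by rewrite addye ?leey// gt_eqF// (lt_le_trans ltNy0)// esum_ge0// => s _; exact: (Fi0 (Some s)).
  rewrite add0e; apply: le_trans (repr _ xT Nx) _; apply: le_esum => s _.
  exact: cell_sup_ge.
rewrite esum_option; last by move=> o; exact: star_ge0.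
have -> : star (Fi None) (tscale (v None) t) = 0%E.
  by apply: star_null => // j; rewrite tnth_tscale mulr_gt0.
rewrite add0e; apply: le_esum => s _.
have [w wE] : exists w, w = v (Some s) by exists (v (Some s)).
have w0 : 0 < w by rewrite wE.
rewrite -wE.
have w1 : w <= 1.
  rewrite wE -lee_fin; apply: le_trans (ltW v1); apply: (esum_term (Some s)) => o.
  by rewrite lee_fin ltW.
have wt01 j : 0 < tnth (tscale w t) j <= 1.
  have /andP[t0 t1] := t01 j; rewrite tnth_tscale mulr_gt0//=.
  by rewrite -[leRHS]mulr1; apply: ler_pM => //; exact: ltW.
apply: le_trans (star_cell_sup phiP (a0 s) (star_block s) _ _ wt01) _.
- by move=> x j; rewrite dyadic_block_periodic.
- by move=> x y; exact: sampling_bound.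
have K0 := ltW (@majorant_const_gt0 R n).
have gk0 : 0 < geom_ker rho k s by apply: geom_ker_gt0; have /andP[] := rho01.
rewrite lee_fin.
apply: (@le_trans _ _ (majorant_const n * a s * \prod_j (2 / w * (phi j (Num.max (2 ^- tnth k j) (2 ^- tnth s j)))^-1))).
  apply: ler_wpM2l; first by rewrite mulr_ge0.
  apply: ler_prod => j _; set m := Num.max (2 ^- tnth k j) _.
  have m01 : 0 < m <= 1.
    have /andP[k0 k1] := p2 (tnth k j); have /andP[s0 s1] := p2 (tnth s j).
    by rewrite /m lt_max k0 ge_max k1 s1.
  have /andP[m0 m1] := m01; have /andP[u0 u1] := wt01 j.
  have m'01 : 0 < Num.max (tnth (tscale w t) j) (2 ^- tnth s j) <= 1.
    by rewrite lt_max u0 ge_max u1 /=; have /andP[] := p2 (tnth s j).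
  have pm := Phi_gt0 (phiP j) m01; have pm' := Phi_gt0 (phiP j) m'01.
  rewrite invr_ge0 (ltW pm') /= -[2 / w]invf_div -invfM lef_pV2 ?posrE ?mulr_gt0 ?divr_gt0//.
  have w2 : 0 <= w / 2 <= 1 by apply/andP; split; lra.
  apply: le_trans (@Phi_scale _ _ (phiP j) _ m w2 _) _; first by rewrite (ltW m0).
  have /andP[m'0 m'1] := m'01; apply: Phi_mono => //; first by rewrite mulr_ge0 ?divr_ge0// ltW.
  have /andP[tk0 _] := tk j; have s0 : 0 < 2 ^- tnth s j :> R by have /andP[] := p2 (tnth s j).
  have halves : 2 * 2 ^- (tnth k j).+1 = 2 ^- tnth k j :> R := half_powS _.
  rewrite /m maxr_pMr ?divr_ge0 ?(ltW w0)// ge_max !le_max tnth_tscale; apply/andP; split; apply/orP.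
    by left; rewrite -mulrA ler_pM2l//; lra.
  by right; rewrite ler_piMl ?(ltW s0)//; have /andP[] := w2.
rewrite big_split /= prodr_const card_ord wE /= /block_weight /expansion_const.
rewrite le_eqVlt; apply/orP; left; apply/eqP.
set c := 4 * _; set g := geom_ker rho k s.
have c0 : c != 0.
  by rewrite lt0r_neq0// /c mulr_gt0// exprn_gt0// divr_gt0// subr_gt0; have /andP[] := rho01.
rewrite (_ : 2 / (c^-1 * g) = 2 * c / g); last by rewrite invfM invrK mulrA.
by rewrite expr_div_n; ring.
Qed.

End embedding.

Section embedding_constant.
Context {R : realType}.

Lemma common_bound n (x : 'I_n -> R) : (forall j, 0 < x j < 1) ->
  exists2 rho, 0 < rho < 1 & forall j, x j <= rho.
Proof.
move=> x01; exists (\big[Num.max/2^-1]_j x j); last by move=> j; exact: le_bigmax.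
rewrite (lt_le_trans _ (bigmax_ge_id _ _ _ _)) ?invr_gt0//=.
by apply: bigmax_lt => [|j _]; [lra|have /andP[] := x01 j].
Qed.

(** The ratio of the weights: the decay [q_j] has to compensate for the [n]-th power
    of the weights, with as much again left over. *)
Lemma common_root n (q : 'I_n -> R) : (forall j, 0 < q j < 1) ->
  exists2 rho, 0 < rho < 1 & forall j, q j <= (rho ^+ n) ^+ 2.
Proof.
move=> q01; have [Q /andP[Q0 Q1] qQ] := common_bound q01.
case: n q q01 qQ => [|n] q q01 qQ; first by exists 2^-1 => [|[]]//; lra.
set d : R := (n.+1 * 2)%:R^-1; have d0 : 0 < d by rewrite invr_gt0 ltr0n.
exists (Q `^ d).
  rewrite powR_gt0//=; have := @gt0_ltr_powR R d d0 Q 1; rewrite powR1; apply => //.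
    by rewrite nnegrE ltW.
  by rewrite nnegrE ler01.
move=> j; rewrite -exprM -powR_mulrn ?powR_ge0// -powRrM mulVf ?pnatr_eq0//.
by rewrite powRr1// ltW.
Qed.

Lemma esum_lty_of_decay n (x : 'I_n -> R) (a : n.-tuple nat -> R) :
  (forall j, 0 < x j < 1) -> (forall s, a s <= \prod_j x j ^+ tnth s j) ->
  (\esum_(s in [set: n.-tuple nat]) (a s)%:E < +oo)%E.
Proof.
move=> x01 ax; have [rho rho01 xrho] := common_bound x01.
apply: le_lt_trans (le_lt_trans (geom_ker_sum [tuple 0%N | j < n] rho01) (ltry _)).
apply: le_esum => s _; rewrite lee_fin; apply: le_trans (ax s) _.
apply: ler_prod => j _; have /andP[xj0 _] := x01 j; rewrite exprn_ge0 ?(ltW xj0)//=.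
rewrite tnth_mktuple /nat_dist sub0n subn0 add0n; apply: lerXn2r; rewrite ?nnegrE ?(ltW xj0)//.
by have /andP[/ltW] := rho01.
Qed.

(** The boxes of the Lorentz norm are compared with the blocks of the Besov norm
    through the geometric kernel of ratio [rho ^ n]. *)
Lemma lorentz_besov n (theta : 'I_n -> \bar R)
    (tau r : 'I_n -> R) (X : 'I_n -> symmetric_space R) (phi psi : 'I_n -> R -> R) :
  (1 <= n)%N -> (forall j, (1 <= theta j)%E) -> (forall j, 1 <= tau j) -> (forall j, 0 < r j) ->
  (forall j, fundamental_function (X j) (phi j)) ->
  (forall j, Phi_function (phi j)) -> (forall j, Phi_function (psi j)) ->
  (forall j, (1 < dil_lower (psi j))%E) ->
  (forall j, (dil_upper (psi j) < dil_lower (phi j))%E) ->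
  (forall j, (dil_upper (phi j) < 2%:E)%E) ->
  (forall j, (seq_norm (epsilon (theta j) (tau j))
     (fun s : nat => (psi j (2 ^- s) / phi j (2 ^- s) * 2 `^ (- (s%:R * r j)))%:E)
     < +oo)%E) ->
  exists2 C : R, 0 < C & forall f, besov_class X r theta f ->
    (lorentz_norm psi tau f <= C%:E * besov_norm X r theta f)%E.
Proof.
move=> n1 theta1 tau1 r0 Xphi phiP psiP psi1 psiphi phi2 summable.
have p2 (k : nat) := @half_pow_range R k.
have phi0 j (k : nat) : 0 < phi j (2 ^- k) by exact: Phi_gt0.
have psi0 j (k : nat) : 0 < psi j (2 ^- k) by exact: Phi_gt0.
have /choice[qC qCP] : forall j, exists qC : R * R, [/\ 0 < qC.1 < 1, 0 < qC.2 & forall k s : nat,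
    psi j (2 ^- k) / phi j (Num.max (2 ^- k) (2 ^- s)) <=
    qC.2 * qC.1 ^+ nat_dist k s * (psi j (2 ^- s) / phi j (2 ^- s))].
  move=> j; have [q q01 [C C0 qC]] := dilation_kernel (phiP j) (psiP j) (psi1 j) (psiphi j).
  by exists (q, C).
have [rho rho01 qrho] : exists2 rho, 0 < rho < 1 & forall j, (qC j).1 <= (rho ^+ n) ^+ 2.
  by apply: common_root => j; have [] := qCP j.
have /andP[rho0 rho1] := rho01.
have p01 : 0 < rho ^+ n < 1 by rewrite exprn_gt0//= exprn_ilt1 ?ltW// -lt0n.
have [C1 C10 H1] := geom_ker_bounded p01 tau1.
pose b j (k : nat) : R := psi j (2 ^- k) / phi j (2 ^- k) * 2 `^ (- (k%:R * r j)).
have b0 j k : 0 < b j k by rewrite mulr_gt0 ?powR_gt0// divr_gt0.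
have [C2 C20 H2] := mixed_seq_hoelder theta1 tau1 b0 summable.
have tau0 j : 0 < tau j := lt_le_trans ltr01 (tau1 j).
pose D := \prod_j (qC j).2.
have D0 : 0 < D by apply: prodr_gt0 => j _; have [] := qCP j.
pose K := expansion_const n rho * D.
have E0 : 0 < expansion_const n rho by exact: expansion_const_gt0.
have K0 : 0 < K by rewrite mulr_gt0.
(* The 1 only makes the constant positive. *)
exists (C1 * (K * C2) + 1).
  by rewrite ltr_wpDl// mulr_ge0// mulr_ge0// ltW.
move=> f [f0 bes].
pose W (s : n.-tuple nat) : R := \prod_(j < n) 2 `^ ((tnth s j)%:R * r j).
have W1 s : 1 <= W s.
  have -> : 1 = \prod_(j < n) (1 : R) by rewrite big1.
  rewrite /W; apply: ler_prod => j _.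
  rewrite ler01 /= -[leLHS](powRr0 (2 : R)); apply: ler_powR; first by lra.
  by rewrite mulr_ge0// ltW.
have W0 s : 0 < W s := lt_le_trans ltr01 (W1 s).
pose M := mixed_seq_norm theta (fun s => (W s)%:E * aniso_norm X (dyadic_block s f))%E.
have WA0 s : (0 <= (W s)%:E * aniso_norm X (dyadic_block s f))%E.
  by rewrite mule_ge0 ?aniso_norm_ge0// lee_fin ltW.
have M0 : (0 <= M)%E by exact: mixed_seq_ge0.
have nf0 : (0 <= aniso_norm X f)%E by exact: aniso_norm_ge0.
have Mbes : (M <= besov_norm X r theta f)%E by rewrite leeDr.
have M1 : (M <= 1)%E by exact: le_trans bes.
have nf1 : (aniso_norm X f <= 1%:E)%E.
  by apply: le_trans bes; rewrite leeDl.
have WA1 s : ((W s)%:E * aniso_norm X (dyadic_block s f) <= 1)%E.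
  by apply: le_trans M1; exact: (mixed_seq_term s theta1 WA0).
pose a s := fine (aniso_norm X (dyadic_block s f)).
have aE s : aniso_norm X (dyadic_block s f) = (a s)%:E.
  rewrite fineK// ge0_fin_numE ?aniso_norm_ge0//; apply: le_lt_trans (ltry 1).
  by apply: le_trans (WA1 s); apply: lee_pemull; rewrite ?aniso_norm_ge0 ?lee_fin.
have a0 s : 0 <= a s by rewrite fine_ge0// aniso_norm_ge0.
have asum : (\esum_(s in [set: n.-tuple nat]) (a s)%:E < +oo)%E.
  apply: (@esum_lty_of_decay _ (fun j => 2 `^ (- r j))).
    move=> j; rewrite powR_gt0//= powRN invf_lt1 ?powR_gt0//.
    by have := @gt0_ltr_powR R _ (r0 j) 1 2; rewrite powR1 !nnegrE; apply => //; lra.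
  move=> s; have := WA1 s; rewrite aE -EFinM lee_fin -ler_pdivlMl// mulr1.
  move=> /le_trans; apply; rewrite /W -prodfV le_eqVlt; apply/orP; left; apply/eqP.
  by apply: eq_bigr => j _; rewrite -powR_mulrn ?powR_ge0// -powRrM -powRN mulNr mulrC.
pose B s : \bar R := (K%:E * ((\prod_(j < n) b j (tnth s j))%:E * ((W s)%:E * (a s)%:E)))%E.
have B'0 s : (0 <= (\prod_(j < n) b j (tnth s j))%:E * ((W s)%:E * (a s)%:E))%E.
  by rewrite -!EFinM lee_fin mulr_ge0 ?mulr_ge0 ?(ltW (W0 s))//; apply: prodr_ge0 => j _; exact: ltW.
have B0 s : (0 <= B s)%E by rewrite mule_ge0// lee_fin ltW.
pose phimax (k s : n.-tuple nat) j := phi j (Num.max (2 ^- tnth k j) (2 ^- tnth s j)).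
have phimax0 k s j : 0 < phimax k s j.
  apply: Phi_gt0 => //; have /andP[k0 k1] := p2 (tnth k j); have /andP[_ s1] := p2 (tnth s j).
  by rewrite lt_max k0 ge_max k1 s1.
pose T k s : R := expansion_const n rho * (geom_ker rho k s ^+ n)^-1 * (a s * \prod_j (phimax k s j)^-1).
have T0 k s : 0 <= T k s.
  rewrite mulr_ge0//; first by rewrite mulr_ge0 ?(ltW E0)// invr_ge0 exprn_ge0// ltW// geom_ker_gt0.
  by rewrite mulr_ge0//; apply: prodr_ge0 => j _; rewrite invr_ge0 ltW.
apply: le_trans (lorentz_mixed_dyadic (F := iterated_rearrangement f)
  (a := fun k => \esum_(s in [set: n.-tuple nat]) (T k s)%:E)%E psiP tau1 _ _ _) _.
- by move=> x; rewrite iterated_rearrangementE; apply: star_ge0 => y _; rewrite lee_fin normc_ge0.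
- by move=> k; apply: esum_ge0 => s _; rewrite lee_fin.
- move=> k x xk; rewrite iterated_rearrangementE.
  apply: (star_expansion Xphi phiP phi2 f0 _ nf1 a0 _ asum rho01 xk); first exact: ler01.
  by move=> s; rewrite aE.
have taue j : (1 <= (tau j)%:E)%E by rewrite lee_fin.
apply: (@le_trans _ _ (mixed_seq_norm (fun j => (tau j)%:E)
    (fun k => \esum_(s in [set: n.-tuple nat]) ((geom_ker (rho ^+ n) k s)%:E * B s)))%E).
  have P0 k : 0 <= \prod_(j < n) psi j (2 ^- tnth k j) by apply: prodr_ge0 => j _; exact: ltW.
  apply: le_mixed_seq => // k.
    by rewrite mule_ge0 ?lee_fin//; apply: esum_ge0 => s _; rewrite lee_fin.
  rewrite -esumZl//; last by move=> s; rewrite lee_fin.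
  apply: le_esum => s _.
  rewrite /B -!EFinM lee_fin /T.
  have g0 := geom_ker_gt0 k s rho0.
  have gE := geom_ker_exp rho n k s.
  have bW : \prod_(j < n) b j (tnth s j) * W s = \prod_(j < n) (psi j (2 ^- tnth s j) / phi j (2 ^- tnth s j)).
    rewrite /W -big_split /=; apply: eq_bigr => j _; rewrite /b powRN.
    by rewrite divfK// gt_eqF// powR_gt0.
  (* One power of the kernel of ratio rho ^ n pays for the weights of
     star_expansion; the other one is the kernel kept in the sum. *)
  have key : \prod_(j < n) psi j (2 ^- tnth k j) * \prod_j (phimax k s j)^-1 <=
      D * geom_ker (rho ^+ n) k s ^+ 2 * (\prod_(j < n) b j (tnth s j) * W s).
    rewrite bW /D -geom_ker_exp /geom_ker -!big_split /=; apply: ler_prod => j _.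
    have [/andP[q0 _] c0 kj] := qCP j.
    rewrite divr_ge0 ?(ltW (psi0 _ _)) ?(ltW (phimax0 _ _ _))//=; apply: le_trans (kj _ _) _.
    apply: ler_wpM2r; first by rewrite divr_ge0// ltW.
    apply: ler_wpM2l; first exact: ltW.
    by apply: lerXn2r; rewrite ?nnegrE ?(ltW q0) ?exprn_ge0 ?(ltW rho0).
  rewrite /K.
  set Ps := \prod_(j < n) psi j _ in key *; set Ph := \prod_j _^-1 in key *.
  set bb := \prod_(j < n) b j _ in key *; rewrite gE in key *.
  set g := geom_ker rho k s ^+ n in key *.
  have gp : 0 < g by rewrite exprn_gt0.
  have c0 : 0 <= expansion_const n rho * g^-1 * a s by rewrite mulr_ge0// mulr_ge0 ?invr_ge0// ltW.
  have -> : Ps * (expansion_const n rho * g^-1 * (a s * Ph)) =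
    expansion_const n rho * g^-1 * a s * (Ps * Ph) by ring.
  apply: le_trans (ler_wpM2l c0 key) _; rewrite le_eqVlt; apply/orP; left; apply/eqP.
  by have gN := lt0r_neq0 gp; field.
apply: le_trans (H1 _ B0) _.
rewrite /B mixed_seq_scale//; last exact: ltW.
apply: (@le_trans _ _ (C1%:E * (K%:E * (C2%:E * M)))%E).
  apply: lee_wpmul2l; first by rewrite lee_fin.
  apply: lee_wpmul2l; first by rewrite lee_fin ltW.
  rewrite (_ : (fun s => _) = (fun s : n.-tuple nat => (\prod_(j < n) b j (tnth s j))%:E *
     ((W s)%:E * aniso_norm X (dyadic_block s f)))%E).
    exact: H2.
  by apply/funext => s; rewrite aE.
rewrite !muleA -!EFinM; apply: le_trans (lee_wpmul2l _ Mbes) _.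
  by rewrite lee_fin mulr_ge0// mulr_ge0// ltW.
apply: lee_wpmul2r; first exact: le_trans Mbes.
by rewrite lee_fin -mulrA lerDl.
Qed.

End embedding_constant.

Theorem theorem3 (R : realType) (m : nat) (theta : 'I_m -> \bar R)
    (tau r : 'I_m -> R) (X : 'I_m -> symmetric_space R)
    (phi psi : 'I_m -> R -> R)
    (m_ge1 : (1 <= m)%N)
    (theta_ge1 : forall j, (1 <= theta j)%E)
    (tau_ge1 : forall j, 1 <= tau j)
    (r_gt0 : forall j, 0 < r j)
    (phi_fundamental : forall j, fundamental_function (X j) (phi j))
    (phi_Phi : forall j, Phi_function (phi j))
    (psi_Phi : forall j, Phi_function (psi j))
    (indices : forall j,
      (1 < dil_lower (psi j))%E /\
      (dil_lower (psi j) <= dil_upper (psi j))%E /\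
      (dil_upper (psi j) < dil_lower (phi j))%E /\
      (dil_lower (phi j) <= dil_upper (phi j))%E /\
      (dil_upper (phi j) < 2%:E)%E)
    (summable : forall j,
      (seq_norm (epsilon (theta j) (tau j))
         (fun s : nat =>
            (psi j (2 ^- s) / phi j (2 ^- s) * 2 `^ (- (s%:R * r j)))%:E)
       < +oo)%E) :
  besov_class X r theta `<=` lorentz_space psi tau /\
  exists2 C : R, 0 < C &
    forall f, besov_class X r theta f ->
      (lorentz_norm psi tau f <= C%:E * besov_norm X r theta f)%E.
Proof.
have [C C0 bound] := lorentz_besov m_ge1 theta_ge1 tau_ge1 r_gt0 phi_fundamental phi_Phi psi_Phi
  (fun j => (indices j).1) (fun j => (indices j).2.2.1) (fun j => (indices j).2.2.2.2) summable.
split; last by exists C.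
move=> f fB; have [[[f_torus _] _] f1] := fB; split=> //.
apply: le_lt_trans (bound f fB) _; apply: (@le_lt_trans _ _ (C%:E * 1)%E).
  by apply: lee_wpmul2l f1; rewrite lee_fin ltW.
by rewrite mule1 ltry.
Qed.
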